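(* For every real $\nu\ge 0$ and every real $x>\nu$, $$\max\left\{\underline{\theta}_\nu(x),\,-\frac{\pi}{2}\right\}<\theta_\nu(x)<\widetilde{\theta}_\nu(x).$$
   Context: $J_\nu,Y_\nu$ are the standard Bessel functions of the first and second kind of order $\nu\ge 0$. The Bessel modulus and phase functions $M_\nu,\theta_\nu:(0,+\infty)\to\mathbb{R}$ are defined by $M_\nu(x)=\sqrt{J_\nu(x)^2+Y_\nu(x)^2}$ and $J_\nu(x)+\mathrm{i}Y_\nu(x)=M_\nu(x)\left(\cos\theta_\nu(x)+\mathrm{i}\sin\theta_\nu(x)\right)$, where $\theta_\nu$ is the continuous branch with $\lim_{x\to0^+}\theta_\nu(x)=-\frac{\pi}{2}$. For $x>\nu\ge0$ define $$\widetilde{\theta}_\nu(x):=\sqrt{x^2-\nu^2}-\nu\arccos\frac{\nu}{x}-\frac{\pi}{4},\qquad \underline{\theta}_\nu(x):=\widetilde{\theta}_\nu(x)-\frac{3x^2+2\nu^2}{24(x^2-\nu^2)^{3/2}}.$$ *)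

(* Defs.v *)
From Stdlib Require Import Reals Factorial.
From Coquelicot Require Import Coquelicot.
Open Scope R_scope.

(* 1 / Gamma(z) for every real z, by Gauss's limit
   1 / Gamma(z) = lim_n  z (z+1) ... (z+n) / (n! n^z);
   it vanishes at the poles z = 0, -1, -2, ... of Gamma. *)
Definition rgamma (z : R) : R :=
  real (Lim_seq (fun n : nat =>
    prod_f_R0 (fun k : nat => z + INR k) n / (INR (fact n) * Rpower (INR n) z))).

(* J_nu(x) = (x/2)^nu sum_k (-1)^k (x^2/4)^k / (k! Gamma(nu+k+1)), for x > 0
   and any real order nu.  For x <= 0 the value is meaningless. *)
Definition bessel_J (nu x : R) : R :=
  Rpower (x / 2) nu *
  PSeries (fun k : nat => (-1) ^ k / INR (fact k) * rgamma (nu + INR k + 1))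
          (x ^ 2 / 4).

Definition bessel_Y_quotient (x nu : R) : R :=
  (bessel_J nu x * cos (nu * PI) - bessel_J (- nu) x) / sin (nu * PI).

(* The quotient itself for non-integer order; its limit mu -> nu for integer
   order, i.e. when sin (nu * PI) = 0.  Only x > 0 is meaningful. *)
Definition bessel_Y (nu x : R) : R :=
  if Req_EM_T (sin (nu * PI)) 0
  then real (Lim (bessel_Y_quotient x) (Finite nu))
  else bessel_Y_quotient x nu.

Definition bessel_modulus (nu x : R) : R :=
  sqrt (bessel_J nu x ^ 2 + bessel_Y nu x ^ 2).

(* These conditions determine theta on (0, +oo); its values elsewhere are
   unconstrained. *)
Definition is_bessel_phase (nu : R) (theta : R -> R) : Prop :=
  (forall x : R, 0 < x -> continuous theta x) /\
  (forall x : R, 0 < x ->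
     bessel_J nu x = bessel_modulus nu x * cos (theta x) /\
     bessel_Y nu x = bessel_modulus nu x * sin (theta x)) /\
  filterlim theta (at_right 0) (locally (- (PI / 2))).

Definition theta_tilde (nu x : R) : R :=
  sqrt (x ^ 2 - nu ^ 2) - nu * acos (nu / x) - PI / 4.

Definition theta_under (nu x : R) : R :=
  theta_tilde nu x -
  (3 * x ^ 2 + 2 * nu ^ 2) / (24 * Rpower (x ^ 2 - nu ^ 2) (3 / 2)).

(* Main.v *)
Require Import Defs.
From Stdlib Require Import Reals Lra Lia Psatz ZArith Factorial.
From Coquelicot Require Import Coquelicot.
Open Scope R_scope.

(** Why the enclosure holds.  Put [x = e^t].  Bessel's equation becomes
    [y'' + (x^2 - nu^2) y = 0] in [t], and [theta] is a phase function of it: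
    every solution is a modulus times the sine of [theta] minus a constant.  The
    two approximations are phase functions as well, of explicit equations
    [y'' + Q y = 0].  The one belonging to [theta_tilde] has [Q < x^2 - nu^2]
    for [x > nu]; the one belonging to [theta_under] has [Q > x^2 - nu^2],
    which after clearing denominators is a polynomial with positive coefficients
    ([under_polynomial_pos]).  By Sturm's theorem, while the phase of the larger
    potential advances by a half-turn the other one advances by less
    ([sturm_phase]).  Hence two phases that agree at infinity are ordered
    oppositely to their potentials ([phase_comparison]), and both bounds follow
    once [theta] is known to have the asymptotics
    [x - nu pi/2 - pi/4 + o(1)] of the two approximations.  The remaining bound
    [theta > -pi/2] is the monotonicity of [theta], that is, the positivity of
    the Wronskian of [J_nu] and [Y_nu].

    The asymptotics modulo [2 pi] is a statement about connection constants: the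
    definitions are power series at 0, the information is needed at infinity.  On
    the positive imaginary axis, up to a constant factor, the series of [J_nu] has
    terms that are eventually positive and comparable with those of cosh times a
    power of the index; since the terms of cosh are sharply concentrated, the
    series is asymptotic to a constant times [e^r / sqrt r], and the modulus of
    that constant does not depend on [nu]
    ([concentration], [besselI_grows_all]).  The coefficient of [e^(-iz)] in
    [sqrt z J_nu z], read off from the function and its derivative at a point of
    modulus [r], changes by [O(1/r)] along the quarter circle leading to the
    positive real axis ([wave_arc]).  This gives the amplitude and the phase of
    [J_nu] on the real axis for every real order ([J_asymptotic]).  For
    non-integer order [Y_nu] is a combination of [J_nu] and [J_(-nu)], and the
    independence of the constant from the order makes its amplitude equal to that
    of [J_nu].  For integer order [Y_nu] is a limit in the order; solutions depend
    continuously on the order and on their data at infinity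
    ([limit_of_solutions]), so the asymptotics persists ([Y_solution]).

    The multiple of [2 pi] is then found to be 0 by the comparison itself, which
    gives both bounds up to that multiple ([bessel_phase_asymptotic]): it cannot be
    negative because [theta > -pi/2] while [theta_tilde] is close to [-pi/4] near
    [x = nu], and it cannot be positive because [J_nu > 0], hence
    [theta < pi/2], up to a point beyond [nu] at which [theta_under] is still not
    far below [-pi/4] ([J_positive_past_turning_point]). *)

(** * Elementary analysis *)

(** Evaluates the formal derivatives that remain after symbolic
    differentiation, from the derivatives known in the context. *)
Ltac derive_values :=
  repeat match goal with
  | H : is_derive _ ?t ?l |- context [Derive ?g ?t] =>
      replace (Derive g t) with l by (symmetry; apply is_derive_unique; exact H)
  end.

Lemma mvt (f f' : R -> R) (a b : R) :
  a < b -> (forall x, a <= x <= b -> is_derive f x (f' x)) ->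
  exists c, a < c < b /\ f b - f a = f' c * (b - a).
Proof.
  intros Hab Hf.
  destruct (MVT_cor2 f f' a b Hab) as [c [Hc Hc']].
  - intros x Hx. now apply is_derive_Reals, Hf.
  - exists c. split; [exact Hc'|exact Hc].
Qed.

Lemma nondecreasing_of_derive (f f' : R -> R) (a b : R) :
  a <= b -> (forall x, a <= x <= b -> is_derive f x (f' x)) ->
  (forall x, a < x < b -> 0 <= f' x) -> f a <= f b.
Proof.
  intros Hab Hf Hpos.
  destruct (Req_dec a b) as [->|Hne]; [lra|].
  destruct (mvt f f' a b) as [c [Hc Heq]]; [lra|exact Hf|].
  specialize (Hpos c Hc). nra.
Qed.

Lemma increasing_of_derive (f f' : R -> R) (a b : R) :
  a < b -> (forall x, a <= x <= b -> is_derive f x (f' x)) ->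
  (forall x, a < x < b -> 0 < f' x) -> f a < f b.
Proof.
  intros Hab Hf Hpos.
  destruct (mvt f f' a b) as [c [Hc Heq]]; [lra|exact Hf|].
  specialize (Hpos c Hc). nra.
Qed.

Lemma taylor_quadratic (f f' f'' : R -> R) (x y d K : R) :
  Rabs (y - x) < d ->
  (forall z, Rabs (z - x) < d ->
     is_derive f z (f' z) /\ is_derive f' z (f'' z) /\ Rabs (f'' z) <= K) ->
  Rabs (f y - f x - f' x * (y - x)) <= K * (y - x) ^ 2.
Proof.
  intros Hy Hf.
  assert (HK : 0 <= K).
  { destruct (Hf y Hy) as [_ [_ H]]. pose proof (Rabs_pos (f'' y)). lra. }
  assert (Hrange : forall z, Rmin x y <= z <= Rmax x y -> Rabs (z - x) <= Rabs (y - x)).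
  { intros z Hz. revert Hz. unfold Rmin, Rmax.
    destruct (Rle_dec x y); intros Hz; unfold Rabs;
      destruct (Rcase_abs (z - x)), (Rcase_abs (y - x)); lra. }
  destruct (MVT_gen f x y f') as [c [Hc Heq]].
  - intros z Hz. apply Hf. specialize (Hrange z). lra.
  - intros z Hz. apply derivable_continuous_pt. exists (f' z).
    apply is_derive_Reals, Hf. specialize (Hrange z). lra.
  - destruct (MVT_gen f' x c f'') as [e [He Heq']].
    + intros z Hz. apply Hf. specialize (Hrange z).
      assert (Rmin x y <= z <= Rmax x y).
      { revert Hz Hc. unfold Rmin, Rmax. destruct (Rle_dec x c), (Rle_dec x y); lra. }
      specialize (Hrange H). lra.
    + intros z Hz. apply derivable_continuous_pt. exists (f'' z).
      apply is_derive_Reals, Hf. specialize (Hrange z).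
      assert (Rmin x y <= z <= Rmax x y).
      { revert Hz Hc. unfold Rmin, Rmax. destruct (Rle_dec x c), (Rle_dec x y); lra. }
      specialize (Hrange H). lra.
    + rewrite Heq.
      replace (f' c * (y - x) - f' x * (y - x)) with (f'' e * (c - x) * (y - x))
        by (rewrite <- Heq'; ring).
      rewrite !Rabs_mult, <- (pow2_abs (y - x)).
      assert (He' : Rmin x y <= e <= Rmax x y).
      { revert He Hc. unfold Rmin, Rmax. destruct (Rle_dec x c), (Rle_dec x y); lra. }
      assert (H1 := Hrange e He').
      assert (H2 : Rabs (f'' e) <= K) by (apply Hf; lra).
      assert (H3 := Hrange c Hc).
      pose proof (Rabs_pos (f'' e)). pose proof (Rabs_pos (c - x)).
      pose proof (Rabs_pos (y - x)).
      replace (K * Rabs (y - x) ^ 2) with (K * Rabs (y - x) * Rabs (y - x)) by ring.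
      apply Rmult_le_compat_r; [lra|]. apply Rmult_le_compat; lra.
Qed.

(** A pointwise limit may be differentiated as soon as the second-order Taylor
    remainders are bounded uniformly: the quadratic bound passes to the limit.
    This serves both for termwise differentiation of series and for limits of
    solutions of differential equations. *)
Lemma is_derive_limit (g : nat -> R -> R) (g' : nat -> R) (f : R -> R) (x l d K : R) :
  0 < d ->
  (forall y, Rabs (y - x) < d -> is_lim_seq (fun n => g n y) (f y)) ->
  is_lim_seq g' l ->
  (forall n y, Rabs (y - x) < d ->
     Rabs (g n y - g n x - g' n * (y - x)) <= K * (y - x) ^ 2) ->
  is_derive f x l.
Proof.
  intros Hd Hlim Hl Hq.
  assert (Hx : Rabs (x - x) < d) by (rewrite Rminus_diag, Rabs_R0; exact Hd).
  assert (Hf : forall y, Rabs (y - x) < d ->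
            Rabs (f y - f x - l * (y - x)) <= K * (y - x) ^ 2).
  { intros y Hy.
    apply (is_lim_seq_le (fun n => Rabs (g n y - g n x - g' n * (y - x)))
             (fun _ => K * (y - x) ^ 2) (Rabs (f y - f x - l * (y - x)))
             (K * (y - x) ^ 2)).
    - intros n. now apply Hq.
    - apply (is_lim_seq_abs _ (f y - f x - l * (y - x))).
      apply is_lim_seq_minus'.
      + apply is_lim_seq_minus'; apply Hlim; assumption.
      + apply (is_lim_seq_mult' _ (fun _ => y - x) _ _ Hl). apply is_lim_seq_const.
    - apply is_lim_seq_const. }
  apply is_derive_Reals. intros eps Heps.
  assert (Hdel : 0 < Rmin d (eps / (Rabs K + 1))).
  { apply Rmin_glb_lt; [lra|]. apply Rdiv_lt_0_compat; [lra|].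
    pose proof (Rabs_pos K). lra. }
  exists (mkposreal _ Hdel). simpl. intros h Hh0 Hh.
  assert (Hh1 : Rabs h < d) by (eapply Rlt_le_trans; [exact Hh|apply Rmin_l]).
  assert (Hh2 : Rabs h < eps / (Rabs K + 1))
    by (eapply Rlt_le_trans; [exact Hh|apply Rmin_r]).
  specialize (Hf (x + h)). replace (x + h - x) with h in Hf by ring.
  specialize (Hf Hh1).
  replace ((f (x + h) - f x) / h - l) with ((f (x + h) - f x - l * h) / h)
    by (field; exact Hh0).
  unfold Rdiv. rewrite Rabs_mult, Rabs_inv.
  assert (Hhp : 0 < Rabs h) by now apply Rabs_pos_lt.
  apply (Rmult_lt_reg_r (Rabs h)); [exact Hhp|].
  rewrite Rmult_assoc, Rinv_l, Rmult_1_r by lra.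
  apply Rle_lt_trans with (1 := Hf).
  rewrite <- (pow2_abs h).
  pose proof (Rle_abs K). pose proof (Rabs_pos K).
  apply (Rmult_lt_compat_r (Rabs K + 1)) in Hh2; [|lra].
  unfold Rdiv in Hh2. rewrite Rmult_assoc, Rinv_l, Rmult_1_r in Hh2 by lra.
  nra.
Qed.

Lemma exp_nondecreasing (x y : R) : x <= y -> exp x <= exp y.
Proof.
  intros [H| ->]; [|lra]. left. now apply exp_increasing.
Qed.

Lemma exp_mul_opp (t : R) : exp t * exp (- t) = 1.
Proof. rewrite <- exp_plus, Rplus_opp_r. apply exp_0. Qed.

Lemma exp_double (t : R) : exp (2 * t) = exp t * exp t.
Proof. rewrite <- exp_plus. f_equal. ring. Qed.

Lemma sin_sq (x : R) : sin x * sin x = 1 - cos x * cos x.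
Proof. pose proof (sin2_cos2 x) as H. unfold Rsqr in H. lra. Qed.

Lemma exp_le_chord (z L : R) : 0 <= z <= 1 -> exp (z * L) <= 1 - z + z * exp L.
Proof.
  intros Hz.
  assert (H1 := exp_ineq1_le ((1 - z) * L)).
  assert (H2 := exp_ineq1_le (- (z * L))).
  assert (Hp := exp_pos (z * L)).
  replace (exp L) with (exp ((1 - z) * L) * exp (z * L))
    by (rewrite <- exp_plus; f_equal; ring).
  assert (E : 1 = exp (- (z * L)) * exp (z * L))
    by (rewrite <- exp_plus, Rplus_opp_l, exp_0; reflexivity).
  assert (H3 : 1 <= z * exp ((1 - z) * L) + (1 - z) * exp (- (z * L))) by nra.
  nra.
Qed.

(** Bernoulli's inequality for exponents in [0, 1]. *)
Lemma Rpower_le_linear (x z : R) : 0 <= z <= 1 -> 0 < x -> Rpower x z <= 1 + z * (x - 1).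
Proof.
  intros Hz Hx. unfold Rpower.
  pose proof (exp_le_chord z (ln x) Hz). rewrite exp_ln in H by exact Hx. lra.
Qed.

(** * The reciprocal Gamma function *)

Definition gauss (z : R) (n : nat) : R :=
  prod_f_R0 (fun k => z + INR k) n / (INR (fact n) * Rpower (INR n) z).

Lemma Rpower_pos (x y : R) : 0 < Rpower x y.
Proof. apply exp_pos. Qed.

Lemma prod_f_R0_pos (f : nat -> R) (n : nat) :
  (forall k, 0 < f k) -> 0 < prod_f_R0 f n.
Proof.
  intros Hf. induction n as [|n IH]; simpl; [apply Hf|].
  apply Rmult_lt_0_compat; [exact IH|apply Hf].
Qed.

Lemma prod_f_R0_shift (f : nat -> R) (n : nat) :
  f O * prod_f_R0 (fun k => f (S k)) n = prod_f_R0 f (S n).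
Proof.
  induction n as [|n IH]; simpl in *; [ring|].
  rewrite <- Rmult_assoc, IH. ring.
Qed.

Lemma gauss_pos (z : R) (n : nat) : 0 < z -> 0 < gauss z n.
Proof.
  intros Hz. apply Rdiv_lt_0_compat.
  - apply prod_f_R0_pos. intros k. pose proof (pos_INR k). lra.
  - apply Rmult_lt_0_compat; [apply INR_fact_lt_0|apply Rpower_pos].
Qed.

Lemma gauss_succ_index (z : R) (n : nat) :
  gauss z (S (S n)) =
  gauss z (S n) * ((1 + z / INR (S (S n))) * Rpower (INR (S n) / INR (S (S n))) z).
Proof.
  unfold gauss.
  assert (H1 : 0 < INR (S n)) by (apply lt_0_INR; lia).
  assert (H2 : 0 < INR (S (S n))) by (apply lt_0_INR; lia).
  assert (E : Rpower (INR (S n)) z =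
              Rpower (INR (S n) / INR (S (S n))) z * Rpower (INR (S (S n))) z).
  { rewrite Rpower_mult_distr; [|apply Rdiv_lt_0_compat; lra|lra].
    f_equal. field. lra. }
  rewrite E.
  change (prod_f_R0 (fun k => z + INR k) (S (S n)))
    with (prod_f_R0 (fun k => z + INR k) (S n) * (z + INR (S (S n)))).
  rewrite (fact_simpl (S n)), mult_INR.
  pose proof (INR_fact_lt_0 (S n)).
  pose proof (Rpower_pos (INR (S (S n))) z).
  pose proof (Rpower_pos (INR (S n) / INR (S (S n))) z).
  field. repeat split; lra.
Qed.


Lemma gauss_succ_arg (z : R) (n : nat) :
  gauss (z + 1) (S n) * z = gauss z (S n) * (1 + (z + 1) / INR (S n)).
Proof.
  unfold gauss.
  assert (H1 : 0 < INR (S n)) by (apply lt_0_INR; lia).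
  rewrite Rpower_plus, Rpower_1 by exact H1.
  pose proof (INR_fact_lt_0 (S n)).
  pose proof (Rpower_pos (INR (S n)) z).
  rewrite <- (prod_f_R0_shift (fun k => z + INR k)). cbv beta.
  change (prod_f_R0 (fun k => z + 1 + INR k) (S n))
    with (prod_f_R0 (fun k => z + 1 + INR k) n * (z + 1 + INR (S n))).
  assert (E : prod_f_R0 (fun k => z + INR (S k)) n = prod_f_R0 (fun k => z + 1 + INR k) n).
  { clear. induction n as [|n IH].
    - simpl; ring.
    - change (prod_f_R0 (fun k => z + INR (S k)) n * (z + INR (S (S n))) =
              prod_f_R0 (fun k => z + 1 + INR k) n * (z + 1 + INR (S n))).
      rewrite IH, (S_INR (S n)). ring. }
  rewrite E. simpl (INR 0). field. repeat split; lra.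
Qed.

Lemma is_lim_seq_inv_INR : is_lim_seq (fun n => / INR n) 0.
Proof.
  apply (is_lim_seq_inv _ p_infty); [apply is_lim_seq_INR|discriminate].
Qed.

Lemma is_lim_seq_gauss_factor (c : R) : is_lim_seq (fun n => 1 + c / INR (S n)) 1.
Proof.
  replace (Finite 1) with (Finite (1 + c * 0)) by (f_equal; ring).
  apply is_lim_seq_plus'; [apply is_lim_seq_const|].
  apply is_lim_seq_mult'; [apply is_lim_seq_const|].
  apply (is_lim_seq_incr_1 (fun n => / INR n)), is_lim_seq_inv_INR.
Qed.

(** On (0, 1] Bernoulli's inequality makes the Gauss quotients decrease while
    their product with 1 / (1 + z/n) increases; hence a positive limit. *)
Lemma gauss_lim_unit (z : R) :
  0 < z <= 1 -> exists l, 0 < l /\ is_lim_seq (gauss z) l.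
Proof.
  intros Hz.
  assert (Hdec : forall n, gauss z (S (S n)) <= gauss z (S n)).
  { intros n. rewrite gauss_succ_index.
    pose proof (gauss_pos z (S n) (proj1 Hz)) as Hg.
    assert (H1 : 0 < INR (S n)) by (apply lt_0_INR; lia).
    assert (H2 : INR (S (S n)) = INR (S n) + 1) by apply S_INR.
    assert (Hb := Rpower_le_linear (INR (S n) / INR (S (S n))) z).
    assert (Hq : INR (S n) / INR (S (S n)) = 1 - / INR (S (S n)))
      by (rewrite H2; field; lra).
    assert (Hi : 0 < / INR (S (S n)) ) by (apply Rinv_0_lt_compat; lra).
    assert (Hq0 : 0 < INR (S n) / INR (S (S n))) by (apply Rdiv_lt_0_compat; lra).
    specialize (Hb ltac:(lra) Hq0). rewrite Hq in Hb.
    rewrite <- Hq in Hb at 1.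
    set (i := / INR (S (S n))) in *.
    change (z / INR (S (S n))) with (z * i).
    set (p := Rpower _ _) in *.
    assert (0 < z * i) by nra.
    assert ((1 + z * i) * p <= 1) by nra.
    nra. }
  assert (Hinc : forall n, gauss z (S n) / (1 + z / INR (S n)) <=
                           gauss z (S (S n)) / (1 + z / INR (S (S n)))).
  { intros n. rewrite gauss_succ_index.
    pose proof (gauss_pos z (S n) (proj1 Hz)) as Hg.
    assert (H1 : 0 < INR (S n)) by (apply lt_0_INR; lia).
    assert (H2 : INR (S (S n)) = INR (S n) + 1) by apply S_INR.
    assert (Hb := Rpower_le_linear (INR (S (S n)) / INR (S n)) z).
    assert (Hq : INR (S (S n)) / INR (S n) = 1 + / INR (S n))
      by (rewrite H2; field; lra).
    assert (Hi : 0 < / INR (S n)) by (apply Rinv_0_lt_compat; lra).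
    specialize (Hb ltac:(lra) ltac:(lra)). rewrite Hq in Hb.
    rewrite <- Hq in Hb at 1.
    assert (Hp : Rpower (INR (S n) / INR (S (S n))) z *
                 Rpower (INR (S (S n)) / INR (S n)) z = 1).
    { rewrite Rpower_mult_distr; try (apply Rdiv_lt_0_compat; lra).
      replace (INR (S n) / INR (S (S n)) * (INR (S (S n)) / INR (S n))) with 1
        by (field; lra).
      unfold Rpower. rewrite ln_1, Rmult_0_r. apply exp_0. }
    set (p := Rpower (INR (S n) / INR (S (S n))) z) in *.
    set (q := Rpower (INR (S (S n)) / INR (S n)) z) in *.
    assert (0 < p) by apply Rpower_pos.
    assert (0 < z / INR (S n)) by (apply Rdiv_lt_0_compat; lra).
    assert (0 < z / INR (S (S n))) by (apply Rdiv_lt_0_compat; lra).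
    replace (gauss z (S n) * ((1 + z / INR (S (S n))) * p) / (1 + z / INR (S (S n))))
      with (gauss z (S n) * p) by (field; split; nra).
    apply Rmult_le_compat_l; [lra|].
    apply (Rmult_le_reg_r (1 + z / INR (S n))); [lra|].
    rewrite Rinv_l by lra. unfold Rdiv in *. nra. }
  assert (Hlow : forall n, gauss z 1 / (1 + z) <= gauss z (S n)).
  { intros n. apply Rle_trans with (gauss z (S n) / (1 + z / INR (S n))).
    - induction n as [|n IH].
      + right. f_equal. simpl. field.
      + apply Rle_trans with (1 := IH), Hinc.
    - pose proof (gauss_pos z (S n) (proj1 Hz)) as Hg.
      assert (0 < z / INR (S n)).
      { apply Rdiv_lt_0_compat; [lra|]. apply lt_0_INR; lia. }
      apply (Rmult_le_reg_r (1 + z / INR (S n))); [lra|].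
      unfold Rdiv at 1. rewrite Rmult_assoc, Rinv_l by lra. nra. }
  destruct (ex_finite_lim_seq_decr (fun n => gauss z (S n)) _ Hdec Hlow) as [l Hl].
  exists l. split.
  - apply Rlt_le_trans with (gauss z 1 / (1 + z)).
    + apply Rdiv_lt_0_compat; [apply gauss_pos|]; lra.
    + apply (is_lim_seq_le (fun _ => gauss z 1 / (1 + z)) _
               (gauss z 1 / (1 + z)) l Hlow); [apply is_lim_seq_const|exact Hl].
  - now apply is_lim_seq_incr_1.
Qed.

Lemma gauss_lim_up (z l : R) :
  0 < z -> is_lim_seq (gauss z) l -> is_lim_seq (gauss (z + 1)) (l / z).
Proof.
  intros Hz Hl. apply is_lim_seq_incr_1.
  apply is_lim_seq_ext with (fun n => gauss z (S n) * (1 + (z + 1) / INR (S n)) / z).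
  { intros n. rewrite <- gauss_succ_arg. field. lra. }
  replace (l / z) with (l * 1 / z) by (field; lra).
  apply is_lim_seq_div'; [|apply is_lim_seq_const|lra].
  apply is_lim_seq_mult'; [now apply -> is_lim_seq_incr_1|apply is_lim_seq_gauss_factor].
Qed.

Lemma gauss_lim_down (z l : R) :
  is_lim_seq (gauss (z + 1)) l -> is_lim_seq (gauss z) (z * l).
Proof.
  intros Hl. apply is_lim_seq_incr_1.
  destruct (nfloor_ex (Rabs (z + 1))) as [N HN]; [apply Rabs_pos|].
  apply (is_lim_seq_ext_loc (fun n => gauss (z + 1) (S n) * z / (1 + (z + 1) / INR (S n)))).
  { exists N. intros n Hn. rewrite gauss_succ_arg.
    assert (H1 : INR N + 1 <= INR (S n)) by (rewrite S_INR; apply le_INR in Hn; lra).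
    pose proof (pos_INR N). assert (Ha := Rle_abs (- (z + 1))). rewrite Rabs_Ropp in Ha.
    unfold Rdiv. field. lra. }
  replace (z * l) with (l * z / 1) by field.
  apply is_lim_seq_div'; [|apply is_lim_seq_gauss_factor|lra].
  apply is_lim_seq_mult'; [now apply -> is_lim_seq_incr_1|apply is_lim_seq_const].
Qed.

Lemma gauss_lim_pos (z : R) : 0 < z -> exists l, 0 < l /\ is_lim_seq (gauss z) l.
Proof.
  intros Hz.
  assert (H : forall (n : nat) z, 0 < z <= INR n + 1 ->
            exists l, 0 < l /\ is_lim_seq (gauss z) l).
  { clear. induction n as [|n IH]; intros z Hz.
    - simpl in Hz. apply gauss_lim_unit. lra.
    - destruct (Rle_dec z 1); [apply gauss_lim_unit; lra|].
      rewrite S_INR in Hz. destruct (IH (z - 1)) as [l [Hl Hlim]]; [lra|].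
      exists (l / (z - 1)). split; [apply Rdiv_lt_0_compat; lra|].
      replace z with (z - 1 + 1) at 1 by ring. apply gauss_lim_up; [lra|exact Hlim]. }
  destruct (nfloor_ex z) as [n Hn]; [lra|]. apply (H n). lra.
Qed.

Lemma gauss_lim_ex (z : R) : exists l : R, is_lim_seq (gauss z) l.
Proof.
  assert (H : forall (n : nat) z, 0 < z + INR n -> exists l : R, is_lim_seq (gauss z) l).
  { clear. induction n as [|n IH]; intros z Hz.
    - simpl in Hz. destruct (gauss_lim_pos z) as [l [_ Hl]]; [lra|]. now exists l.
    - rewrite S_INR in Hz. destruct (IH (z + 1)) as [l Hl]; [lra|].
      exists (z * l). now apply gauss_lim_down. }
  destruct (nfloor_ex (Rabs z)) as [n Hn]; [apply Rabs_pos|].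
  apply (H (S n)). rewrite S_INR.
  assert (Ha := Rle_abs (- z)). rewrite Rabs_Ropp in Ha. lra.
Qed.

Lemma rgamma_eq_of_lim (z l : R) : is_lim_seq (gauss z) l -> rgamma z = l.
Proof.
  intros Hl. unfold rgamma. fold (gauss z). now rewrite (is_lim_seq_unique _ _ Hl).
Qed.

Lemma is_lim_seq_gauss (z : R) : is_lim_seq (gauss z) (rgamma z).
Proof.
  destruct (gauss_lim_ex z) as [l Hl]. now rewrite (rgamma_eq_of_lim z l Hl).
Qed.

Lemma rgamma_pos (z : R) : 0 < z -> 0 < rgamma z.
Proof.
  intros Hz. destruct (gauss_lim_pos z Hz) as [l [Hl Hlim]].
  now rewrite (rgamma_eq_of_lim z l Hlim).
Qed.

Lemma rgamma_rec (z : R) : rgamma z = z * rgamma (z + 1).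
Proof. apply rgamma_eq_of_lim, gauss_lim_down, is_lim_seq_gauss. Qed.

Lemma rgamma_rec_prod (z : R) (n : nat) :
  rgamma z = prod_f_R0 (fun k => z + INR k) n * rgamma (z + INR n + 1).
Proof.
  induction n as [|n IH].
  - simpl. rewrite Rplus_0_r. apply rgamma_rec.
  - change (prod_f_R0 (fun k => z + INR k) (S n))
      with (prod_f_R0 (fun k => z + INR k) n * (z + INR (S n))).
    rewrite IH, (rgamma_rec (z + INR n + 1)), S_INR.
    replace (z + (INR n + 1) + 1) with (z + INR n + 1 + 1) by ring. ring.
Qed.

(** Stirling-type asymptotics, Gamma(z + n + 1) ~ n! n^z: a restatement of
    Gauss's limit through the functional equation. *)
Lemma rgamma_asymptotic (z : R) :
  0 < z ->
  is_lim_seq (fun n => rgamma (z + INR n + 1) * (INR (fact n) * Rpower (INR n) z)) 1.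
Proof.
  intros Hz. pose proof (rgamma_pos z Hz) as Hp.
  apply is_lim_seq_ext with (fun n => rgamma z / gauss z n).
  { intros n. rewrite (rgamma_rec_prod z n) at 1. unfold gauss.
    pose proof (INR_fact_lt_0 n). pose proof (Rpower_pos (INR n) z).
    assert (0 < prod_f_R0 (fun k => z + INR k) n).
    { apply prod_f_R0_pos. intros k. pose proof (pos_INR k). lra. }
    field. repeat split; lra. }
  replace 1 with (rgamma z / rgamma z) by (field; lra).
  apply is_lim_seq_div'; [apply is_lim_seq_const|apply is_lim_seq_gauss|lra].
Qed.

Lemma finite_bound (f : nat -> R) (N : nat) :
  exists D, 0 < D /\ forall k, (k < N)%nat -> Rabs (f k) <= D.
Proof.
  induction N as [|N [D [HD IH]]].
  - exists 1. split; [lra|]. intros k Hk. lia.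
  - exists (D + Rabs (f N)). pose proof (Rabs_pos (f N)). split; [lra|].
    intros k Hk. destruct (Nat.eq_dec k N) as [->|]; [lra|].
    specialize (IH k ltac:(lia)). lra.
Qed.

Lemma rgamma_shift_bounded (z : R) :
  exists C, 0 < C /\ forall k : nat, Rabs (rgamma (z + INR k)) <= C.
Proof.
  destruct (nfloor_ex (Rabs z)) as [N HN]; [apply Rabs_pos|].
  assert (Ha := Rle_abs (- z)). rewrite Rabs_Ropp in Ha.
  assert (Htail : forall j, rgamma (z + INR (S (S N) + j)) <= rgamma (z + INR (S (S N)))).
  { induction j as [|j IH]; [rewrite Nat.add_0_r; lra|].
    apply Rle_trans with (2 := IH).
    rewrite (rgamma_rec (z + INR (S (S N) + j))).
    rewrite Nat.add_succ_r, (S_INR (S (S N) + j)).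
    replace (z + INR (S (S N) + j) + 1) with (z + (INR (S (S N) + j) + 1)) by ring.
    assert (1 <= z + INR (S (S N) + j)).
    { rewrite plus_INR, !S_INR. pose proof (pos_INR j). lra. }
    assert (0 < rgamma (z + (INR (S (S N) + j) + 1))) by (apply rgamma_pos; lra).
    nra. }
  destruct (finite_bound (fun k => rgamma (z + INR k)) (S (S (S N)))) as [C [HC H]].
  exists C. split; [exact HC|].
  intros k. destruct (Nat.le_gt_cases k (S (S N))) as [|Hk]; [apply H; lia|].
  replace k with (S (S N) + (k - S (S N)))%nat by lia.
  rewrite Rabs_right.
  - apply Rle_trans with (1 := Htail _). apply Rle_trans with (1 := Rle_abs _). apply H. lia.
  - apply Rle_ge, Rlt_le, rgamma_pos. rewrite plus_INR, !S_INR.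
    pose proof (pos_INR (k - S (S N))). lra.
Qed.

(** * Generalised power series in polar coordinates *)

Lemma is_series_exp (x : R) : is_series (fun k => x ^ k / INR (fact k)) (exp x).
Proof.
  pose proof (is_exp_Reals x) as H. unfold is_pseries in H.
  eapply is_series_ext; [|exact H]. intros k. simpl.
  rewrite pow_n_pow. unfold scal; simpl; unfold mult; simpl. unfold Rdiv. ring.
Qed.

(** Coefficients of exponential type; the class is stable under the operations
    below, and every series formed with it converges everywhere. *)
Definition exp_type (a : nat -> R) : Prop :=
  exists C rho, 0 < rho /\ forall k, Rabs (a k) <= C * (rho ^ k / INR (fact k)).

Lemma exp_type_ex_series (a : nat -> R) : exp_type a -> ex_series a.
Proof.
  intros [C [rho [_ Ha]]].
  apply (ex_series_le a (fun k => C * (rho ^ k / INR (fact k)))).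
  - intros k. apply Ha.
  - apply (ex_series_scal_l C (fun k => rho ^ k / INR (fact k))).
    exists (exp rho). apply is_series_exp.
Qed.

Lemma exp_type_mul_geom (a b : nat -> R) (D r : R) :
  0 < r -> exp_type a -> (forall k, Rabs (b k) <= D * r ^ k) ->
  exp_type (fun k => b k * a k).
Proof.
  intros Hr [C [rho [Hrho Ha]]] Hb. exists (D * C), (r * rho). split.
  - now apply Rmult_lt_0_compat.
  - intros k. rewrite Rabs_mult, Rpow_mult_distr.
    replace (D * C * (r ^ k * rho ^ k / INR (fact k)))
      with ((D * r ^ k) * (C * (rho ^ k / INR (fact k)))) by (unfold Rdiv; ring).
    apply Rmult_le_compat; try apply Rabs_pos; auto.
Qed.

Lemma exp_type_abs (a : nat -> R) : exp_type a -> exp_type (fun k => Rabs (a k)).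
Proof.
  intros [C [rho [Hr Ha]]]. exists C, rho. split; [exact Hr|].
  intros k. now rewrite Rabs_Rabsolu.
Qed.

Definition freq (s : R) (k : nat) : R := 2 * INR k + s.

Lemma exp_type_freq (a : nat -> R) (s : R) :
  exp_type a -> exp_type (fun k => freq s k * a k).
Proof.
  intros Ha. apply (exp_type_mul_geom a (freq s) (2 + Rabs s) 2); [lra|exact Ha|].
  intros k. unfold freq.
  apply Rle_trans with (1 := Rabs_triang _ _).
  rewrite (Rabs_right (2 * INR k)) by (pose proof (pos_INR k); lra).
  pose proof (Rabs_pos s).
  assert (INR k <= 2 ^ k /\ 1 <= 2 ^ k).
  { induction k as [|k [IH1 IH2]]; [simpl; lra|]. rewrite S_INR. simpl pow. lra. }
  nra.
Qed.

Lemma exp_type_exp (a : nat -> R) (s t : R) :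
  exp_type a -> exp_type (fun k => exp (freq s k * t) * a k).
Proof.
  intros Ha.
  apply (exp_type_mul_geom a (fun k => exp (freq s k * t)) (exp (s * t)) (exp (2 * t)));
    [apply exp_pos|exact Ha|].
  intros k. rewrite Rabs_right by (apply Rle_ge, Rlt_le, exp_pos).
  right. unfold freq.
  induction k as [|k IH].
  - simpl. rewrite Rmult_1_r. f_equal. ring.
  - rewrite S_INR. simpl pow.
    replace ((2 * (INR k + 1) + s) * t) with (2 * t + (2 * INR k + s) * t) by ring.
    rewrite exp_plus, IH. ring.
Qed.

Lemma exp_type_bounded_mul (a b : nat -> R) :
  (forall k, Rabs (b k) <= 1) -> exp_type a -> exp_type (fun k => b k * a k).
Proof.
  intros Hb Ha. apply (exp_type_mul_geom a b 1 1); [lra|exact Ha|].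
  intros k. rewrite pow1. specialize (Hb k). lra.
Qed.

Lemma Series_derive (g g' g'' : nat -> R -> R) (B : nat -> R) (x d : R) :
  0 < d ->
  (forall k y, Rabs (y - x) < d ->
     is_derive (g k) y (g' k y) /\ is_derive (g' k) y (g'' k y) /\
     Rabs (g'' k y) <= B k) ->
  ex_series B ->
  (forall y, ex_series (fun k => g k y)) ->
  ex_series (fun k => g' k x) ->
  is_derive (fun y => Series (fun k => g k y)) x (Series (fun k => g' k x)).
Proof.
  intros Hd Hg HB Hs Hs'.
  apply (is_derive_limit (fun n y => sum_n (fun k => g k y) n)
           (sum_n (fun k => g' k x)) _ x _ d (Series B) Hd).
  - intros y _. exact (Series_correct _ (Hs y)).
  - exact (Series_correct _ Hs').
  - intros n y Hy.
    apply Rle_trans with (sum_n B n * (y - x) ^ 2).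
    + induction n as [|n IH].
      * rewrite !sum_O. apply (taylor_quadratic (g O) (g' O) (g'' O) x y d); auto.
      * rewrite !sum_Sn. unfold plus; simpl.
        assert (H := taylor_quadratic (g (S n)) (g' (S n)) (g'' (S n)) x y d _ Hy (Hg (S n))).
        replace (sum_n (fun k => g k y) n + g (S n) y -
                 (sum_n (fun k => g k x) n + g (S n) x) -
                 (sum_n (fun k => g' k x) n + g' (S n) x) * (y - x))
          with ((sum_n (fun k => g k y) n - sum_n (fun k => g k x) n -
                 sum_n (fun k => g' k x) n * (y - x)) +
                (g (S n) y - g (S n) x - g' (S n) x * (y - x))) by ring.
        apply Rle_trans with (1 := Rabs_triang _ _).
        replace ((sum_n B n + B (S n)) * ((y - x) * ((y - x) * 1)))
          with (sum_n B n * (y - x) ^ 2 + B (S n) * (y - x) ^ 2) by ring.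
        apply Rplus_le_compat; [exact IH|exact H].
    + apply Rmult_le_compat_r; [apply pow2_ge_0|].
      assert (HB0 : forall k, 0 <= B k).
      { intros k. destruct (Hg k x) as [_ [_ H]]; [rewrite Rminus_diag, Rabs_R0; lra|].
        pose proof (Rabs_pos (g'' k x)). lra. }
      apply (is_lim_seq_incr_compare (sum_n B) (Series B)).
      * exact (Series_correct _ HB).
      * intros k. rewrite sum_Sn. unfold plus; simpl. specialize (HB0 (S k)). lra.
Qed.

(** [V a s t phi c] is the real part of [e^{ic} sum_k a_k z^(2k+s)] at
    [z = e^(t + i phi)].  The offset [c] gives access to the imaginary part as
    well, and makes the family stable under differentiation in [phi]. *)
Definition Vterm (a : nat -> R) (s t phi c : R) (k : nat) : R :=
  a k * (exp (freq s k * t) * cos (freq s k * phi + c)).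

Definition V (a : nat -> R) (s t phi c : R) : R := Series (Vterm a s t phi c).

Lemma cos_abs_le (x : R) : Rabs (cos x) <= 1.
Proof. apply Rabs_le, COS_bound. Qed.

Lemma sin_abs_le (x : R) : Rabs (sin x) <= 1.
Proof. apply Rabs_le, SIN_bound. Qed.

Lemma ex_series_Vterm (a : nat -> R) (s t phi c : R) :
  exp_type a -> ex_series (Vterm a s t phi c).
Proof.
  intros Ha. apply exp_type_ex_series.
  assert (H := exp_type_bounded_mul _ (fun k => cos (freq s k * phi + c))
                 (fun k => cos_abs_le _) (exp_type_exp a s t Ha)).
  destruct H as [C [rho [Hr H]]]. exists C, rho. split; [exact Hr|].
  intros k. unfold Vterm. specialize (H k). cbv beta in H.
  replace (a k * (exp (freq s k * t) * cos (freq s k * phi + c)))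
    with (cos (freq s k * phi + c) * (exp (freq s k * t) * a k)) by ring.
  exact H.
Qed.

Lemma V_ext (a b : nat -> R) (s t phi c : R) :
  (forall k, a k = b k) -> V a s t phi c = V b s t phi c.
Proof. intros H. apply Series_ext. intros k. unfold Vterm. now rewrite H. Qed.

Lemma V_lin (a b : nat -> R) (x y s t phi c : R) :
  exp_type a -> exp_type b ->
  V (fun k => x * a k + y * b k) s t phi c = x * V a s t phi c + y * V b s t phi c.
Proof.
  intros Ha Hb. unfold V. rewrite <- !Series_scal_l, <- Series_plus.
  - apply Series_ext. intros k. unfold Vterm. ring.
  - exact (ex_series_scal_l x _ (ex_series_Vterm a s t phi _ Ha)).
  - exact (ex_series_scal_l y _ (ex_series_Vterm b s t phi _ Hb)).
Qed.

Lemma V_offset (a : nat -> R) (s t phi c : R) :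
  exp_type a ->
  V a s t phi c = cos c * V a s t phi 0 - sin c * V a s t phi (- (PI / 2)).
Proof.
  intros Ha. unfold V. rewrite <- !Series_scal_l, <- Series_minus.
  - apply Series_ext. intros k. unfold Vterm.
    rewrite (cos_plus _ c), (cos_plus _ 0), (cos_plus _ (- (PI / 2))).
    rewrite cos_0, sin_0, cos_neg, sin_neg, cos_PI2, sin_PI2. ring.
  - exact (ex_series_scal_l (cos c) _ (ex_series_Vterm a s t phi _ Ha)).
  - exact (ex_series_scal_l (sin c) _ (ex_series_Vterm a s t phi _ Ha)).
Qed.

Lemma V_shift_exponent (a : nat -> R) (s d t phi c : R) :
  V a (s + d) t phi c = exp (d * t) * V a s t phi (c + d * phi).
Proof.
  unfold V. rewrite <- Series_scal_l. apply Series_ext. intros k. unfold Vterm, freq.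
  replace ((2 * INR k + (s + d)) * t) with (d * t + (2 * INR k + s) * t) by ring.
  rewrite exp_plus.
  replace ((2 * INR k + (s + d)) * phi + c)
    with ((2 * INR k + s) * phi + (c + d * phi)) by ring.
  ring.
Qed.

(** Multiplying the series by [z^2] shifts its coefficients: recurrences between
    coefficients become equations between functions. *)
Lemma V_shift_index (a b : nat -> R) (x s t phi c : R) :
  exp_type b -> b O = 0 -> (forall k, b (S k) = x * a k) ->
  V b s t phi c = x * V a (s + 2) t phi c.
Proof.
  intros Hb H0 HS. unfold V.
  rewrite (Series_incr_1 _ (ex_series_Vterm b s t phi c Hb)), <- Series_scal_l.
  unfold Vterm at 1. rewrite H0, Rmult_0_l, Rplus_0_l.
  apply Series_ext. intros k. unfold Vterm, freq. rewrite HS, S_INR.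
  replace (2 * (INR k + 1) + s) with (2 * INR k + (s + 2)) by ring. ring.
Qed.

Lemma V_abs_le (a : nat -> R) (s t phi c : R) :
  exp_type a -> Rabs (V a s t phi c) <= V (fun k => Rabs (a k)) s t 0 0.
Proof.
  intros Ha. unfold V.
  assert (Hex := ex_series_Vterm _ s t 0 0 (exp_type_abs a Ha)).
  assert (Hle : forall k, Rabs (Vterm a s t phi c k) <= Vterm (fun k => Rabs (a k)) s t 0 0 k).
  { intros k. unfold Vterm. rewrite Rmult_0_r, Rplus_0_l, cos_0, !Rabs_mult, Rmult_1_r.
    rewrite (Rabs_right (exp _)) by (apply Rle_ge, Rlt_le, exp_pos).
    apply Rmult_le_compat_l; [apply Rabs_pos|].
    pose proof (cos_abs_le (freq s k * phi + c)). pose proof (exp_pos (freq s k * t)). nra. }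
  apply Rle_trans with (Series (fun k => Rabs (Vterm a s t phi c k))).
  - apply Series_Rabs. apply (ex_series_le (fun k => Rabs (Vterm a s t phi c k)) _) with (2 := Hex).
    intros k. simpl. unfold norm; simpl. unfold abs; simpl. rewrite Rabs_Rabsolu. apply Hle.
  - apply Series_le; [|exact Hex]. intros k. split; [apply Rabs_pos|apply Hle].
Qed.

Lemma Vterm_second_bound (a : nat -> R) (s t : R) :
  exp_type a ->
  exists B, ex_series B /\
    forall k y phi c, Rabs (y - t) < 1 ->
      Rabs (Vterm (fun k => freq s k * (freq s k * a k)) s y phi c k) <= B k.
Proof.
  intros Ha.
  pose proof (exp_type_freq _ s (exp_type_freq a s Ha)) as H2.
  pose proof (exp_type_abs _ H2) as H2a.
  set (B1 := fun k => exp (freq s k * (t + 1)) * Rabs (freq s k * (freq s k * a k))).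
  set (B2 := fun k => exp (freq s k * (t - 1)) * Rabs (freq s k * (freq s k * a k))).
  exists (fun k => B1 k + B2 k). split.
  - apply (ex_series_plus B1 B2); apply exp_type_ex_series; now apply exp_type_exp.
  - intros k y phi c Hy. unfold Vterm. rewrite Rabs_mult, (Rabs_mult (exp _)).
    pose proof (cos_abs_le (freq s k * phi + c)) as Hc.
    pose proof (Rabs_pos (cos (freq s k * phi + c))).
    rewrite (Rabs_right (exp _)) by (apply Rle_ge, Rlt_le, exp_pos).
    pose proof (exp_pos (freq s k * y)).
    assert (Hexp : exp (freq s k * y) <= exp (freq s k * (t + 1)) + exp (freq s k * (t - 1))).
    { apply Rabs_def2 in Hy.
      pose proof (exp_pos (freq s k * (t + 1))). pose proof (exp_pos (freq s k * (t - 1))).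
      destruct (Rle_dec 0 (freq s k)).
      - assert (Hle : freq s k * y <= freq s k * (t + 1)) by nra.
        apply exp_nondecreasing in Hle. lra.
      - assert (Hle : freq s k * y <= freq s k * (t - 1)) by nra.
        apply exp_nondecreasing in Hle. lra. }
    unfold B1, B2.
    pose proof (Rabs_pos (freq s k * (freq s k * a k))).
    rewrite <- Rmult_plus_distr_r, Rmult_comm. apply Rmult_le_compat_r; [assumption|].
    apply Rle_trans with (2 := Hexp). nra.
Qed.

Lemma is_derive_V_t (a : nat -> R) (s t phi c : R) :
  exp_type a ->
  is_derive (fun y => V a s y phi c) t (V (fun k => freq s k * a k) s t phi c).
Proof.
  intros Ha. destruct (Vterm_second_bound a s t Ha) as [B [HB HB']].
  apply (Series_derive (fun k y => Vterm a s y phi c k)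
           (fun k y => Vterm (fun k => freq s k * a k) s y phi c k)
           (fun k y => Vterm (fun k => freq s k * (freq s k * a k)) s y phi c k) B t 1).
  - lra.
  - intros k y Hy. split; [|split].
    + unfold Vterm. auto_derive; [exact I|ring].
    + unfold Vterm. auto_derive; [exact I|ring].
    + now apply HB'.
  - exact HB.
  - intros y. now apply ex_series_Vterm.
  - apply ex_series_Vterm. now apply exp_type_freq.
Qed.

Lemma is_derive_V_phi (a : nat -> R) (s t phi c : R) :
  exp_type a ->
  is_derive (fun y => V a s t y c) phi (V (fun k => freq s k * a k) s t phi (c + PI / 2)).
Proof.
  intros Ha. destruct (Vterm_second_bound a s t Ha) as [B [HB HB']].
  apply (Series_derive (fun k y => Vterm a s t y c k)
           (fun k y => Vterm (fun k => freq s k * a k) s t y (c + PI / 2) k)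
           (fun k y => Vterm (fun k => freq s k * (freq s k * a k)) s t y (c + PI / 2 + PI / 2) k)
           B phi 1).
  - lra.
  - assert (Hcos : forall x, cos (x + PI / 2) = - sin x).
    { intros x. rewrite cos_plus, cos_PI2, sin_PI2. ring. }
    intros k y Hy. split; [|split].
    + unfold Vterm. rewrite <- Rplus_assoc, Hcos. auto_derive; [exact I|ring].
    + unfold Vterm. rewrite <- (Rplus_assoc _ (c + PI / 2)), Hcos.
      auto_derive; [exact I|ring].
    + apply HB'. rewrite Rminus_diag, Rabs_R0. lra.
  - exact HB.
  - intros y. now apply ex_series_Vterm.
  - apply ex_series_Vterm. now apply exp_type_freq.
Qed.

(** * Growth of the modified Bessel functions *)

Definition cosh_term (r : R) (k : nat) : R := (r ^ 2) ^ k / INR (fact (2 * k)).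

Lemma exp_type_inv_fact (f : nat -> nat) :
  (forall k, (k <= f k)%nat) -> exp_type (fun k => / INR (fact (f k))).
Proof.
  intros Hf. exists 1, 1. split; [lra|]. intros k. rewrite pow1.
  rewrite Rabs_right by (apply Rle_ge, Rlt_le, Rinv_0_lt_compat, INR_fact_lt_0).
  unfold Rdiv. rewrite !Rmult_1_l.
  apply Rinv_le_contravar; [apply INR_fact_lt_0|]. apply le_INR, fact_le, Hf.
Qed.

Lemma exp_type_ex_pseries (a : nat -> R) (x : R) : exp_type a -> ex_series (fun k => x ^ k * a k).
Proof.
  intros Ha. apply exp_type_ex_series.
  apply (exp_type_mul_geom a (fun k => x ^ k) 1 (Rabs x + 1)).
  - pose proof (Rabs_pos x). lra.
  - exact Ha.
  - intros k. rewrite <- RPow_abs, Rmult_1_l. apply pow_incr.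
    pose proof (Rabs_pos x). lra.
Qed.

(** The weights [cosh_term r k] are concentrated at [2k = r (1 + O(r^(-1/2)))];
    this is their total mass and their second moment about [r]. *)
Lemma cosh_moments (r : R) :
  0 < r ->
  exists o, 0 <= r * o <= exp r /\
    is_series (cosh_term r) ((exp r + exp (- r)) / 2) /\
    is_series (fun k => (2 * INR k / r - 1) ^ 2 * cosh_term r k) (2 * exp (- r) + o).
Proof.
  intros Hr.
  set (c0 := Series (cosh_term r)).
  set (oterm := fun k : nat => (r ^ 2) ^ k * / INR (fact (2 * k + 1))).
  set (o := Series oterm).
  assert (Hc : is_series (cosh_term r) c0).
  { apply Series_correct. apply exp_type_ex_pseries, (exp_type_inv_fact (fun k => 2 * k)%nat). lia. }
  assert (Ho : is_series oterm o).
  { apply Series_correct. apply exp_type_ex_pseries, (exp_type_inv_fact (fun k => 2 * k + 1)%nat). lia. }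
  assert (Hsplit : forall x, x ^ 2 = r ^ 2 -> exp x = c0 + x * o).
  { intros x Hx. rewrite <- (is_series_unique _ _ (is_series_exp x)).
    assert (H := is_pseries_odd_even (fun n => / INR (fact n)) x c0 o).
    rewrite Hx in H.
    assert (H' : is_pseries (fun n => / INR (fact n)) x (c0 + x * o)).
    { apply H.
      - eapply is_series_ext; [|exact Hc]. intros k. unfold cosh_term.
        symmetry. exact (f_equal2 Rmult (pow_n_pow (r ^ 2) k) eq_refl).
      - eapply is_series_ext; [|exact Ho]. intros k. unfold oterm.
        symmetry. exact (f_equal2 Rmult (pow_n_pow (r ^ 2) k) eq_refl). }
    rewrite <- (is_pseries_unique _ _ _ H'). unfold PSeries.
    apply Series_ext. intros k. unfold Rdiv. ring. }
  assert (E1 := Hsplit r eq_refl).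
  assert (E2 := Hsplit (- r) ltac:(ring)).
  assert (Ho0 : 0 <= o).
  { apply (is_lim_seq_le (fun _ => 0) (sum_n oterm) 0 o).
    - intros n. induction n as [|n IH].
      + rewrite sum_O. unfold oterm. simpl. lra.
      + rewrite sum_Sn. unfold plus; simpl.
        assert (0 <= oterm (S n)); [|lra].
        apply Rmult_le_pos; [apply pow_le; nra|].
        apply Rlt_le, Rinv_0_lt_compat, INR_fact_lt_0.
    - apply is_lim_seq_const.
    - exact Ho. }
  assert (M1 : is_series (fun k => 2 * INR k * cosh_term r k) (r ^ 2 * o)).
  { apply is_series_decr_1. unfold plus, opp; simpl.
    replace (r * (r * 1) * o + - (2 * 0 * cosh_term r 0)) with (r ^ 2 * o) by ring.
    eapply is_series_ext; [|exact (is_series_scal_l (r ^ 2) oterm o Ho)].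
    intros k. unfold oterm, cosh_term.
    replace (2 * S k)%nat with (S (2 * k + 1)) by lia.
    rewrite fact_simpl, mult_INR.
    replace (INR (S (2 * k + 1))) with (2 * INR (S k)).
    2:{ rewrite !S_INR, plus_INR, mult_INR. simpl. ring. }
    pose proof (INR_fact_neq_0 (2 * k + 1)).
    assert (INR (S k) <> 0) by (apply not_0_INR; lia).
    unfold scal; simpl. unfold mult; simpl. field. auto. }
  assert (M2 : is_series (fun k => 2 * INR k * (2 * INR k - 1) * cosh_term r k) (r ^ 2 * c0)).
  { apply is_series_decr_1. unfold plus, opp; simpl.
    replace (r * (r * 1) * c0 + - (2 * 0 * (2 * 0 - 1) * cosh_term r 0)) with (r ^ 2 * c0) by ring.
    eapply is_series_ext; [|exact (is_series_scal_l (r ^ 2) (cosh_term r) c0 Hc)].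
    intros k. unfold cosh_term.
    replace (2 * S k)%nat with (S (S (2 * k))) by lia.
    rewrite !fact_simpl, !mult_INR.
    replace (INR (S (S (2 * k)))) with (2 * INR k + 2).
    2:{ rewrite !S_INR, mult_INR. simpl. ring. }
    replace (INR (S (2 * k))) with (2 * INR k + 1).
    2:{ rewrite !S_INR, mult_INR. simpl. ring. }
    change (match k with O => 1 | S _ => INR k + 1 end) with (INR (S k)).
    rewrite S_INR.
    pose proof (INR_fact_neq_0 (2 * k)). pose proof (pos_INR k).
    change (scal ?a ?b) with (Rmult a b).
    match goal with |- ?a = ?b => change (@eq R a b) end.
    rewrite <- (tech_pow_Rmult (r ^ 2)). field. repeat split; lra. }
  exists o. split; [|split].
  - pose proof (exp_pos (- r)). nra.
  - replace ((exp r + exp (- r)) / 2) with c0 by (rewrite E1, E2; field). exact Hc.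
  - assert (M := is_series_plus _ _ _ _ (is_series_plus _ _ _ _
                  (is_series_scal_l (/ r ^ 2) _ _ M2)
                  (is_series_scal_l (/ r ^ 2 - 2 / r) _ _ M1)) Hc).
    unfold plus, scal in M; simpl in M. unfold mult in M; simpl in M.
    match type of M with is_series _ ?l =>
      replace (2 * exp (- r) + o) with l by (rewrite E2; field; lra) end.
    eapply is_series_ext; [|exact M].
    intros k. simpl. field. lra.
Qed.

Lemma Rpower_sub_1_le (y s : R) : 0 < y -> 0 <= s <= 2 -> Rabs (Rpower y s - 1) <= Rabs (y ^ 2 - 1).
Proof.
  intros Hy Hs.
  assert (E2 : y ^ 2 = Rpower y 2) by (rewrite <- Rpower_pow by exact Hy; f_equal; simpl; ring).
  assert (E0 : 1 = Rpower y 0) by now rewrite Rpower_O.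
  destruct (Rle_dec 1 y) as [H|H].
  - assert (1 <= Rpower y s) by (rewrite E0; apply Rle_Rpower; lra).
    assert (Rpower y s <= y ^ 2) by (rewrite E2; apply Rle_Rpower; lra).
    rewrite !Rabs_right; lra.
  - assert (Hln : ln y < 0) by (rewrite <- ln_1; apply ln_increasing; lra).
    assert (Rpower y s <= 1).
    { rewrite E0. unfold Rpower. apply exp_nondecreasing. nra. }
    assert (y ^ 2 <= Rpower y s).
    { rewrite E2. unfold Rpower. apply exp_nondecreasing. nra. }
    rewrite !Rabs_left1; lra.
Qed.

(** Only second moments of the weights are available, so the error is put in
    the form of a small constant plus a multiple of a square. *)
Lemma Rpower_sub_1_quadratic (y s d : R) :
  0 < y -> 0 <= s <= 2 -> 0 < d ->
  Rabs (Rpower y s - 1) <= 2 * d + (1 + / (2 * d)) * (y - 1) ^ 2.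
Proof.
  intros Hy Hs Hd. apply Rle_trans with (1 := Rpower_sub_1_le y s Hy Hs).
  assert (H : Rabs (y - 1) <= d + (y - 1) ^ 2 / (4 * d)).
  { assert (E : d + (y - 1) ^ 2 / (4 * d) - Rabs (y - 1) = (Rabs (y - 1) - 2 * d) ^ 2 / (4 * d)).
    { rewrite <- (pow2_abs (y - 1)). field. lra. }
    assert (0 <= (Rabs (y - 1) - 2 * d) ^ 2 / (4 * d)).
    { apply Rdiv_le_0_compat; [apply pow2_ge_0|lra]. }
    lra. }
  replace (y ^ 2 - 1) with (2 * (y - 1) + (y - 1) ^ 2) by ring.
  apply Rle_trans with (1 := Rabs_triang _ _).
  rewrite Rabs_mult, (Rabs_right 2), (Rabs_right ((y - 1) ^ 2)) by
    (try lra; apply Rle_ge, pow2_ge_0).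
  replace ((1 + / (2 * d)) * (y - 1) ^ 2) with ((y - 1) ^ 2 + 2 * ((y - 1) ^ 2 / (4 * d)))
    by (field; lra).
  lra.
Qed.

Lemma Rpower_ratio (r x h : R) :
  0 < r -> 0 < x -> Rpower (r / 2) (- h) * Rpower x h = Rpower (2 * x / r) h.
Proof.
  intros Hr Hx. unfold Rpower. rewrite <- exp_plus. f_equal.
  replace (2 * x / r) with (x / (r / 2)) by (field; lra).
  rewrite (ln_div x (r / 2)) by lra. ring.
Qed.

Lemma concentration_pointwise (g : nat -> R) (h d : R) :
  0 < h <= 2 -> 0 < d <= 1 -> is_lim_seq (fun k => g k / Rpower (INR k) h) 1 ->
  exists D K, 0 < D /\ 0 < K /\ forall r k, 0 < r ->
    Rabs (Rpower (r / 2) (- h) * g k - 1) <=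
    5 * d + D * Rpower (r / 2) (- h) + K * (4 / r ^ 2 + (2 * INR k / r - 1) ^ 2).
Proof.
  intros Hh Hd Hg.
  set (x := fun k : nat => Rmax (INR k) 1).
  assert (Hx : forall k, 1 <= x k) by (intros k; apply Rmax_r).
  apply is_lim_seq_spec in Hg. destruct (Hg (mkposreal d (proj1 Hd))) as [N HN]. simpl in HN.
  destruct (finite_bound (fun k => g k - Rpower (x k) h) (S N)) as [D [HD HDb]].
  assert (Happ : forall k, Rabs (g k - Rpower (x k) h) <= d * Rpower (x k) h + D).
  { intros k. pose proof (Rpower_pos (x k) h).
    destruct (Nat.lt_ge_cases k (S N)) as [Hk|Hk].
    - specialize (HDb k Hk). nra.
    - assert (Hk1 : 1 <= INR k) by (apply (le_INR 1); lia).
      assert (Exk : x k = INR k) by (unfold x; apply Rmax_left; exact Hk1).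
      rewrite Exk in *. specialize (HN k ltac:(lia)).
      replace (g k - Rpower (INR k) h) with ((g k / Rpower (INR k) h - 1) * Rpower (INR k) h)
        by (field; lra).
      rewrite Rabs_mult, (Rabs_right (Rpower _ _)) by lra. nra. }
  set (K := 1 + / (2 * d)).
  assert (HK : 0 < K).
  { unfold K. assert (0 < / (2 * d)) by (apply Rinv_0_lt_compat; lra). lra. }
  exists D, (2 * K). split; [exact HD|]. split; [lra|].
  intros r k Hr.
  set (y := 2 * x k / r).
  assert (Hy : 0 < y) by (apply Rdiv_lt_0_compat; [specialize (Hx k)|]; lra).
  assert (HZ := Rpower_sub_1_quadratic y h d Hy ltac:(lra) (proj1 Hd)).
  fold K in HZ. set (Z := 2 * d + K * (y - 1) ^ 2) in *.
  assert (Hp : 0 < Rpower (r / 2) (- h)) by apply Rpower_pos.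
  assert (Er : Rpower (r / 2) (- h) * Rpower (x k) h = Rpower y h).
  { apply Rpower_ratio; [exact Hr|]. specialize (Hx k). lra. }
  assert (H1 : Rabs (Rpower (r / 2) (- h) * g k - Rpower y h) <=
               d * Rpower y h + D * Rpower (r / 2) (- h)).
  { rewrite <- Er at 1.
    replace (Rpower (r / 2) (- h) * g k - Rpower (r / 2) (- h) * Rpower (x k) h)
      with (Rpower (r / 2) (- h) * (g k - Rpower (x k) h)) by ring.
    rewrite Rabs_mult, (Rabs_right (Rpower (r / 2) (- h))) by lra.
    rewrite <- Er. specialize (Happ k). nra. }
  assert (Hyh : Rpower y h <= 1 + Z).
  { pose proof (Rle_abs (Rpower y h - 1)). lra. }
  assert (HZ0 : 0 <= Z).
  { pose proof (Rabs_pos (Rpower y h - 1)). lra. }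
  assert (H2 : Rabs (Rpower (r / 2) (- h) * g k - 1) <=
               d + 2 * Z + D * Rpower (r / 2) (- h)).
  { replace (Rpower (r / 2) (- h) * g k - 1)
      with ((Rpower (r / 2) (- h) * g k - Rpower y h) + (Rpower y h - 1)) by ring.
    apply Rle_trans with (1 := Rabs_triang _ _).
    pose proof (Rpower_pos y h). nra. }
  assert (Hyk : (y - 1) ^ 2 <= 4 / r ^ 2 + (2 * INR k / r - 1) ^ 2).
  { unfold y. destruct k as [|k].
    - unfold x. simpl INR. rewrite Rmax_right by lra.
      replace (4 / r ^ 2 + (2 * 0 / r - 1) ^ 2 - (2 * 1 / r - 1) ^ 2) with (4 / r) by (field; lra).
      replace ((2 * 1 / r - 1) ^ 2) with (4 / r ^ 2 + (2 * 0 / r - 1) ^ 2 - 4 / r) by (field; lra).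
      assert (0 < 4 / r) by (apply Rdiv_lt_0_compat; lra). lra.
    - unfold x. rewrite Rmax_left by (apply (le_INR 1); lia).
      assert (0 < 4 / r ^ 2) by (apply Rdiv_lt_0_compat; [lra|apply pow_lt; lra]). lra. }
  unfold Z in H2. nra.
Qed.

Lemma Rpower_neg_lim (h : R) : 0 < h -> is_lim (fun r => Rpower (r / 2) (- h)) p_infty 0.
Proof.
  intros Hh. apply is_lim_spec. intros eps. simpl.
  exists (2 * Rpower (/ eps) (/ h)). intros r Hr.
  pose proof (cond_pos eps) as He.
  rewrite Rminus_0_r, Rabs_right by (apply Rle_ge, Rlt_le, Rpower_pos).
  assert (Hi : 0 < / eps) by (apply Rinv_0_lt_compat; lra).
  assert (H0 := Rpower_pos (/ eps) (/ h)).
  rewrite Rpower_Ropp, <- (Rinv_inv eps).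
  apply Rinv_lt_contravar.
  - apply Rmult_lt_0_compat; [exact Hi|apply Rpower_pos].
  - replace (/ eps) with (Rpower (Rpower (/ eps) (/ h)) h) at 1.
    + unfold Rpower at 1 3. apply exp_increasing. apply Rmult_lt_compat_l; [exact Hh|].
      apply ln_increasing; lra.
    + rewrite Rpower_mult, Rinv_l, Rpower_1 by lra. reflexivity.
Qed.

Lemma exp_opp_le_inv (r : R) : 0 < r -> exp (- r) <= / r.
Proof.
  intros Hr. rewrite exp_Ropp. apply Rinv_le_contravar; [exact Hr|].
  pose proof (exp_ineq1_le r). lra.
Qed.

(** Averaging a regularly varying sequence over concentrated weights evaluates
    it at the centre of mass. *)
Lemma concentration (g : nat -> R) (h : R) :
  0 < h <= 2 -> is_lim_seq (fun k => g k / Rpower (INR k) h) 1 ->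
  is_lim (fun r => exp (- r) * Rpower (r / 2) (- h) * Series (fun k => g k * cosh_term r k))
    p_infty (/ 2).
Proof.
  intros Hh Hg.
  assert (Hmain : forall d, 0 < d <= 1 -> exists D K, 0 < D /\ 0 < K /\ forall r, 1 < r ->
    Rabs (exp (- r) * Rpower (r / 2) (- h) * Series (fun k => g k * cosh_term r k) - / 2) <=
    5 * d + D * Rpower (r / 2) (- h) + (7 * K + 1) / r).
  { intros d Hd.
    destruct (concentration_pointwise g h d Hh Hd Hg) as [D [K [HD [HK Hpt]]]].
    exists D, K. split; [exact HD|]. split; [exact HK|]. intros r Hr.
    destruct (cosh_moments r ltac:(lra)) as [o [Ho [Hs0 Hs2]]].
    set (p := Rpower (r / 2) (- h)) in *.
    assert (Hp : 0 < p) by apply Rpower_pos.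
    set (A := 5 * d + D * p + K * (4 / r ^ 2)).
    assert (Hc0 : forall k, 0 <= cosh_term r k).
    { intros k. apply Rdiv_le_0_compat; [|apply INR_fact_lt_0]. apply pow_le. nra. }
    assert (Hmaj := is_series_plus _ _ _ _ (is_series_scal_l A _ _ Hs0)
                      (is_series_scal_l K _ _ Hs2)).
    unfold plus, scal in Hmaj; simpl in Hmaj. unfold mult in Hmaj; simpl in Hmaj.
    set (maj := fun n : nat => A * cosh_term r n +
           K * ((2 * INR n / r - 1) * ((2 * INR n / r - 1) * 1) * cosh_term r n)) in *.
    set (f := fun k => (p * g k - 1) * cosh_term r k).
    assert (Hf : forall k, Rabs (f k) <= maj k).
    { intros k. unfold f, maj. rewrite Rabs_mult, (Rabs_right (cosh_term r k)).
      2: now apply Rle_ge.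
      specialize (Hpt r k ltac:(lra)). specialize (Hc0 k). fold p in Hpt. unfold A.
      replace ((5 * d + D * p + K * (4 / r ^ 2)) * cosh_term r k +
        K * ((2 * INR k / r - 1) * ((2 * INR k / r - 1) * 1) * cosh_term r k))
        with ((5 * d + D * p + K * (4 / r ^ 2 + (2 * INR k / r - 1) ^ 2)) * cosh_term r k) by ring.
      now apply Rmult_le_compat_r. }
    assert (Hexf : ex_series (fun k => Rabs (f k))).
    { apply (ex_series_le (fun k => Rabs (f k)) maj).
      - intros k. unfold norm; simpl. unfold abs; simpl. rewrite Rabs_Rabsolu. apply Hf.
      - eexists. exact Hmaj. }
    assert (Hfs : Rabs (Series f) <= A * ((exp r + exp (- r)) / 2) + K * (2 * exp (- r) + o)).
    { apply Rle_trans with (1 := Series_Rabs f Hexf).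
      rewrite <- (is_series_unique _ _ Hmaj).
      apply Series_le; [|eexists; exact Hmaj]. intros k. split; [apply Rabs_pos|apply Hf]. }
    assert (Eg : p * Series (fun k => g k * cosh_term r k) =
                 Series f + (exp r + exp (- r)) / 2).
    { rewrite <- (is_series_unique _ _ Hs0), <- Series_scal_l, <- Series_plus.
      - apply Series_ext. intros k. unfold f. ring.
      - apply ex_series_Rabs, Hexf.
      - eexists. exact Hs0. }
    assert (Hexp : exp (- r) * exp r = 1) by (rewrite Rmult_comm; apply exp_mul_opp).
    pose proof (exp_pos (- r)) as He0. pose proof (exp_opp_le_inv r ltac:(lra)) as Hei.
    assert (Hri : 0 < / r < 1).
    { split; [apply Rinv_0_lt_compat; lra|]. rewrite <- Rinv_1. apply Rinv_lt_contravar; lra. }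
    assert (Hr2 : 4 / r ^ 2 <= 4 * / r).
    { replace (4 / r ^ 2) with (4 * (/ r * / r)) by (field; lra). nra. }
    assert (Hr20 : 0 < 4 / r ^ 2) by (apply Rdiv_lt_0_compat; [lra|apply pow_lt; lra]).
    rewrite Rmult_assoc, Eg.
    replace (exp (- r) * (Series f + (exp r + exp (- r)) / 2) - / 2)
      with (exp (- r) * Series f + exp (- r) * exp (- r) / 2 +
            (exp (- r) * exp r - 1) / 2) by field.
    rewrite Hexp. replace ((1 - 1) / 2) with 0 by field. rewrite Rplus_0_r.
    apply Rle_trans with (1 := Rabs_triang _ _).
    rewrite Rabs_mult, (Rabs_right (exp (- r))) by lra.
    rewrite (Rabs_right (exp (- r) * exp (- r) / 2)) by nra.
    assert (HA : 0 < A) by (unfold A; nra).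
    assert (Ho' : exp (- r) * o <= / r).
    { apply (Rmult_le_reg_l r); [lra|]. rewrite Rinv_r by lra. nra. }
    assert (Hm : exp (- r) * Rabs (Series f) <= A + K * (3 * / r)).
    { apply Rle_trans with (exp (- r) * (A * ((exp r + exp (- r)) / 2) + K * (2 * exp (- r) + o))).
      - apply Rmult_le_compat_l; lra.
      - replace (exp (- r) * (A * ((exp r + exp (- r)) / 2) + K * (2 * exp (- r) + o)))
          with (A * ((exp (- r) * exp r + exp (- r) * exp (- r)) / 2) +
                K * (2 * (exp (- r) * exp (- r)) + exp (- r) * o)) by field.
        rewrite Hexp.
        assert (exp (- r) * exp (- r) <= / r) by nra.
        apply Rplus_le_compat; [|apply Rmult_le_compat_l; nra].
        rewrite <- (Rmult_1_r A) at 2. apply Rmult_le_compat_l; nra. }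
    unfold A in Hm. unfold Rdiv at 2. nra. }
  apply is_lim_spec. intros eps. pose proof (cond_pos eps) as He.
  set (d := Rmin 1 (eps / 20)).
  assert (Hd : 0 < d <= 1).
  { unfold d. split; [apply Rmin_glb_lt; lra|apply Rmin_l]. }
  assert (Hd' : d <= eps / 20) by apply Rmin_r.
  destruct (Hmain d Hd) as [D [K [HD [HK Hb]]]].
  assert (Hlim := Rpower_neg_lim h ltac:(lra)).
  apply is_lim_spec in Hlim.
  assert (HeD : 0 < eps / (4 * D)) by (apply Rdiv_lt_0_compat; lra).
  destruct (Hlim (mkposreal _ HeD)) as [T HT]. simpl in HT.
  exists (Rmax 1 (Rmax T (4 * (7 * K + 1) / eps))). intros r Hr.
  assert (Hr1 : 1 < r) by (apply Rle_lt_trans with (2 := Hr); apply Rmax_l).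
  assert (Hr2 : T < r).
  { apply Rle_lt_trans with (2 := Hr). apply Rle_trans with (2 := Rmax_r _ _). apply Rmax_l. }
  assert (Hr3 : 4 * (7 * K + 1) / eps < r).
  { apply Rle_lt_trans with (2 := Hr). apply Rle_trans with (2 := Rmax_r _ _). apply Rmax_r. }
  apply Rle_lt_trans with (1 := Hb r Hr1).
  specialize (HT r Hr2).
  rewrite Rminus_0_r, Rabs_right in HT by (apply Rle_ge, Rlt_le, Rpower_pos).
  assert (D * Rpower (r / 2) (- h) < eps / 4).
  { replace (pos eps / 4) with (D * (eps / (4 * D))) by (field; lra).
    now apply Rmult_lt_compat_l. }
  assert ((7 * K + 1) / r < eps / 4).
  { apply (Rmult_lt_reg_r r); [lra|]. unfold Rdiv at 1.
    rewrite Rmult_assoc, Rinv_l, Rmult_1_r by lra.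
    apply (Rmult_lt_compat_r (eps / 4)) in Hr3; [|lra].
    replace (4 * (7 * K + 1) / eps * (eps / 4)) with (7 * K + 1) in Hr3 by (field; lra). lra. }
  lra.
Qed.

(** The power-series coefficients of the modified Bessel function [I_nu], as a
    series in [r^(2k+nu)]. *)
Definition besselI_coef (nu : R) (k : nat) : R :=
  Rpower 2 (- nu) * (rgamma (nu + INR k + 1) / (INR (fact k) * 4 ^ k)).

Lemma pow4_pos (k : nat) : 0 < 4 ^ k.
Proof. apply pow_lt. lra. Qed.

Lemma exp_type_besselI (nu : R) : exp_type (besselI_coef nu).
Proof.
  destruct (rgamma_shift_bounded (nu + 1)) as [C [HC H]].
  exists (Rpower 2 (- nu) * C), (/ 4). split; [lra|].
  intros k. unfold besselI_coef.
  replace (nu + INR k + 1) with (nu + 1 + INR k) by ring.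
  pose proof (INR_fact_lt_0 k). pose proof (pow4_pos k).
  pose proof (Rpower_pos 2 (- nu)).
  assert (Hi : 0 < / (INR (fact k) * 4 ^ k)) by (apply Rinv_0_lt_compat; nra).
  unfold Rdiv. rewrite !Rabs_mult.
  rewrite (Rabs_right (Rpower _ _)), (Rabs_right (/ _)) by lra.
  rewrite pow_inv.
  replace (Rpower 2 (- nu) * C * (/ 4 ^ k * / INR (fact k)))
    with (Rpower 2 (- nu) * (C * / (INR (fact k) * 4 ^ k))) by (field; lra).
  apply Rmult_le_compat_l; [lra|]. apply Rmult_le_compat_r; [lra|apply H].
Qed.

Lemma besselI_coef_up (nu : R) (k : nat) :
  2 * INR (S k) * besselI_coef nu (S k) = besselI_coef (nu + 1) k.
Proof.
  unfold besselI_coef.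
  replace (nu + INR (S k) + 1) with (nu + 1 + INR k + 1) by (rewrite S_INR; ring).
  replace (Rpower 2 (- (nu + 1))) with (Rpower 2 (- nu) / 2).
  2:{ rewrite Ropp_plus_distr, Rpower_plus, (Rpower_Ropp 2 1), Rpower_1 by lra. reflexivity. }
  rewrite fact_simpl, mult_INR. simpl (4 ^ S k).
  pose proof (INR_fact_lt_0 k). pose proof (pow4_pos k).
  assert (0 < INR (S k)) by (apply lt_0_INR; lia).
  field. repeat split; lra.
Qed.

Lemma besselI_coef_down (nu : R) (k : nat) :
  2 * (INR k + nu) * besselI_coef nu k = besselI_coef (nu - 1) k.
Proof.
  unfold besselI_coef.
  replace (nu - 1 + INR k + 1) with (nu + INR k) by ring.
  rewrite (rgamma_rec (nu + INR k)).
  replace (Rpower 2 (- (nu - 1))) with (Rpower 2 (- nu) * 2).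
  2:{ replace (- (nu - 1)) with (- nu + 1) by ring.
      rewrite Rpower_plus, Rpower_1 by lra. reflexivity. }
  pose proof (INR_fact_lt_0 k). pose proof (pow4_pos k).
  field. repeat split; lra.
Qed.

Definition besselI (nu t : R) : R := V (besselI_coef nu) nu t 0 0.
Definition besselI' (nu t : R) : R := V (fun k => freq nu k * besselI_coef nu k) nu t 0 0.

Lemma besselI_up (nu t : R) : besselI' nu t = exp t * besselI (nu + 1) t + nu * besselI nu t.
Proof.
  pose proof (exp_type_besselI nu) as He.
  unfold besselI, besselI'.
  rewrite <- (Rmult_1_l (V (fun k => freq nu k * _) _ _ _ _)).
  assert (Het := exp_type_freq _ 0 He).
  assert (E := V_lin (fun k => freq 0 k * besselI_coef nu k) (besselI_coef nu) 1 nu nu t 0 0).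
  rewrite (V_shift_index (besselI_coef (nu + 1)) (fun k => freq 0 k * besselI_coef nu k) 1) in E;
    [|exact Het|unfold freq; simpl; ring
     |intros k; rewrite <- besselI_coef_up; unfold freq; ring].
  replace (nu + 2) with (nu + 1 + 1) in E by ring.
  rewrite (V_shift_exponent (besselI_coef (nu + 1)) (nu + 1) 1), Rmult_1_l in E.
  rewrite !Rmult_1_l, Rplus_0_r in E. rewrite Rmult_1_l, <- E; auto.
  apply V_ext. intros k. unfold freq. ring.
Qed.

Lemma besselI_down (nu t : R) : besselI' nu t = exp t * besselI (nu - 1) t - nu * besselI nu t.
Proof.
  pose proof (exp_type_besselI nu) as He.
  unfold besselI, besselI'.
  assert (E := V_shift_exponent (besselI_coef (nu - 1)) (nu - 1) 1 t 0 0).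
  replace (nu - 1 + 1) with nu in E by ring.
  replace (1 * t) with t in E by ring. replace (0 + 1 * 0) with 0 in E by ring.
  rewrite <- E.
  replace (V (besselI_coef (nu - 1)) nu t 0 0 - nu * V (besselI_coef nu) nu t 0 0)
    with (1 * V (besselI_coef (nu - 1)) nu t 0 0 + (- nu) * V (besselI_coef nu) nu t 0 0) by ring.
  rewrite <- V_lin; [|apply exp_type_besselI|exact He].
  apply V_ext. intros k. rewrite <- besselI_coef_down. unfold freq. ring.
Qed.

Lemma rgamma_half_shift (k : nat) :
  rgamma (INR k + / 2) * INR (fact (2 * k)) = rgamma (/ 2) * (INR (fact k) * 4 ^ k).
Proof.
  induction k as [|k IH].
  - simpl. rewrite Rplus_0_l. ring.
  - rewrite (rgamma_rec (INR k + / 2)) in IH. rewrite S_INR.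
    replace (2 * S k)%nat with (S (S (2 * k))) by lia.
    rewrite !fact_simpl, !mult_INR.
    replace (INR (S (S (2 * k)))) with (2 * INR k + 2).
    2:{ rewrite !S_INR, mult_INR. simpl. ring. }
    replace (INR (S (2 * k))) with (2 * INR k + 1).
    2:{ rewrite !S_INR, mult_INR. simpl. ring. }
    rewrite S_INR. simpl (4 ^ S k).
    replace (INR k + 1 + / 2) with (INR k + / 2 + 1) by ring.
    replace (rgamma (/ 2) * ((INR k + 1) * INR (fact k) * (4 * 4 ^ k)))
      with (4 * (INR k + 1) * (rgamma (/ 2) * (INR (fact k) * 4 ^ k))) by ring.
    rewrite <- IH. field.
Qed.

Lemma rgamma_quotient_asymptotic (h : R) :
  h <= 2 ->
  is_lim_seq (fun k => rgamma (INR k + / 2 - h) / rgamma (INR k + / 2) / Rpower (INR k) h) 1.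
Proof.
  intros Hh. apply (is_lim_seq_incr_n _ 3).
  assert (H1 := rgamma_asymptotic (5 / 2 - h) ltac:(lra)).
  assert (H2 := rgamma_asymptotic (5 / 2) ltac:(lra)).
  assert (H := is_lim_seq_div' _ _ _ _ H1 H2 ltac:(lra)).
  assert (H3 : is_lim_seq (fun n => Rpower (1 - 3 * / INR (n + 3)) h) 1).
  { assert (Hc : continuity_pt (fun x => Rpower x h) 1).
    { apply derivable_continuous_pt. eexists. apply derivable_pt_lim_power. lra. }
    assert (E1 : 1 = Rpower 1 h) by (unfold Rpower; rewrite ln_1, Rmult_0_r, exp_0; reflexivity).
    replace (Finite 1) with (Finite (Rpower 1 h)) by now rewrite <- E1.
    apply (is_lim_seq_continuous (fun x => Rpower x h)); [exact Hc|].
    replace (Finite 1) with (Finite (1 - 3 * 0)) by (f_equal; ring).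
    apply is_lim_seq_minus'; [apply is_lim_seq_const|].
    apply is_lim_seq_mult'; [apply is_lim_seq_const|].
    apply (is_lim_seq_incr_n (fun n => / INR n) 3), is_lim_seq_inv_INR. }
  assert (H4 := is_lim_seq_mult' _ _ _ _ H H3).
  replace (1 / 1 * 1) with 1 in H4 by field.
  eapply is_lim_seq_ext_loc; [|exact H4].
  exists 1%nat. intros n Hn.
  assert (Hn1 : 1 <= INR n) by (apply (le_INR 1); exact Hn).
  rewrite plus_INR. replace (INR 3) with 3 by (simpl; ring).
  replace (5 / 2 - h + INR n + 1) with (INR n + 3 + / 2 - h) by field.
  replace (5 / 2 + INR n + 1) with (INR n + 3 + / 2) by field.
  assert (0 < rgamma (INR n + 3 + / 2)) by (apply rgamma_pos; lra).
  replace (5 / 2) with (5 / 2 - h + h) at 2 by ring.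
  rewrite (Rpower_plus (5 / 2 - h) h).
  replace (1 - 3 * / (INR n + 3)) with (INR n / (INR n + 3)) by (field; lra).
  assert (Er : Rpower (INR n) h = Rpower (INR n / (INR n + 3)) h * Rpower (INR n + 3) h).
  { rewrite Rpower_mult_distr; [|apply Rdiv_lt_0_compat; lra|lra]. f_equal. field. lra. }
  rewrite Er.
  pose proof (Rpower_pos (INR n / (INR n + 3)) h). pose proof (Rpower_pos (INR n + 3) h).
  pose proof (Rpower_pos (INR n) (5 / 2 - h)). pose proof (INR_fact_lt_0 n).
  field. repeat split; lra.
Qed.

(** The universal constant [1 / sqrt (2 pi)]. *)
Definition besselI_const : R := rgamma (/ 2) * sqrt 2 / 2.

Lemma besselI_const_pos : 0 < besselI_const.
Proof.
  unfold besselI_const. assert (0 < rgamma (/ 2)) by (apply rgamma_pos; lra).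
  assert (0 < sqrt 2) by (apply sqrt_lt_R0; lra). nra.
Qed.

(** The growth statement e^(-r) sqrt(r) I_nu(r) -> L, with r = e^t.  The point
    is that L does not depend on [nu]. *)
Definition besselI_grows (nu : R) : Prop :=
  is_lim (fun t => exp (- exp t) * exp (t / 2) * besselI nu t) p_infty besselI_const.

Lemma is_lim_exp_p_infty : is_lim exp p_infty p_infty.
Proof. apply is_lim_exp_p. Qed.

Lemma is_lim_comp_exp (f : R -> R) (l : R) :
  is_lim f p_infty l -> is_lim (fun t => f (exp t)) p_infty l.
Proof.
  intros H. apply (is_lim_comp f exp p_infty l p_infty H is_lim_exp_p_infty).
  exists 0. intros x _. discriminate.
Qed.

(** The base strip: comparing with the series of cosh, the coefficients are
    k^h / (2k)! to leading order. *)
Lemma besselI_grows_strip (h : R) : 0 < h <= 2 -> besselI_grows (- / 2 - h).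
Proof.
  intros Hh.
  set (g := fun k => rgamma (INR k + / 2 - h) / rgamma (INR k + / 2)).
  assert (H := concentration g h Hh (rgamma_quotient_asymptotic h (proj2 Hh))).
  apply is_lim_comp_exp in H.
  assert (H' := is_lim_scal_l _ (rgamma (/ 2) * sqrt 2) _ _ H).
  unfold besselI_grows, besselI_const.
  simpl in H'. eapply is_lim_ext; [|exact H'].
  intros t. cbv beta.
  set (r := exp t). assert (Hr : 0 < r) by apply exp_pos.
  unfold besselI, V.
  rewrite <- !Rmult_assoc, !(Rmult_comm _ (exp (- r))), !Rmult_assoc. f_equal.
  rewrite <- !Series_scal_l. apply Series_ext. intros k.
  unfold g, Vterm, besselI_coef, cosh_term.
  replace (freq (- / 2 - h) k * 0 + 0) with 0 by ring. rewrite cos_0, Rmult_1_r.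
  replace (- / 2 - h + INR k + 1) with (INR k + / 2 - h) by field.
  assert (Hhalf := rgamma_half_shift k).
  assert (Hg : 0 < rgamma (INR k + / 2)) by (apply rgamma_pos; pose proof (pos_INR k); lra).
  pose proof (INR_fact_lt_0 k) as Hf1. pose proof (INR_fact_lt_0 (2 * k)) as Hf2.
  pose proof (pow4_pos k) as H4.
  assert (Ec : / (INR (fact k) * 4 ^ k) = rgamma (/ 2) / (rgamma (INR k + / 2) * INR (fact (2 * k)))).
  { rewrite Hhalf. field. repeat split; try lra. apply Rgt_not_eq, rgamma_pos. lra. }
  change (rgamma (INR k + / 2 - h) / (INR (fact k) * 4 ^ k))
    with (rgamma (INR k + / 2 - h) * / (INR (fact k) * 4 ^ k)).
  rewrite Ec.
  assert (E1 : (r ^ 2) ^ k = exp (2 * INR k * t)).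
  { unfold r. clear. induction k as [|k IH].
    - simpl. rewrite Rmult_0_r, Rmult_0_l, exp_0. reflexivity.
    - rewrite S_INR. simpl pow. replace (2 * (INR k + 1) * t) with (t + t + 2 * INR k * t) by ring.
      rewrite !exp_plus, <- IH. simpl. ring. }
  assert (E2 : exp (t / 2) * exp (freq (- / 2 - h) k * t) = (r ^ 2) ^ k * exp (- h * t)).
  { rewrite E1, <- !exp_plus. f_equal. unfold freq. field. }
  assert (E3 : sqrt 2 * Rpower (r / 2) (- h) = Rpower 2 (- (- / 2 - h)) * exp (- h * t)).
  { rewrite <- Rpower_sqrt by lra. unfold Rpower.
    rewrite (ln_div r 2) by lra. unfold r. rewrite ln_exp, <- !exp_plus. f_equal. field. }
  transitivity (rgamma (/ 2) * (sqrt 2 * Rpower (r / 2) (- h)) *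
     (rgamma (INR k + / 2 - h) / rgamma (INR k + / 2) * ((r ^ 2) ^ k / INR (fact (2 * k))))).
  { ring. }
  rewrite E3.
  transitivity ((exp (t / 2) * exp (freq (- / 2 - h) k * t)) * Rpower 2 (- (- / 2 - h)) *
    (rgamma (INR k + / 2 - h) * (rgamma (/ 2) / (rgamma (INR k + / 2) * INR (fact (2 * k)))))).
  { rewrite E2. field. lra. }
  ring.
Qed.

Lemma is_lim_exp_opp : is_lim (fun t => exp (- t)) p_infty 0.
Proof.
  apply (is_lim_comp exp Ropp p_infty 0 m_infty).
  - apply is_lim_exp_m.
  - apply (is_lim_opp (fun x => x) p_infty p_infty), is_lim_id.
  - exists 0. intros x _. discriminate.
Qed.

Lemma is_lim_mult_exp_opp (c l : R) (f : R -> R) :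
  is_lim f p_infty l -> is_lim (fun t => c * exp (- t) * f t) p_infty 0.
Proof.
  intros H.
  assert (H1 := is_lim_scal_l _ c _ _ is_lim_exp_opp).
  assert (H2 := is_lim_mult _ _ _ _ _ H1 H I). simpl in H2.
  replace (Finite 0) with (Finite (c * 0 * l)) by (f_equal; ring). exact H2.
Qed.

Lemma besselI_three_terms (nu t : R) :
  besselI (nu - 1) t = besselI (nu + 1) t + 2 * nu * exp (- t) * besselI nu t.
Proof.
  assert (H1 := besselI_up nu t). rewrite (besselI_down nu t) in H1.
  assert (He : exp (- t) * exp t = 1) by (rewrite Rmult_comm; apply exp_mul_opp).
  pose proof (exp_pos t).
  apply (Rmult_eq_reg_l (exp t)); [|lra].
  rewrite Rmult_plus_distr_l.
  replace (exp t * (2 * nu * exp (- t) * besselI nu t))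
    with (exp (- t) * exp t * (2 * nu * besselI nu t)) by ring.
  rewrite He. lra.
Qed.

Lemma besselI_grows_step (nu : R) :
  besselI_grows nu ->
  (besselI_grows (nu + 1) -> besselI_grows (nu - 1)) /\
  (besselI_grows (nu - 1) -> besselI_grows (nu + 1)).
Proof.
  intros H0. unfold besselI_grows in *. split; intros H1.
  - assert (H := is_lim_plus' _ _ _ _ _ H1 (is_lim_mult_exp_opp (2 * nu) _ _ H0)).
    rewrite Rplus_0_r in H. eapply is_lim_ext; [|exact H].
    intros t. cbv beta. rewrite (besselI_three_terms nu t). ring.
  - assert (H := is_lim_plus' _ _ _ _ _ H1 (is_lim_mult_exp_opp (- (2 * nu)) _ _ H0)).
    rewrite Rplus_0_r in H. eapply is_lim_ext; [|exact H].
    intros t. cbv beta. rewrite (besselI_three_terms nu t). ring.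
Qed.

(** The three-term recurrence, whose middle term is smaller by a factor [1/r],
    transports the constant from a strip of width two to every order. *)
Lemma besselI_grows_all (nu : R) : besselI_grows nu.
Proof.
  assert (H : forall (n : nat) nu, - 5 / 2 - INR n <= nu < - / 2 + INR n -> besselI_grows nu).
  { clear. induction n as [|n IH]; intros nu Hnu.
    - simpl in Hnu. replace nu with (- / 2 - (- / 2 - nu)) by ring.
      apply besselI_grows_strip. lra.
    - rewrite S_INR in Hnu. pose proof (pos_INR n).
      destruct (Rle_dec (- / 2 + INR n) nu).
      + replace nu with (nu - 1 + 1) by ring.
        refine (proj2 (besselI_grows_step (nu - 1) (IH _ _)) (IH _ _)); lra.
      + destruct (Rle_dec (- 5 / 2 - INR n) nu); [apply IH; lra|].
        replace nu with (nu + 1 - 1) by ring.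
        refine (proj1 (besselI_grows_step (nu + 1) (IH _ _)) (IH _ _)); lra. }
  destruct (nfloor_ex (Rabs nu)) as [n Hn]; [apply Rabs_pos|].
  apply (H (S (S n))). rewrite !S_INR.
  assert (Ha := Rle_abs nu). assert (Hb := Rle_abs (- nu)). rewrite Rabs_Ropp in Hb. lra.
Qed.

Lemma besselI'_grows (nu : R) :
  is_lim (fun t => exp (- exp t) * exp (t / 2) * (exp (- t) * besselI' nu t)) p_infty besselI_const.
Proof.
  assert (H := is_lim_plus' _ _ _ _ _ (besselI_grows_all (nu + 1))
                 (is_lim_mult_exp_opp nu _ _ (besselI_grows_all nu))).
  rewrite Rplus_0_r in H. eapply is_lim_ext; [|exact H].
  intros t. cbv beta. rewrite (besselI_up nu t).
  assert (He : exp (- t) * exp t = 1) by (rewrite Rmult_comm; apply exp_mul_opp).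
  rewrite (Rmult_plus_distr_l (exp (- t))), <- (Rmult_assoc (exp (- t)) (exp t)), He. ring.
Qed.

(** * Rotation from the imaginary to the real axis *)

Definition besselJ_coef (nu : R) (k : nat) : R := (-1) ^ k * besselI_coef nu k.

Lemma pow_m1_abs (k : nat) : Rabs ((-1) ^ k) = 1.
Proof. rewrite <- RPow_abs, Rabs_m1. apply pow1. Qed.

Lemma exp_type_besselJ (nu : R) : exp_type (besselJ_coef nu).
Proof.
  apply (exp_type_bounded_mul (besselI_coef nu) (fun k => (-1) ^ k)).
  - intros k. rewrite pow_m1_abs. lra.
  - apply exp_type_besselI.
Qed.

Lemma besselJ_coef_rec (nu : R) (k : nat) :
  4 * INR (S k) * (INR (S k) + nu) * besselJ_coef nu (S k) = - besselJ_coef nu k.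
Proof.
  unfold besselJ_coef.
  assert (H1 := besselI_coef_up nu k). assert (H2 := besselI_coef_down (nu + 1) k).
  replace (nu + 1 - 1) with nu in H2 by ring. rewrite <- H2, <- H1.
  simpl pow. rewrite S_INR. ring.
Qed.

(** Real part of [e^(ic) u] for [u = sqrt z J_nu z] at [z = e^(t + i phi)], and
    for the first two derivatives of [u] in [t]. *)
Definition zJ (nu t phi c : R) : R := V (besselJ_coef nu) (nu + / 2) t phi c.
Definition zJ1 (nu t phi c : R) : R :=
  V (fun k => freq (nu + / 2) k * besselJ_coef nu k) (nu + / 2) t phi c.
Definition zJ2 (nu t phi c : R) : R :=
  V (fun k => freq (nu + / 2) k * (freq (nu + / 2) k * besselJ_coef nu k)) (nu + / 2) t phi c.

Definition lam (nu : R) : R := nu ^ 2 - / 4.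

(** Bessel's equation [z^2 u'' = (lam - z^2) u] in logarithmic form; the factor
    [z^2] appears as [e^(2t)] together with the offset [2 phi]. *)
Lemma zJ_ode (nu t phi c : R) :
  zJ2 nu t phi c =
  zJ1 nu t phi c + lam nu * zJ nu t phi c - exp (2 * t) * zJ nu t phi (c + 2 * phi).
Proof.
  pose proof (exp_type_besselJ nu) as H0.
  pose proof (exp_type_freq _ (nu + / 2) H0) as H1.
  pose proof (exp_type_freq _ (nu + / 2) H1) as H2.
  set (b := fun k => 1 * (freq (nu + / 2) k * (freq (nu + / 2) k * besselJ_coef nu k)) +
              (-1) * (1 * (freq (nu + / 2) k * besselJ_coef nu k) + lam nu * besselJ_coef nu k)).
  assert (H3 : exp_type (fun k => 1 * (freq (nu + / 2) k * besselJ_coef nu k) + lam nu * besselJ_coef nu k)).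
  { destruct (exp_type_freq _ (nu + / 2 + lam nu) H0) as [C [rho [Hr H]]].
    exists C, rho. split; [exact Hr|]. intros k. specialize (H k). unfold freq in *.
    replace (1 * ((2 * INR k + (nu + / 2)) * besselJ_coef nu k) + lam nu * besselJ_coef nu k)
      with ((2 * INR k + (nu + / 2 + lam nu)) * besselJ_coef nu k) by ring. exact H. }
  assert (E1 := V_lin _ _ 1 (-1) (nu + / 2) t phi c H2 H3).
  rewrite (V_lin _ _ 1 (lam nu) (nu + / 2) t phi c H1 H0) in E1.
  assert (Hb : forall k, b k = 4 * INR k * (INR k + nu) * besselJ_coef nu k).
  { intros k. unfold b, freq, lam. field. }
  assert (Hbt : exp_type b).
  { destruct (exp_type_freq _ 0 (exp_type_freq _ (2 * nu) H0)) as [C [rho [Hr H]]].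
    exists C, rho. split; [exact Hr|]. intros k. specialize (H k). rewrite Hb. unfold freq in H.
    replace (4 * INR k * (INR k + nu) * besselJ_coef nu k)
      with ((2 * INR k + 0) * ((2 * INR k + 2 * nu) * besselJ_coef nu k)) by ring. exact H. }
  assert (E2 := V_shift_index (besselJ_coef nu) b (-1) (nu + / 2) t phi c Hbt).
  rewrite (V_shift_exponent (besselJ_coef nu)) in E2.
  specialize (E2 ltac:(rewrite Hb; simpl; ring)
                 ltac:(intros k; rewrite Hb, besselJ_coef_rec; ring)).
  change (V b (nu + / 2) t phi c =
    1 * zJ2 nu t phi c + (-1) * (1 * zJ1 nu t phi c + lam nu * zJ nu t phi c)) in E1.
  rewrite E1 in E2. unfold zJ in *. lra.
Qed.

Section Quadrant.

Variable nu : R.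

Let reU t phi := zJ nu t phi 0.
Let imU t phi := zJ nu t phi (- (PI / 2)).
Let reU1 t phi := zJ1 nu t phi 0.
Let imU1 t phi := zJ1 nu t phi (- (PI / 2)).
Let reU2 t phi := zJ2 nu t phi 0.
Let imU2 t phi := zJ2 nu t phi (- (PI / 2)).

Lemma reU_dt (t phi : R) : is_derive (fun y : R => reU y phi) t (reU1 t phi).
Proof. apply is_derive_V_t, exp_type_besselJ. Qed.
Lemma imU_dt (t phi : R) : is_derive (fun y => imU y phi) t (imU1 t phi).
Proof. apply is_derive_V_t, exp_type_besselJ. Qed.
Lemma reU1_dt (t phi : R) : is_derive (fun y => reU1 y phi) t (reU2 t phi).
Proof. apply is_derive_V_t, exp_type_freq, exp_type_besselJ. Qed.
Lemma imU1_dt (t phi : R) : is_derive (fun y => imU1 y phi) t (imU2 t phi).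
Proof. apply is_derive_V_t, exp_type_freq, exp_type_besselJ. Qed.

Lemma offset_half_pi (a : nat -> R) s t phi :
  exp_type a -> V a s t phi (0 + PI / 2) = - V a s t phi (- (PI / 2)).
Proof. intros Ha. rewrite Rplus_0_l, V_offset by exact Ha. rewrite cos_PI2, sin_PI2. ring. Qed.

Lemma reU_dphi (t phi : R) : is_derive (fun y => reU t y) phi (- imU1 t phi).
Proof.
  unfold imU1, zJ1. rewrite <- offset_half_pi by (apply exp_type_freq, exp_type_besselJ).
  apply is_derive_V_phi, exp_type_besselJ.
Qed.
Lemma imU_dphi (t phi : R) : is_derive (fun y => imU t y) phi (reU1 t phi).
Proof.
  unfold reU1, zJ1. replace 0 with (- (PI / 2) + PI / 2) by ring.
  apply is_derive_V_phi, exp_type_besselJ.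
Qed.
Lemma reU1_dphi (t phi : R) : is_derive (fun y => reU1 t y) phi (- imU2 t phi).
Proof.
  unfold imU2, zJ2. rewrite <- offset_half_pi by (do 2 apply exp_type_freq; apply exp_type_besselJ).
  apply is_derive_V_phi, exp_type_freq, exp_type_besselJ.
Qed.
Lemma imU1_dphi (t phi : R) : is_derive (fun y => imU1 t y) phi (reU2 t phi).
Proof.
  unfold reU2, zJ2. replace 0 with (- (PI / 2) + PI / 2) by ring.
  apply is_derive_V_phi, exp_type_freq, exp_type_besselJ.
Qed.

Lemma reU2_ode (t phi : R) :
  reU2 t phi = reU1 t phi + lam nu * reU t phi -
    exp (2 * t) * (cos (2 * phi) * reU t phi - sin (2 * phi) * imU t phi).
Proof.
  unfold reU2. rewrite zJ_ode, Rplus_0_l. unfold zJ at 2.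
  rewrite V_offset by apply exp_type_besselJ. reflexivity.
Qed.

Lemma imU2_ode (t phi : R) :
  imU2 t phi = imU1 t phi + lam nu * imU t phi -
    exp (2 * t) * (sin (2 * phi) * reU t phi + cos (2 * phi) * imU t phi).
Proof.
  unfold imU2. rewrite zJ_ode. unfold zJ at 2.
  rewrite V_offset by apply exp_type_besselJ.
  rewrite cos_plus, sin_plus, cos_neg, sin_neg, cos_PI2, sin_PI2.
  unfold imU1, reU, imU, zJ. ring.
Qed.

Let energy t phi :=
  exp (- (2 * (exp t * sin phi))) *
  (reU t phi ^ 2 + imU t phi ^ 2 + exp (- (2 * t)) * (reU1 t phi ^ 2 + imU1 t phi ^ 2)).

(** On a ray the damping factor [e^(-2 Im z)] compensates exactly the growth
    rate of the equation, up to the integrable perturbation [lam / z^2]. *)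
Lemma energy_derive (t phi : R) :
  0 <= sin phi ->
  exists l, is_derive (fun y : R => energy y phi) t l /\ l <= Rabs (lam nu) * exp (- t) * energy t phi.
Proof.
  intros Hphi.
  set (r := exp t). set (q := exp (- t)). set (x := cos phi). set (y := sin phi) in *.
  assert (Hr : 0 < r) by apply exp_pos. assert (Hq : 0 < q) by apply exp_pos.
  assert (Hrq : r * q = 1) by apply exp_mul_opp.
  assert (Er2 : exp (2 * t) = r * r) by apply exp_double.
  assert (Eq2 : exp (- (2 * t)) = q * q).
  { unfold q. rewrite <- exp_double. f_equal. ring. }
  assert (Hxy : y * y = 1 - x * x).
  { pose proof (sin2_cos2 phi) as H. unfold Rsqr in H. unfold x, y. lra. }
  set (a0 := reU t phi). set (b0 := imU t phi). set (a1 := reU1 t phi). set (b1 := imU1 t phi).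
  set (E := exp (- (2 * (r * y)))).
  assert (HE : 0 < E) by apply exp_pos.
  exists (E * (- (2 * (r * y)) * (a0 ^ 2 + b0 ^ 2 + q * q * (a1 ^ 2 + b1 ^ 2)) +
      2 * lam nu * (q * q) * (a0 * a1 + b0 * b1) +
      4 * y * (a0 * (y * a1 - x * b1) + b0 * (y * b1 + x * a1)))).
  split.
  - unfold energy.
    assert (HA0 := reU_dt t phi). assert (HB0 := imU_dt t phi).
    assert (HA1 := reU1_dt t phi). assert (HB1 := imU1_dt t phi).
    auto_derive.
    + repeat split; try (eexists; eassumption).
    + derive_values.
      rewrite reU2_ode, imU2_ode, cos_2a, sin_2a, Er2, Eq2.
      fold r x y a0 b0 a1 b1 E.
      ring [Hrq Hxy].
  - set (W := a0 ^ 2 + b0 ^ 2 + q * q * (a1 ^ 2 + b1 ^ 2)).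
    assert (EW : energy t phi = E * W).
    { unfold energy. rewrite Eq2. fold r y a0 b0 a1 b1 E. reflexivity. }
    rewrite EW.
    replace (Rabs (lam nu) * q * (E * W)) with (E * (Rabs (lam nu) * q * W)) by ring.
    apply Rmult_le_compat_l; [lra|].
    assert (H1 : 4 * y * (a0 * (y * a1 - x * b1) + b0 * (y * b1 + x * a1)) <= 2 * (r * y) * W).
    { assert (Hsq : (y * a1 - x * b1) ^ 2 + (y * b1 + x * a1) ^ 2 = a1 ^ 2 + b1 ^ 2)
        by ring [Hxy].
      unfold W. rewrite <- Hsq.
      set (g1 := y * a1 - x * b1). set (g2 := y * b1 + x * a1).
      assert (0 <= 2 * (r * y) * ((a0 - q * g1) ^ 2 + (b0 - q * g2) ^ 2)).
      { apply Rmult_le_pos; [nra|]. pose proof (pow2_ge_0 (a0 - q * g1)).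
        pose proof (pow2_ge_0 (b0 - q * g2)). lra. }
      replace (4 * y * (a0 * g1 + b0 * g2))
        with (2 * (r * y) * (a0 ^ 2 + b0 ^ 2 + q * q * (g1 ^ 2 + g2 ^ 2)) -
              2 * (r * y) * ((a0 - q * g1) ^ 2 + (b0 - q * g2) ^ 2)) by ring [Hrq].
      lra. }
    assert (H2 : 2 * lam nu * (q * q) * (a0 * a1 + b0 * b1) <= Rabs (lam nu) * q * W).
    { replace (2 * lam nu * (q * q) * (a0 * a1 + b0 * b1))
        with (q * (lam nu * (2 * q * (a0 * a1 + b0 * b1)))) by ring.
      replace (Rabs (lam nu) * q * W) with (q * (Rabs (lam nu) * W)) by ring.
      apply Rmult_le_compat_l; [lra|].
      apply Rle_trans with (1 := Rle_abs _). rewrite Rabs_mult.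
      apply Rmult_le_compat_l; [apply Rabs_pos|]. apply Rabs_le. unfold W.
      pose proof (pow2_ge_0 (a0 - q * a1)). pose proof (pow2_ge_0 (b0 - q * b1)).
      pose proof (pow2_ge_0 (a0 + q * a1)). pose proof (pow2_ge_0 (b0 + q * b1)).
      split; nra. }
    lra.
Qed.

(** The perturbation is integrable in [t], so the damped energy stays bounded
    uniformly in the direction. *)
Lemma energy_bounded :
  exists K, 0 < K /\ forall t phi, 0 <= t -> 0 <= sin phi -> energy t phi <= K.
Proof.
  pose proof (exp_type_besselJ nu) as H0.
  pose proof (exp_type_freq _ (nu + / 2) H0) as H1.
  set (M0 := V (fun k => Rabs (besselJ_coef nu k)) (nu + / 2) 0 0 0).
  set (M1 := V (fun k => Rabs (freq (nu + / 2) k * besselJ_coef nu k)) (nu + / 2) 0 0 0).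
  set (K0 := 2 * M0 ^ 2 + 2 * M1 ^ 2 + 1).
  assert (HK0 : 0 < K0).
  { unfold K0. pose proof (pow2_ge_0 M0). pose proof (pow2_ge_0 M1). lra. }
  exists (K0 * exp (Rabs (lam nu))). split.
  { apply Rmult_lt_0_compat; [exact HK0|apply exp_pos]. }
  intros t phi Ht Hphi.
  assert (Hsq : forall v M, Rabs v <= M -> v ^ 2 <= M ^ 2).
  { intros v M Hv. rewrite <- (pow2_abs v). apply pow_incr. split; [apply Rabs_pos|exact Hv]. }
  assert (Hinit : energy 0 phi <= K0).
  { unfold energy.
    assert (a0 := Hsq _ _ (V_abs_le _ (nu + / 2) 0 phi 0 H0)).
    assert (b0 := Hsq _ _ (V_abs_le _ (nu + / 2) 0 phi (- (PI / 2)) H0)).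
    assert (a1 := Hsq _ _ (V_abs_le _ (nu + / 2) 0 phi 0 H1)).
    assert (b1 := Hsq _ _ (V_abs_le _ (nu + / 2) 0 phi (- (PI / 2)) H1)).
    fold M0 in a0, b0. fold M1 in a1, b1.
    change (reU 0 phi ^ 2 <= M0 ^ 2) in a0. change (imU 0 phi ^ 2 <= M0 ^ 2) in b0.
    change (reU1 0 phi ^ 2 <= M1 ^ 2) in a1. change (imU1 0 phi ^ 2 <= M1 ^ 2) in b1.
    rewrite Rmult_0_r, Ropp_0, exp_0.
    assert (He : exp (- (2 * (1 * sin phi))) <= 1).
    { rewrite <- exp_0 at 2. apply exp_nondecreasing. lra. }
    pose proof (exp_pos (- (2 * (1 * sin phi)))).
    set (w := reU 0 phi ^ 2 + imU 0 phi ^ 2 + 1 * (reU1 0 phi ^ 2 + imU1 0 phi ^ 2)).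
    assert (0 <= w).
    { unfold w. pose proof (pow2_ge_0 (reU 0 phi)). pose proof (pow2_ge_0 (imU 0 phi)).
      pose proof (pow2_ge_0 (reU1 0 phi)). pose proof (pow2_ge_0 (imU1 0 phi)). lra. }
    assert (w <= K0) by (unfold w, K0; lra). nra. }
  assert (Hmono : energy t phi * exp (Rabs (lam nu) * exp (- t)) <=
                  energy 0 phi * exp (Rabs (lam nu) * exp (- 0))).
  { apply Ropp_le_cancel.
    assert (Hd : forall y : R, exists l : R,
      is_derive (fun y : R => - (energy y phi * exp (Rabs (lam nu) * exp (- y)))) y l /\ 0 <= l).
    { intros y. destruct (energy_derive y phi Hphi) as [l [Hl Hle]].
      exists (- (l * exp (Rabs (lam nu) * exp (- y)) +
              energy y phi * (exp (Rabs (lam nu) * exp (- y)) * (- (Rabs (lam nu) * exp (- y)))))).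
      split.
      - auto_derive; [eexists; exact Hl|].
        derive_values.
        ring.
      - pose proof (exp_pos (Rabs (lam nu) * exp (- y))). nra. }
    apply (nondecreasing_of_derive
      (fun y => - (energy y phi * exp (Rabs (lam nu) * exp (- y))))
      (fun y => Derive (fun y => - (energy y phi * exp (Rabs (lam nu) * exp (- y)))) y) 0 t Ht).
    - intros y _. destruct (Hd y) as [l [Hl _]]. apply Derive_correct. now exists l.
    - intros y _. destruct (Hd y) as [l [Hl H]]. rewrite (is_derive_unique _ _ _ Hl). exact H. }
  rewrite Ropp_0, exp_0, Rmult_1_r in Hmono.
  assert (H1e : 1 <= exp (Rabs (lam nu) * exp (- t))).
  { rewrite <- exp_0 at 1. apply exp_nondecreasing. apply Rmult_le_pos; [apply Rabs_pos|].
    apply Rlt_le, exp_pos. }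
  assert (He0 : 0 <= energy t phi).
  { unfold energy. pose proof (exp_pos (- (2 * t))).
    apply Rmult_le_pos; [apply Rlt_le, exp_pos|].
    pose proof (pow2_ge_0 (reU t phi)). pose proof (pow2_ge_0 (imU t phi)).
    pose proof (pow2_ge_0 (reU1 t phi)). pose proof (pow2_ge_0 (imU1 t phi)). nra. }
  apply Rle_trans with (energy t phi * exp (Rabs (lam nu) * exp (- t))); [nra|].
  apply Rle_trans with (1 := Hmono).
  apply Rmult_le_compat_r; [apply Rlt_le, exp_pos|exact Hinit].
Qed.

(** Real and imaginary part of [e^(iz) (u + i u') / 2] with [u = sqrt z J_nu z]:
    for [u = a e^(-iz) + b e^(iz)] this is the constant [a]. *)
Let reW t phi :=
  exp (- (exp t * sin phi)) / 2 *
  ((cos (exp t * cos phi) * reU t phi - sin (exp t * cos phi) * imU t phi) -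
   exp (- t) * (sin (exp t * cos phi - phi) * reU1 t phi + cos (exp t * cos phi - phi) * imU1 t phi)).
Let imW t phi :=
  exp (- (exp t * sin phi)) / 2 *
  ((sin (exp t * cos phi) * reU t phi + cos (exp t * cos phi) * imU t phi) +
   exp (- t) * (cos (exp t * cos phi - phi) * reU1 t phi - sin (exp t * cos phi - phi) * imU1 t phi)).

(** The coefficient would be constant for [u'' + u = 0]; only the perturbation
    [lam u / z^2] contributes to its derivative. *)
Lemma wave_derive_phi (t phi : R) :
  is_derive (fun y : R => reW t y) phi
    (- (exp (- (exp t * sin phi)) * (lam nu / 2) * exp (- t) *
        (cos (exp t * cos phi - phi) * reU t phi - sin (exp t * cos phi - phi) * imU t phi))) /\
  is_derive (fun y : R => imW t y) phi
    (- (exp (- (exp t * sin phi)) * (lam nu / 2) * exp (- t) *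
        (sin (exp t * cos phi - phi) * reU t phi + cos (exp t * cos phi - phi) * imU t phi))).
Proof.
  set (r := exp t). set (q := exp (- t)). set (x := cos phi). set (y := sin phi).
  assert (Hrq : r * q = 1) by apply exp_mul_opp.
  assert (Er2 : exp (2 * t) = r * r) by apply exp_double.
  assert (Hxy : y * y = 1 - x * x).
  { pose proof (sin2_cos2 phi) as H. unfold Rsqr in H. unfold x, y. lra. }
  set (S := sin (r * x - phi)). set (C := cos (r * x - phi)).
  assert (HS : sin (r * x) = S * x + C * y).
  { replace (r * x) with (r * x - phi + phi) by ring. rewrite sin_plus. reflexivity. }
  assert (HC : cos (r * x) = C * x - S * y).
  { replace (r * x) with (r * x - phi + phi) by ring. rewrite cos_plus. reflexivity. }
  assert (D1 := reU_dphi t phi). assert (D2 := imU_dphi t phi).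
  assert (D3 := reU1_dphi t phi). assert (D4 := imU1_dphi t phi).
  assert (EA := reU2_ode t phi). assert (EB := imU2_ode t phi).
  rewrite cos_2a, sin_2a, Er2 in EA, EB. fold x y in EA, EB.
  unfold reW, imW. split.
  - auto_derive; [repeat split; eexists; eassumption|].
    change (exp t * cos phi + - phi) with (r * x - phi).
    derive_values. rewrite EA, EB. fold r q x y S C. rewrite HS, HC.
    generalize (exp (- (r * y))). intros E.
    field_simplify_eq. ring [Hrq Hxy].
  - auto_derive; [repeat split; eexists; eassumption|].
    change (exp t * cos phi + - phi) with (r * x - phi).
    derive_values. rewrite EA, EB. fold r q x y S C. rewrite HS, HC.
    generalize (exp (- (r * y))). intros E.
    field_simplify_eq. ring [Hrq Hxy].
Qed.

Lemma abs_le_of_sq (v K : R) : 0 < K -> v ^ 2 <= K -> Rabs v <= K + 1.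
Proof.
  intros HK Hv. rewrite <- (pow2_abs v) in Hv. pose proof (Rabs_pos v).
  destruct (Rle_dec (Rabs v) (K + 1)) as [|Hn]; [assumption|]. nra.
Qed.

(** Along the arc from the real to the imaginary axis the coefficient of
    [e^(-iz)] changes only by O(1/r). *)
Lemma wave_arc :
  exists K, forall t, 0 <= t ->
    Rabs (reW t (PI / 2) - reW t 0) <= K * exp (- t) /\
    Rabs (imW t (PI / 2) - imW t 0) <= K * exp (- t).
Proof.
  destruct energy_bounded as [K [HK Hen]].
  set (M := Rabs (lam nu / 2) * (K + 1)).
  assert (HM : 0 <= M) by (apply Rmult_le_pos; [apply Rabs_pos|lra]).
  exists (M * (PI / 2)). intros t Ht. pose proof PI_RGT_0 as Hpi.
  assert (Hq : 0 < exp (- t)) by apply exp_pos.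
  assert (Hb : forall c s phi, c ^ 2 + s ^ 2 = 1 -> 0 <= phi <= PI / 2 ->
     Rabs (- (exp (- (exp t * sin phi)) * (lam nu / 2) * exp (- t) *
            (c * reU t phi - s * imU t phi))) <= M * exp (- t)).
  { intros c s phi Hcs Hphi.
    assert (Hsin : 0 <= sin phi) by (apply sin_ge_0; lra).
    assert (Hsq : (exp (- (exp t * sin phi)) * (c * reU t phi - s * imU t phi)) ^ 2 <= K).
    { apply Rle_trans with (2 := Hen t phi Ht Hsin). unfold energy.
      replace (- (2 * (exp t * sin phi)))
        with (- (exp t * sin phi) + - (exp t * sin phi)) by ring.
      rewrite exp_plus.
      set (e := exp (- (exp t * sin phi))).
      replace ((e * (c * reU t phi - s * imU t phi)) ^ 2)
        with (e * e * (c * reU t phi - s * imU t phi) ^ 2) by ring.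
      apply Rmult_le_compat_l; [nra|].
      assert (E : (c * reU t phi - s * imU t phi) ^ 2 =
                  (c ^ 2 + s ^ 2) * (reU t phi ^ 2 + imU t phi ^ 2) -
                  (s * reU t phi + c * imU t phi) ^ 2) by ring.
      rewrite E, Hcs.
      pose proof (pow2_ge_0 (s * reU t phi + c * imU t phi)).
      pose proof (pow2_ge_0 (reU1 t phi)). pose proof (pow2_ge_0 (imU1 t phi)).
      pose proof (exp_pos (- (2 * t))). nra. }
    apply abs_le_of_sq in Hsq; [|exact HK].
    replace (- (exp (- (exp t * sin phi)) * (lam nu / 2) * exp (- t) *
            (c * reU t phi - s * imU t phi)))
      with (- (exp (- t) * ((lam nu / 2) *
             (exp (- (exp t * sin phi)) * (c * reU t phi - s * imU t phi))))) by ring.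
    rewrite Rabs_Ropp, Rabs_mult, (Rabs_right (exp (- t))), Rabs_mult by lra.
    unfold M. pose proof (Rabs_pos (lam nu / 2)).
    rewrite (Rmult_comm _ (exp (- t))).
    apply Rmult_le_compat_l; [lra|]. now apply Rmult_le_compat_l. }
  split.
  - destruct (mvt (fun y => reW t y) _ 0 (PI / 2) ltac:(lra) (fun y _ => proj1 (wave_derive_phi t y)))
      as [c [Hc E]].
    rewrite E, Rminus_0_r, Rabs_mult, (Rabs_right (PI / 2)) by lra.
    replace (M * (PI / 2) * exp (- t)) with (M * exp (- t) * (PI / 2)) by ring.
    apply Rmult_le_compat_r; [lra|]. apply Hb; [|lra].
    pose proof (sin2_cos2 (exp t * cos c - c)) as H. unfold Rsqr in H. simpl. lra.
  - destruct (mvt (fun y => imW t y) _ 0 (PI / 2) ltac:(lra) (fun y _ => proj2 (wave_derive_phi t y)))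
      as [c [Hc E]].
    rewrite E, Rminus_0_r, Rabs_mult, (Rabs_right (PI / 2)) by lra.
    replace (M * (PI / 2) * exp (- t)) with (M * exp (- t) * (PI / 2)) by ring.
    apply Rmult_le_compat_r; [lra|].
    replace (sin (exp t * cos c - c) * reU t c + cos (exp t * cos c - c) * imU t c)
      with (sin (exp t * cos c - c) * reU t c - - cos (exp t * cos c - c) * imU t c) by ring.
    apply Hb; [|lra].
    pose proof (sin2_cos2 (exp t * cos c - c)) as H. unfold Rsqr in H. simpl. lra.
Qed.

(** [sqrt r J_nu r] and its derivative in [r], in the variable [t = ln r]. *)
Definition uJ (t : R) : R := reU t 0.
Definition pJ (t : R) : R := exp (- t) * reU1 t 0.

Lemma cos_pi_shift (k : nat) (x : R) : cos (INR k * PI + x) = (-1) ^ k * cos x.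
Proof.
  induction k as [|k IH].
  - simpl. rewrite Rmult_0_l, Rplus_0_l. ring.
  - rewrite S_INR. replace ((INR k + 1) * PI + x) with (INR k * PI + x + PI) by ring.
    rewrite neg_cos, IH. simpl. ring.
Qed.

Lemma m1_pow_sq (k : nat) : (-1) ^ k * (-1) ^ k = 1.
Proof. rewrite <- Rpow_mult_distr. replace (-1 * -1) with 1 by ring. apply pow1. Qed.

(** On the positive imaginary axis the factor [i^(2k)] cancels the alternating
    signs of the series. *)
Lemma zJ_imaginary (t c : R) :
  zJ nu t (PI / 2) c = cos ((nu + / 2) * (PI / 2) + c) * (exp (t / 2) * besselI nu t) /\
  zJ1 nu t (PI / 2) c =
    cos ((nu + / 2) * (PI / 2) + c) * (exp (t / 2) * (besselI' nu t + / 2 * besselI nu t)).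
Proof.
  assert (Hph : forall k, cos (freq (nu + / 2) k * (PI / 2) + c) =
                (-1) ^ k * cos ((nu + / 2) * (PI / 2) + c)).
  { intros k. rewrite <- cos_pi_shift. f_equal. unfold freq. field. }
  assert (Hex : forall k, exp (freq (nu + / 2) k * t) = exp (t / 2) * exp (freq nu k * t)).
  { intros k. rewrite <- exp_plus. f_equal. unfold freq. field. }
  split.
  - unfold zJ, besselI, V. rewrite <- !Series_scal_l. apply Series_ext. intros k.
    unfold Vterm, besselJ_coef. rewrite Hph, Hex.
    replace (freq nu k * 0 + 0) with 0 by ring. rewrite cos_0.
    pose proof (m1_pow_sq k) as H. ring [H].
  - unfold zJ1, besselI, besselI'.
    replace (V (fun k => freq nu k * besselI_coef nu k) nu t 0 0 +
             / 2 * V (besselI_coef nu) nu t 0 0)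
      with (1 * V (fun k => freq nu k * besselI_coef nu k) nu t 0 0 +
             / 2 * V (besselI_coef nu) nu t 0 0) by ring.
    rewrite <- V_lin by (try apply exp_type_freq; apply exp_type_besselI).
    unfold V. rewrite <- !Series_scal_l. apply Series_ext. intros k.
    unfold Vterm, besselJ_coef. rewrite Hph, Hex.
    replace (freq nu k * 0 + 0) with 0 by ring. rewrite cos_0.
    replace (freq (nu + / 2) k) with (freq nu k + / 2) by (unfold freq; ring).
    pose proof (m1_pow_sq k) as H. ring [H].
Qed.

Lemma zJ_real_im (t : R) : imU t 0 = 0 /\ imU1 t 0 = 0.
Proof.
  assert (H : forall a s, V a s t 0 (- (PI / 2)) = 0).
  { intros a s. transitivity (0 * V a s t 0 0); [|ring].
    unfold V. rewrite <- Series_scal_l. apply Series_ext. intros k. unfold Vterm.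
    replace (freq s k * 0 + - (PI / 2)) with (- (PI / 2)) by ring.
    rewrite cos_neg, cos_PI2. ring. }
  split; [exact (H _ _)|exact (H _ _)].
Qed.

(** On the imaginary axis the coefficient tends to the growth constant of [I_nu]
    times [e^(i pi (nu + 1/2) / 2)], the value of [z^(nu + 1/2)] at [z = i]; on
    the real axis it determines the amplitude and phase of [u]. *)
Lemma J_asymptotic :
  is_lim (fun t => cos (exp t) * uJ t - sin (exp t) * pJ t) p_infty
    (2 * besselI_const * cos ((nu + / 2) * (PI / 2))) /\
  is_lim (fun t => sin (exp t) * uJ t + cos (exp t) * pJ t) p_infty
    (2 * besselI_const * sin ((nu + / 2) * (PI / 2))).
Proof.
  set (om := (nu + / 2) * (PI / 2)).
  assert (HI : is_lim (fun t => exp (- exp t) * exp (t / 2) *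
            (besselI nu t + exp (- t) * (besselI' nu t + / 2 * besselI nu t)) / 2) p_infty
            besselI_const).
  { assert (H := is_lim_plus' _ _ _ _ _
            (is_lim_plus' _ _ _ _ _ (besselI_grows_all nu) (besselI'_grows nu))
            (is_lim_mult_exp_opp (/ 2) _ _ (besselI_grows_all nu))).
    assert (H' := is_lim_scal_l _ (/ 2) _ _ H). simpl in H'.
    replace (/ 2 * (besselI_const + besselI_const + 0)) with besselI_const in H' by field.
    eapply is_lim_ext; [|exact H']. intros t. simpl. field. }
  destruct wave_arc as [K HK].
  assert (Hsmall : forall f g : R -> R, (forall t, 0 <= t -> Rabs (f t - g t) <= K * exp (- t)) ->
            is_lim (fun t => 2 * (g t - f t)) p_infty 0).
  { intros f g Hfg.
    assert (H0 := is_lim_scal_l _ (2 * K) _ _ is_lim_exp_opp). simpl in H0.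
    rewrite Rmult_0_r in H0.
    apply (is_lim_le_le_loc (fun t => - (2 * K * exp (- t))) (fun t => 2 * K * exp (- t))).
    - exists 0. intros t Ht. specialize (Hfg t ltac:(lra)).
      apply Rabs_le_between in Hfg. lra.
    - replace (Finite 0) with (Finite (- 0)) by (f_equal; ring). exact (is_lim_opp _ _ _ H0).
    - exact H0. }
  assert (Hpi : forall t, sin (exp t * cos (PI / 2) - PI / 2) = -1 /\
                          cos (exp t * cos (PI / 2) - PI / 2) = 0 /\
                          sin (exp t * cos (PI / 2)) = 0 /\ cos (exp t * cos (PI / 2)) = 1).
  { intros t. rewrite cos_PI2, Rmult_0_r.
    replace (0 - PI / 2) with (- (PI / 2)) by ring.
    rewrite sin_neg, cos_neg, cos_PI2, sin_PI2, sin_0, cos_0. lra. }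
  split.
  - assert (H1 := is_lim_scal_l _ (2 * cos om) _ _ HI). simpl in H1.
    assert (H2 := Hsmall (fun t => reW t (PI / 2)) (fun t => reW t 0)
                    (fun t Ht => proj1 (HK t Ht))).
    assert (H3 := is_lim_plus' _ _ _ _ _ H1 H2).
    replace (2 * besselI_const * cos om) with (2 * cos om * besselI_const + 0) by ring.
    eapply is_lim_ext; [|exact H3]. intros t. cbv beta.
    destruct (zJ_real_im t) as [Hb0 Hb1].
    destruct (Hpi t) as [E1 [E2 [E3 E4]]].
    unfold reW. rewrite E1, E2, E3, E4, Hb0, Hb1.
    rewrite sin_0, cos_0, sin_PI2, Rmult_1_r, Rmult_0_r, Rminus_0_r, Ropp_0, exp_0.
    change (reU t (PI / 2)) with (zJ nu t (PI / 2) 0).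
    change (reU1 t (PI / 2)) with (zJ1 nu t (PI / 2) 0).
    rewrite (proj1 (zJ_imaginary t 0)), (proj2 (zJ_imaginary t 0)).
    rewrite Rplus_0_r. fold om. unfold uJ, pJ. field.
  - assert (H1 := is_lim_scal_l _ (2 * sin om) _ _ HI). simpl in H1.
    assert (H2 := Hsmall (fun t => imW t (PI / 2)) (fun t => imW t 0)
                    (fun t Ht => proj2 (HK t Ht))).
    assert (H3 := is_lim_plus' _ _ _ _ _ H1 H2).
    replace (2 * besselI_const * sin om) with (2 * sin om * besselI_const + 0) by ring.
    eapply is_lim_ext; [|exact H3]. intros t. cbv beta.
    destruct (zJ_real_im t) as [Hb0 Hb1].
    destruct (Hpi t) as [E1 [E2 [E3 E4]]].
    unfold imW. rewrite E1, E2, E3, E4, Hb0, Hb1.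
    rewrite sin_0, cos_0, sin_PI2, Rmult_1_r, Rmult_0_r, Rminus_0_r, Ropp_0, exp_0.
    change (imU t (PI / 2)) with (zJ nu t (PI / 2) (- (PI / 2))).
    change (imU1 t (PI / 2)) with (zJ1 nu t (PI / 2) (- (PI / 2))).
    rewrite (proj1 (zJ_imaginary t (- (PI / 2)))), (proj2 (zJ_imaginary t (- (PI / 2)))).
    fold om. replace (om + - (PI / 2)) with (- (PI / 2 - om)) by ring.
    rewrite cos_neg, cos_shift. unfold uJ, pJ. field.
Qed.

End Quadrant.

(** * Solutions of Bessel's equation and their behaviour at infinity *)

(** With [x = e^t], the pair [(u, p)] is [sqrt x y] and its derivative in [x],
    where [y] solves Bessel's equation and [l] is [nu^2 - 1/4]. *)
Definition solution (l : R) (u p : R -> R) : Prop :=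
  forall t, is_derive u t (exp t * p t) /\
            is_derive p t (- (exp t * u t) + l * exp (- t) * u t).

(** [u ~ al cos x + be sin x] and [p ~ be cos x - al sin x]: the coefficients are
    recovered by rotating [(u, p)] back through the angle [x]. *)
Definition asymptotic (u p : R -> R) (al be : R) : Prop :=
  is_lim (fun t => cos (exp t) * u t - sin (exp t) * p t) p_infty al /\
  is_lim (fun t => sin (exp t) * u t + cos (exp t) * p t) p_infty be.

Lemma solution_linear (l : R) u p v q (a b : R) :
  solution l u p -> solution l v q ->
  solution l (fun t => a * u t + b * v t) (fun t => a * p t + b * q t).
Proof.
  intros H1 H2 t. destruct (H1 t) as [Hu Hp]. destruct (H2 t) as [Hv Hq].
  split.
  - replace (exp t * (a * p t + b * q t)) with (a * (exp t * p t) + b * (exp t * q t)) by ring.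
    exact (is_derive_plus _ _ _ _ _ (is_derive_scal _ _ a _ Hu) (is_derive_scal _ _ b _ Hv)).
  - replace (- (exp t * (a * u t + b * v t)) + l * exp (- t) * (a * u t + b * v t))
      with (a * (- (exp t * u t) + l * exp (- t) * u t) +
            b * (- (exp t * v t) + l * exp (- t) * v t)) by ring.
    exact (is_derive_plus _ _ _ _ _ (is_derive_scal _ _ a _ Hp) (is_derive_scal _ _ b _ Hq)).
Qed.

Lemma asymptotic_linear u p v q (al be al' be' a b : R) :
  asymptotic u p al be -> asymptotic v q al' be' ->
  asymptotic (fun t => a * u t + b * v t) (fun t => a * p t + b * q t)
    (a * al + b * al') (a * be + b * be').
Proof.
  intros [H1 H2] [H3 H4]. split.
  - assert (H := is_lim_plus' _ _ _ _ _ (is_lim_scal_l _ a _ _ H1) (is_lim_scal_l _ b _ _ H3)).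
    eapply is_lim_ext; [|exact H]. intros t. simpl. ring.
  - assert (H := is_lim_plus' _ _ _ _ _ (is_lim_scal_l _ a _ _ H2) (is_lim_scal_l _ b _ _ H4)).
    eapply is_lim_ext; [|exact H]. intros t. simpl. ring.
Qed.

(** Two solutions are close wherever their data at infinity and their parameters
    are: the energy of the difference can grow from infinity down to [T] only by
    the factor allowed by the integrable potential [l / x^2]. *)
Lemma solution_compare (l1 l2 : R) u1 p1 u2 p2 (a1 b1 a2 b2 L B T t : R) :
  solution l1 u1 p1 -> solution l2 u2 p2 ->
  asymptotic u1 p1 a1 b1 -> asymptotic u2 p2 a2 b2 ->
  Rabs l1 <= L -> (forall s, T <= s -> Rabs (u2 s) <= B) -> T <= t ->
  (u1 t - u2 t) ^ 2 + (p1 t - p2 t) ^ 2 <=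
  exp ((L + 1) * exp (- T)) *
    ((a1 - a2) ^ 2 + (b1 - b2) ^ 2 + (l1 - l2) ^ 2 * B ^ 2).
Proof.
  intros S1 S2 [A1 A1'] [A2 A2'] HL HB Ht.
  set (e := (l1 - l2) ^ 2 * B ^ 2).
  assert (He : 0 <= e) by (apply Rmult_le_pos; apply pow2_ge_0).
  set (G := fun s => (u1 s - u2 s) ^ 2 + (p1 s - p2 s) ^ 2 + e).
  set (F := fun s => G s * exp (- ((L + 1) * exp (- s)))).
  assert (HL0 : 0 <= L) by (pose proof (Rabs_pos l1); lra).
  assert (HF : forall s, T <= s -> exists d, is_derive F s d /\ 0 <= d).
  { intros s Hs.
    destruct (S1 s) as [D1 D1']. destruct (S2 s) as [D2 D2'].
    set (q := exp (- s)). set (r := exp s).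
    exists ((2 * (u1 s - u2 s) * (r * p1 s - r * p2 s) +
             2 * (p1 s - p2 s) * ((- (r * u1 s) + l1 * q * u1 s) - (- (r * u2 s) + l2 * q * u2 s))
             + (L + 1) * q * G s) * exp (- ((L + 1) * q))).
    split.
    - unfold F, G. auto_derive.
      + repeat split; eexists; eassumption.
      + derive_values.
        fold q r. ring.
    - apply Rmult_le_pos; [|apply Rlt_le, exp_pos].
      set (d := u1 s - u2 s). set (f := p1 s - p2 s).
      assert (Hq : 0 < q) by apply exp_pos.
      replace (2 * d * (r * p1 s - r * p2 s) +
               2 * f * (- (r * u1 s) + l1 * q * u1 s - (- (r * u2 s) + l2 * q * u2 s)) +
               (L + 1) * q * G s)
        with (q * (2 * l1 * f * d + 2 * f * ((l1 - l2) * u2 s) + (L + 1) * G s)).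
      2:{ unfold d, f. ring. }
      apply Rmult_le_pos; [lra|].
      assert (HBs : u2 s ^ 2 <= B ^ 2).
      { rewrite <- (pow2_abs (u2 s)). apply pow_incr. split; [apply Rabs_pos|now apply HB]. }
      assert (H1 : - L * (f ^ 2 + d ^ 2) <= 2 * l1 * f * d).
      { apply Rabs_le_between in HL.
        pose proof (pow2_ge_0 (f - d)). pose proof (pow2_ge_0 (f + d)).
        destruct (Rle_dec 0 l1); nra. }
      assert (H2 : - (f ^ 2 + e) <= 2 * f * ((l1 - l2) * u2 s)).
      { assert (((l1 - l2) * u2 s) ^ 2 <= e).
        { unfold e. rewrite Rpow_mult_distr. apply Rmult_le_compat_l; [apply pow2_ge_0|exact HBs]. }
        pose proof (pow2_ge_0 (f + (l1 - l2) * u2 s)). nra. }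
      unfold G. fold d f. pose proof (pow2_ge_0 d). pose proof (pow2_ge_0 f). nra. }
  assert (Hmono : forall s, t <= s -> F t <= F s).
  { intros s Hs. apply (nondecreasing_of_derive F (Derive F) t s Hs).
    - intros y Hy. destruct (HF y ltac:(lra)) as [d [Hd _]]. apply Derive_correct. now exists d.
    - intros y Hy. destruct (HF y ltac:(lra)) as [d [Hd Hd0]].
      now rewrite (is_derive_unique _ _ _ Hd). }
  set (W := (a1 - a2) ^ 2 + (b1 - b2) ^ 2 + e).
  assert (HG : is_lim G p_infty W).
  { assert (Ha := is_lim_minus' _ _ _ _ _ A1 A2).
    assert (Hb := is_lim_minus' _ _ _ _ _ A1' A2').
    assert (H := is_lim_plus' _ _ _ _ _
       (is_lim_plus' _ _ _ _ _ (is_lim_mult _ _ _ _ _ Ha Ha I) (is_lim_mult _ _ _ _ _ Hb Hb I))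
       (is_lim_const e p_infty)).
    simpl in H. unfold W.
    replace ((a1 - a2) ^ 2 + (b1 - b2) ^ 2 + e)
      with ((a1 - a2) * (a1 - a2) + (b1 - b2) * (b1 - b2) + e) by ring.
    eapply is_lim_ext; [|exact H]. intros s. unfold G. cbv beta.
    pose proof (sin2_cos2 (exp s)) as Hsc. unfold Rsqr in Hsc.
    set (S := sin (exp s)) in *. set (C := cos (exp s)) in *.
    assert (Hsc' : S * S = 1 - C * C) by lra.
    ring [Hsc']. }
  assert (HW : F t <= W).
  { apply (is_lim_le_loc (fun _ => F t) G p_infty (F t) W).
    - exists (Rmax t T). intros s Hs.
      assert (t < s) by (apply Rle_lt_trans with (2 := Hs); apply Rmax_l).
      apply Rle_trans with (1 := Hmono s ltac:(lra)). unfold F.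
      assert (HG0 : 0 <= G s).
      { unfold G. pose proof (pow2_ge_0 (u1 s - u2 s)). pose proof (pow2_ge_0 (p1 s - p2 s)). lra. }
      rewrite <- (Rmult_1_r (G s)) at 2. apply Rmult_le_compat_l; [exact HG0|].
      apply Rle_trans with (exp 0); [apply exp_nondecreasing|rewrite exp_0; lra].
      assert (0 <= (L + 1) * exp (- s)) by (apply Rmult_le_pos; [lra|apply Rlt_le, exp_pos]). lra.
    - apply is_lim_const.
    - exact HG. }
  unfold F in HW.
  assert (Hgt : G t <= exp ((L + 1) * exp (- t)) * W).
  { replace (G t) with (exp ((L + 1) * exp (- t)) * (G t * exp (- ((L + 1) * exp (- t))))).
    - apply Rmult_le_compat_l; [apply Rlt_le, exp_pos|exact HW].
    - rewrite <- Rmult_assoc, (Rmult_comm _ (G t)), Rmult_assoc, <- exp_plus, Rplus_opp_r, exp_0.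
      ring. }
  assert (HW0 : 0 <= W).
  { unfold W. pose proof (pow2_ge_0 (a1 - a2)). pose proof (pow2_ge_0 (b1 - b2)). lra. }
  assert (HeT : exp ((L + 1) * exp (- t)) <= exp ((L + 1) * exp (- T))).
  { apply exp_nondecreasing. apply Rmult_le_compat_l; [lra|]. apply exp_nondecreasing. lra. }
  apply Rle_trans with (G t); [unfold G; lra|].
  apply Rle_trans with (1 := Hgt). apply Rmult_le_compat_r; [exact HW0|exact HeT].
Qed.

Lemma solution_zero (l : R) : solution l (fun _ => 0) (fun _ => 0).
Proof.
  intros t. split.
  - rewrite Rmult_0_r. apply @is_derive_const.
  - replace (- (exp t * 0) + l * exp (- t) * 0) with 0 by ring. apply @is_derive_const.
Qed.

Lemma asymptotic_zero : asymptotic (fun _ => 0) (fun _ => 0) 0 0.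
Proof.
  split; eapply is_lim_ext; try apply (is_lim_const 0); intros t; simpl; ring.
Qed.

Lemma abs_le_of_sum_sq (x y z : R) : 0 <= z -> x ^ 2 + y ^ 2 <= z ^ 2 -> Rabs x <= z /\ Rabs y <= z.
Proof.
  intros Hz H. pose proof (pow2_ge_0 x). pose proof (pow2_ge_0 y).
  split; apply Rabs_le; split; nra.
Qed.

Lemma solution_bounded (l : R) u p (a b L T : R) :
  solution l u p -> asymptotic u p a b -> Rabs l <= L ->
  forall t, T <= t ->
    Rabs (u t) <= exp ((L + 1) * exp (- T)) * (Rabs a + Rabs b) /\
    Rabs (p t) <= exp ((L + 1) * exp (- T)) * (Rabs a + Rabs b).
Proof.
  intros S A HL t Ht.
  assert (H := solution_compare l l u p _ _ a b 0 0 L 0 T t S (solution_zero l) A asymptotic_zero HL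
             ltac:(intros; cbv beta; rewrite Rabs_R0; lra) Ht).
  rewrite !Rminus_0_r in H.
  assert (HL0 : 0 <= L) by (pose proof (Rabs_pos l); lra).
  set (e := exp ((L + 1) * exp (- T))) in *.
  assert (He : 1 <= e).
  { unfold e. rewrite <- exp_0 at 1. apply exp_nondecreasing. apply Rmult_le_pos; [lra|].
    apply Rlt_le, exp_pos. }
  pose proof (Rabs_pos a). pose proof (Rabs_pos b).
  apply abs_le_of_sum_sq; [nra|].
  apply Rle_trans with (1 := H).
  rewrite <- (pow2_abs a), <- (pow2_abs b).
  replace ((l - l) ^ 2 * 0 ^ 2) with 0 by ring.
  rewrite Rpow_mult_distr.
  apply Rle_trans with (e * (Rabs a + Rabs b) ^ 2).
  - apply Rmult_le_compat_l; [lra|]. nra.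
  - apply Rmult_le_compat_r; [apply pow2_ge_0|]. nra.
Qed.

Lemma is_lim_seq_bounded (u : nat -> R) (l : R) :
  is_lim_seq u l -> exists M, forall n, Rabs (u n) <= M.
Proof.
  intros H. apply is_lim_seq_spec in H. destruct (H (mkposreal 1 Rlt_0_1)) as [N HN]. simpl in HN.
  destruct (finite_bound u N) as [D [HD HDb]].
  exists (D + (Rabs l + 1)). intros n. pose proof (Rabs_pos l).
  destruct (Nat.lt_ge_cases n N) as [Hn|Hn].
  - specialize (HDb n Hn). lra.
  - specialize (HN n Hn). pose proof (Rabs_triang (u n - l) l).
    replace (u n - l + l) with (u n) in H1 by ring. lra.
Qed.

Lemma converges_of_rate (u : nat -> R) (d : nat -> R) (C : R) :
  0 <= C -> is_lim_seq d 0 -> (forall n m, Rabs (u n - u m) <= C * (d n + d m)) ->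
  exists l : R, is_lim_seq u l /\ forall n, Rabs (u n - l) <= C * d n.
Proof.
  intros HC Hd Hu.
  assert (Hc : ex_finite_lim_seq u).
  { apply ex_lim_seq_cauchy_corr. intros eps.
    apply is_lim_seq_spec in Hd.
    assert (He : 0 < eps / (2 * (C + 1))).
    { apply Rdiv_lt_0_compat; [apply cond_pos|lra]. }
    destruct (Hd (mkposreal _ He)) as [N HN]. simpl in HN. exists N. intros n m Hn Hm.
    apply Rle_lt_trans with (1 := Hu n m).
    assert (H1 := HN n Hn). assert (H2 := HN m Hm).
    rewrite Rminus_0_r in H1, H2. apply Rabs_def2 in H1. apply Rabs_def2 in H2.
    apply Rle_lt_trans with ((C + 1) * (d n + d m) + (Rabs (d n + d m) - (d n + d m)) * (C + 1)).
    - pose proof (Rle_abs (d n + d m)). pose proof (Rabs_pos (d n + d m)). nra.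
    - replace ((C + 1) * (d n + d m) + (Rabs (d n + d m) - (d n + d m)) * (C + 1))
        with ((C + 1) * Rabs (d n + d m)) by ring.
      replace (pos eps) with ((C + 1) * (2 * (eps / (2 * (C + 1))))) by (field; lra).
      apply Rmult_lt_compat_l; [lra|]. apply Rabs_def1; lra. }
  destruct Hc as [l Hl]. exists l. split; [exact Hl|].
  intros n.
  assert (H1 : is_lim_seq (fun m => Rabs (u n - u m)) (Rabs (u n - l))).
  { apply (is_lim_seq_abs _ (u n - l)). apply is_lim_seq_minus'; [apply is_lim_seq_const|exact Hl]. }
  assert (H2 : is_lim_seq (fun m => C * (d n + d m)) (C * (d n + 0))).
  { apply is_lim_seq_mult'; [apply is_lim_seq_const|].
    apply is_lim_seq_plus'; [apply is_lim_seq_const|exact Hd]. }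
  rewrite Rplus_0_r in H2.
  exact (is_lim_seq_le _ _ (Rabs (u n - l)) (C * d n) (fun m => Hu n m) H1 H2).
Qed.

(** The second derivatives are bounded locally and uniformly, so pointwise limits
    of solutions are solutions. *)
Lemma solution_of_limit (l : nat -> R) (u p : nat -> R -> R) (l0 : R) (U P : R -> R) :
  (forall n, solution (l n) (u n) (p n)) -> is_lim_seq l l0 ->
  (forall t, is_lim_seq (fun n => u n t) (U t)) ->
  (forall t, is_lim_seq (fun n => p n t) (P t)) ->
  (forall T, exists B, forall n t, T <= t -> Rabs (u n t) <= B /\ Rabs (p n t) <= B) ->
  solution l0 U P.
Proof.
  intros HS Hl HU HP HB.
  destruct (is_lim_seq_bounded l l0 Hl) as [L HL].
  assert (HL0 : 0 <= L) by (pose proof (Rabs_pos (l O)); specialize (HL O); lra).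
  intros t.
  (* Bounds for the coefficients of the equation near [t]. *)
  set (R1 := exp (t + 1)). set (Q1 := exp (- (t - 1))).
  destruct (HB (t - 1)) as [b1 Hb1'].
  assert (Hnear : forall s, Rabs (s - t) < 1 ->
            0 < exp s <= R1 /\ 0 < exp (- s) <= Q1 /\
            forall n, Rabs (u n s) <= b1 /\ Rabs (p n s) <= b1).
  { intros s Hs. apply Rabs_def2 in Hs. split; [|split].
    - split; [apply exp_pos|]. apply exp_nondecreasing. lra.
    - split; [apply exp_pos|]. apply exp_nondecreasing. lra.
    - intros n. apply Hb1'. lra. }
  assert (HR1 : 0 < R1) by apply exp_pos. assert (HQ1 : 0 < Q1) by apply exp_pos.
  assert (Hb1 : 0 <= b1).
  { destruct (Hb1' O t ltac:(lra)) as [H _]. pose proof (Rabs_pos (u O t)). lra. }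
  assert (Hpt : forall s n, Rabs (s - t) < 1 ->
            Rabs (- (exp s * u n s) + l n * exp (- s) * u n s) <= (R1 + L * Q1) * b1).
  { intros s n Hs. destruct (Hnear s Hs) as [H1 [H2 H3]]. destruct (H3 n) as [H4 _].
    replace (- (exp s * u n s) + l n * exp (- s) * u n s)
      with ((- exp s + l n * exp (- s)) * u n s) by ring.
    rewrite Rabs_mult. apply Rmult_le_compat; try apply Rabs_pos; [|exact H4].
    apply Rle_trans with (1 := Rabs_triang _ _).
    rewrite Rabs_Ropp, Rabs_mult, (Rabs_right (exp s)), (Rabs_right (exp (- s))) by lra.
    apply Rplus_le_compat; [lra|]. apply Rmult_le_compat; try lra; [apply Rabs_pos|apply HL]. }
  split.
  + apply (is_derive_limit u (fun n => exp t * p n t) U t _ 1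
             (R1 * b1 + R1 * ((R1 + L * Q1) * b1))); [lra| | |].
    * intros y _. apply HU.
    * apply is_lim_seq_mult'; [apply is_lim_seq_const|apply HP].
    * intros n y Hy.
      apply (taylor_quadratic (u n) (fun s => exp s * p n s)
        (fun s => exp s * p n s + exp s * (- (exp s * u n s) + l n * exp (- s) * u n s))
        t y 1 _ Hy).
      intros z Hz. destruct (HS n z) as [D1 D2]. split; [exact D1|]. split.
      -- auto_derive; [eexists; exact D2|].
         derive_values.
         ring.
      -- destruct (Hnear z Hz) as [H1 [H2 H3]]. destruct (H3 n) as [_ H4].
         apply Rle_trans with (1 := Rabs_triang _ _).
         rewrite !Rabs_mult, (Rabs_right (exp z)) by lra.
         apply Rplus_le_compat; apply Rmult_le_compat; try lra; try apply Rabs_pos.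
         now apply Hpt.
  + apply (is_derive_limit p
             (fun n => - (exp t * u n t) + l n * exp (- t) * u n t) P t _ 1
             ((R1 + L * Q1) * b1 + (R1 + L * Q1) * (R1 * b1))); [lra| | |].
    * intros y _. apply HP.
    * apply is_lim_seq_plus'.
      -- apply (is_lim_seq_opp _ (exp t * U t)).
         apply is_lim_seq_mult'; [apply is_lim_seq_const|apply HU].
      -- apply is_lim_seq_mult'; [|apply HU].
         apply is_lim_seq_mult'; [exact Hl|apply is_lim_seq_const].
    * intros n y Hy.
      apply (taylor_quadratic (p n) (fun s => - (exp s * u n s) + l n * exp (- s) * u n s)
        (fun s => - (exp s + l n * exp (- s)) * u n s +
                  (- exp s + l n * exp (- s)) * (exp s * p n s))
        t y 1 _ Hy).
      intros z Hz. destruct (HS n z) as [D1 D2]. split; [exact D2|]. split.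
      -- auto_derive; [repeat split; eexists; exact D1|].
         derive_values.
         ring.
      -- destruct (Hnear z Hz) as [H1 [H2 H3]]. destruct (H3 n) as [H4 H5].
         assert (Hln : Rabs (l n * exp (- z)) <= L * Q1).
         { rewrite Rabs_mult, (Rabs_right (exp (- z))) by lra.
           apply Rmult_le_compat; try lra; [apply Rabs_pos|apply HL]. }
         apply Rle_trans with (1 := Rabs_triang _ _).
         apply Rplus_le_compat; rewrite Rabs_mult; apply Rmult_le_compat; try apply Rabs_pos.
         ++ rewrite Rabs_Ropp. apply Rle_trans with (1 := Rabs_triang _ _).
            rewrite (Rabs_right (exp z)) by lra. lra.
         ++ exact H4.
         ++ apply Rle_trans with (1 := Rabs_triang _ _).
            rewrite Rabs_Ropp, (Rabs_right (exp z)) by lra. lra.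
         ++ rewrite Rabs_mult, (Rabs_right (exp z)) by lra.
            apply Rmult_le_compat; try lra. apply Rabs_pos.
Qed.

Lemma is_lim_seq_abs_sub (x : nat -> R) (x0 : R) :
  is_lim_seq x x0 -> is_lim_seq (fun n => Rabs (x n - x0)) 0.
Proof.
  intros Hx. rewrite <- Rabs_R0. apply (is_lim_seq_abs _ 0).
  replace (Finite 0) with (Finite (x0 - x0)) by (f_equal; ring).
  apply is_lim_seq_minus'; [exact Hx|apply is_lim_seq_const].
Qed.

Lemma asymptotic_of_uniform_limit (u p : nat -> R -> R) (a b D : nat -> R)
    (U P : R -> R) (a0 b0 : R) :
  (forall n, asymptotic (u n) (p n) (a n) (b n)) -> is_lim_seq a a0 -> is_lim_seq b b0 ->
  is_lim_seq D 0 ->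
  (forall n t, 0 <= t -> Rabs (u n t - U t) <= D n /\ Rabs (p n t - P t) <= D n) ->
  asymptotic U P a0 b0.
Proof.
  intros HA Ha Hb HD HDu.
  assert (Hgen : forall (f g : R -> R) (v : nat -> R) (v0 : R),
    (forall t, Rabs (f t) <= 1) -> (forall t, Rabs (g t) <= 1) ->
    (forall n, is_lim (fun t => f (exp t) * u n t + g (exp t) * p n t) p_infty (v n)) ->
    is_lim_seq v v0 ->
    is_lim (fun t => f (exp t) * U t + g (exp t) * P t) p_infty v0).
  { intros f g v v0 Hf Hg Hv Hv0. apply is_lim_spec. intros eps.
    pose proof (cond_pos eps) as Heps.
    assert (Hd2 := is_lim_seq_plus' _ _ _ _ (is_lim_seq_mult' _ _ _ _ (is_lim_seq_const 2) HD)
               (is_lim_seq_abs_sub v v0 Hv0)).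
    rewrite Rmult_0_r, Rplus_0_r in Hd2. apply is_lim_seq_spec in Hd2.
    destruct (Hd2 (pos_div_2 eps)) as [n Hn]. specialize (Hn n (Nat.le_refl n)). simpl in Hn.
    rewrite Rminus_0_r in Hn.
    assert (Hvn := Hv n). apply is_lim_spec in Hvn.
    destruct (Hvn (pos_div_2 eps)) as [T HT]. simpl in HT.
    exists (Rmax 0 T). intros t Ht.
    assert (Ht0 : 0 < t) by (apply Rle_lt_trans with (2 := Ht); apply Rmax_l).
    assert (HtT : T < t) by (apply Rle_lt_trans with (2 := Ht); apply Rmax_r).
    specialize (HT t HtT).
    assert (H1 := proj1 (HDu n t ltac:(lra))). assert (H2 := proj2 (HDu n t ltac:(lra))).
    replace (f (exp t) * U t + g (exp t) * P t - v0)
      with ((f (exp t) * u n t + g (exp t) * p n t - v n) +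
            (- (f (exp t) * (u n t - U t)) + (- (g (exp t) * (p n t - P t)) + (v n - v0)))) by ring.
    apply Rle_lt_trans with (1 := Rabs_triang _ _).
    apply Rle_lt_trans with (Rabs (f (exp t) * u n t + g (exp t) * p n t - v n) +
      (D n + (D n + Rabs (v n - v0)))).
    - apply Rplus_le_compat_l. apply Rle_trans with (1 := Rabs_triang _ _).
      assert (Hb2 : forall x y z : R, Rabs x <= 1 -> Rabs y <= z -> Rabs (- (x * y)) <= z).
      { intros x y z Hx Hy. rewrite Rabs_Ropp, Rabs_mult.
        pose proof (Rabs_pos x). pose proof (Rabs_pos y). nra. }
      apply Rplus_le_compat; [apply Hb2; [apply Hf|exact H1]|].
      apply Rle_trans with (1 := Rabs_triang _ _).
      apply Rplus_le_compat_r. apply Hb2; [apply Hg|exact H2].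
    - pose proof (Rle_abs (2 * D n + Rabs (v n - v0))). lra. }
  split.
  + eapply is_lim_ext; [|apply (Hgen cos (fun x => - sin x) a a0)].
    * intros t. simpl. ring.
    * apply cos_abs_le.
    * intros t. rewrite Rabs_Ropp. apply sin_abs_le.
    * intros n. eapply is_lim_ext; [|exact (proj1 (HA n))]. intros t. simpl. ring.
    * exact Ha.
  + apply (Hgen sin cos b b0); [apply sin_abs_le|apply cos_abs_le| |exact Hb].
    intros n. exact (proj2 (HA n)).
Qed.

(** Solutions depend continuously on their parameter and on their data at
    infinity. *)
Lemma limit_of_solutions (l : nat -> R) (u p : nat -> R -> R) (a b : nat -> R) (l0 a0 b0 : R) :
  (forall n, solution (l n) (u n) (p n)) -> (forall n, asymptotic (u n) (p n) (a n) (b n)) ->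
  is_lim_seq l l0 -> is_lim_seq a a0 -> is_lim_seq b b0 ->
  exists U P, solution l0 U P /\ asymptotic U P a0 b0 /\
    forall t, is_lim_seq (fun n => u n t) (U t).
Proof.
  intros HS HA Hl Ha Hb.
  destruct (is_lim_seq_bounded l l0 Hl) as [L HL].
  destruct (is_lim_seq_bounded a a0 Ha) as [MA HMA].
  destruct (is_lim_seq_bounded b b0 Hb) as [MB HMB].
  assert (HL0 : 0 <= L) by (pose proof (Rabs_pos (l O)); specialize (HL O); lra).
  set (e := fun T => exp ((L + 1) * exp (- T))).
  assert (He : forall T, 1 <= e T).
  { intros T. unfold e. rewrite <- exp_0 at 1. apply exp_nondecreasing.
    apply Rmult_le_pos; [lra|]. apply Rlt_le, exp_pos. }
  set (B := fun T => e T * (MA + MB)).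
  assert (HB : forall T n t, T <= t -> Rabs (u n t) <= B T /\ Rabs (p n t) <= B T).
  { intros T n t Ht.
    destruct (solution_bounded (l n) _ _ _ _ L T (HS n) (HA n) (HL n) t Ht) as [H1 H2].
    assert (e T * (Rabs (a n) + Rabs (b n)) <= B T).
    { unfold B. apply Rmult_le_compat_l; [specialize (He T); lra|].
      specialize (HMA n). specialize (HMB n). lra. }
    fold (e T) in H1, H2. lra. }
  assert (HB0 : forall T, 0 <= B T).
  { intros T. destruct (HB T O T (Rle_refl _)) as [H _]. pose proof (Rabs_pos (u O T)). lra. }
  set (d := fun T n => Rabs (a n - a0) + Rabs (b n - b0) + B T * Rabs (l n - l0)).
  assert (Hd : forall T, is_lim_seq (d T) 0).
  { intros T. replace (Finite 0) with (Finite (0 + 0 + B T * 0)) by (f_equal; ring).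
    apply is_lim_seq_plus'.
    - apply is_lim_seq_plus'; now apply is_lim_seq_abs_sub.
    - apply is_lim_seq_mult'; [apply is_lim_seq_const|now apply is_lim_seq_abs_sub]. }
  assert (Hrate : forall T t n m, T <= t ->
            Rabs (u n t - u m t) <= e T * (d T n + d T m) /\
            Rabs (p n t - p m t) <= e T * (d T n + d T m)).
  { intros T t n m Ht.
    assert (H := solution_compare (l n) (l m) _ _ _ _ _ _ _ _ L (B T) T t (HS n) (HS m)
               (HA n) (HA m) (HL n) (fun s Hs => proj1 (HB T m s Hs)) Ht).
    fold (e T) in H.
    assert (Hx : forall x y z : R, Rabs (x - y) <= Rabs (x - z) + Rabs (y - z)).
    { intros x y z. replace (x - y) with ((x - z) + - (y - z)) by ring.
      apply Rle_trans with (1 := Rabs_triang _ _). rewrite Rabs_Ropp. lra. }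
    assert (H1 := Hx (a n) (a m) a0). assert (H2 := Hx (b n) (b m) b0).
    assert (H3 := Hx (l n) (l m) l0).
    pose proof (Rabs_pos (a n - a m)). pose proof (Rabs_pos (b n - b m)).
    pose proof (Rabs_pos (l n - l m)).
    specialize (HB0 T). specialize (He T).
    set (D := d T n + d T m).
    assert (HD : Rabs (a n - a m) + Rabs (b n - b m) + B T * Rabs (l n - l m) <= D).
    { unfold D, d. nra. }
    assert (0 <= B T * Rabs (l n - l m)) by now apply Rmult_le_pos.
    apply abs_le_of_sum_sq; [nra|].
    apply Rle_trans with (1 := H).
    rewrite <- (pow2_abs (a n - a m)), <- (pow2_abs (b n - b m)), <- (pow2_abs (l n - l m)).
    rewrite Rpow_mult_distr.
    apply Rle_trans with (e T * D ^ 2).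
    - apply Rmult_le_compat_l; [lra|].
      replace (Rabs (l n - l m) ^ 2 * B T ^ 2) with ((B T * Rabs (l n - l m)) ^ 2) by ring.
      set (x := Rabs (a n - a m)) in *. set (y := Rabs (b n - b m)) in *.
      set (z := B T * Rabs (l n - l m)) in *.
      apply Rle_trans with ((x + y + z) ^ 2); [nra|]. apply pow_incr. lra.
    - apply Rmult_le_compat_r; [apply pow2_ge_0|]. nra. }
  assert (Hlim : forall x : nat -> R -> R,
    (forall T t n m, T <= t -> Rabs (x n t - x m t) <= e T * (d T n + d T m)) ->
    forall t, is_lim_seq (fun n => x n t) (real (Lim_seq (fun n => x n t))) /\
      forall T n, T <= t -> Rabs (x n t - real (Lim_seq (fun n => x n t))) <= e T * d T n).
  { intros x Hx t.
    assert (HT : forall T, T <= t -> exists X : R, is_lim_seq (fun n => x n t) X /\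
              forall n, Rabs (x n t - X) <= e T * d T n).
    { intros T HTt. apply converges_of_rate.
      - specialize (He T). lra.
      - apply Hd.
      - intros n m. now apply Hx. }
    split.
    - destruct (HT t (Rle_refl t)) as [X [HX _]]. now rewrite (is_lim_seq_unique _ _ HX).
    - intros T n HTt. destruct (HT T HTt) as [X [HX HX']]. rewrite (is_lim_seq_unique _ _ HX).
      apply HX'. }
  set (U := fun t => real (Lim_seq (fun n => u n t))).
  set (P := fun t => real (Lim_seq (fun n => p n t))).
  assert (HU' := Hlim u (fun T t n m Ht => proj1 (Hrate T t n m Ht))).
  assert (HP' := Hlim p (fun T t n m Ht => proj2 (Hrate T t n m Ht))).
  exists U, P. split; [|split].
  - apply (solution_of_limit l u p l0 U P HS Hl (fun t => proj1 (HU' t)) (fun t => proj1 (HP' t))).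
    intros T. exists (B T). intros n t. apply HB.
  - apply (asymptotic_of_uniform_limit u p a b (fun n => e 0 * d 0 n) U P a0 b0 HA Ha Hb).
    + replace (Finite 0) with (Finite (e 0 * 0)) by (f_equal; ring).
      apply is_lim_seq_mult'; [apply is_lim_seq_const|apply Hd].
    + intros n t Ht. split; [now apply HU'|now apply HP'].
  - intros t. apply HU'.
Qed.

(** * The Bessel functions of the first and second kind *)

Definition amplitude : R := 2 * besselI_const.

Lemma amplitude_pos : 0 < amplitude.
Proof. unfold amplitude. pose proof besselI_const_pos. lra. Qed.

(** Expected asymptotics: [theta x = x - phase_shift nu + o(1)]. *)
Definition phase_shift (nu : R) : R := (nu + / 2) * (PI / 2).

Lemma bessel_J_eq (nu t : R) : bessel_J nu (exp t) = exp (- (t / 2)) * uJ nu t.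
Proof.
  unfold bessel_J, uJ, zJ, V, PSeries. rewrite <- !Series_scal_l.
  apply Series_ext. intros k. unfold Vterm, besselJ_coef, besselI_coef.
  replace (freq (nu + / 2) k * 0 + 0) with 0 by ring. rewrite cos_0.
  replace (exp (freq (nu + / 2) k * t)) with (exp (t / 2) * (exp (nu * t) * exp (2 * INR k * t))).
  2:{ rewrite <- !exp_plus. f_equal. unfold freq. field. }
  assert (E1 : (exp t ^ 2 / 4) ^ k = exp (2 * INR k * t) / 4 ^ k).
  { unfold Rdiv. rewrite Rpow_mult_distr, pow_inv. f_equal.
    induction k as [|k IH].
    - simpl. rewrite Rmult_0_r, Rmult_0_l, exp_0. reflexivity.
    - rewrite S_INR. replace (2 * (INR k + 1) * t) with (t + t + 2 * INR k * t) by ring.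
      rewrite !exp_plus, <- IH. simpl. ring. }
  assert (E2 : Rpower (exp t / 2) nu = Rpower 2 (- nu) * exp (nu * t)).
  { unfold Rpower. rewrite (ln_div (exp t) 2), ln_exp by (try apply exp_pos; lra).
    rewrite <- exp_plus. f_equal. ring. }
  assert (E3 : exp (- (t / 2)) * exp (t / 2) = 1) by (rewrite Rmult_comm; apply exp_mul_opp).
  rewrite E1, E2.
  pose proof (INR_fact_lt_0 k). pose proof (pow4_pos k).
  transitivity (exp (- (t / 2)) * exp (t / 2) * (Rpower 2 (- nu) * exp (nu * t) *
    ((-1) ^ k / INR (fact k) * rgamma (nu + INR k + 1) * (exp (2 * INR k * t) / 4 ^ k)))).
  { rewrite E3. ring. }
  field. lra.
Qed.

Lemma J_solution (nu : R) : solution (lam nu) (uJ nu) (pJ nu).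
Proof.
  intros t.
  assert (He : exp t * exp (- t) = 1) by apply exp_mul_opp.
  assert (H1 := reU1_dt nu t 0). cbv beta in H1.
  split.
  - unfold pJ. rewrite <- Rmult_assoc, He, Rmult_1_l. exact (reU_dt nu t 0).
  - unfold pJ, uJ. auto_derive; [eexists; exact H1|].
    match goal with |- context [Derive ?f t] =>
      replace (Derive f t) with (zJ2 nu t 0 0) by (symmetry; now apply is_derive_unique) end.
    rewrite zJ_ode. replace (0 + 2 * 0) with 0 by ring.
    rewrite (exp_double t).
    ring [He].
Qed.

Lemma J_asymptotic_phase (nu : R) :
  asymptotic (uJ nu) (pJ nu) (amplitude * cos (phase_shift nu)) (amplitude * sin (phase_shift nu)).
Proof. exact (J_asymptotic nu). Qed.

Definition uY (nu t : R) : R := (cos (nu * PI) * uJ nu t - uJ (- nu) t) / sin (nu * PI).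
Definition pY (nu t : R) : R := (cos (nu * PI) * pJ nu t - pJ (- nu) t) / sin (nu * PI).

Lemma Y_quotient_eq (nu t : R) :
  bessel_Y_quotient (exp t) nu = exp (- (t / 2)) * uY nu t.
Proof.
  unfold bessel_Y_quotient, uY. rewrite !bessel_J_eq. unfold Rdiv. ring.
Qed.

(** [J_nu] and [J_(-nu)] have the same amplitude and phases differing by
    [nu pi]; the quotient is designed to turn this into a quarter-turn. *)
Lemma Y_quotient_solution (nu : R) :
  sin (nu * PI) <> 0 ->
  solution (lam nu) (uY nu) (pY nu) /\
  asymptotic (uY nu) (pY nu)
    (- (amplitude * sin (phase_shift nu))) (amplitude * cos (phase_shift nu)).
Proof.
  intros Hs.
  assert (H1 := J_solution nu). assert (H2 := J_solution (- nu)).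
  replace (lam (- nu)) with (lam nu) in H2 by (unfold lam; ring).
  set (x := cos (nu * PI) / sin (nu * PI)). set (y := - / sin (nu * PI)).
  assert (Eu : forall t, x * uJ nu t + y * uJ (- nu) t = uY nu t).
  { intros t. unfold uY, x, y. field. exact Hs. }
  assert (Ep : forall t, x * pJ nu t + y * pJ (- nu) t = pY nu t).
  { intros t. unfold pY, x, y. field. exact Hs. }
  split.
  - assert (H := solution_linear _ _ _ _ _ x y H1 H2). intros t.
    destruct (H t) as [Ha Hb]. cbv beta in Ha, Hb. rewrite Ep in Ha. rewrite Eu in Hb. split.
    + eapply is_derive_ext; [|exact Ha]. exact Eu.
    + eapply is_derive_ext; [|exact Hb]. exact Ep.
  - assert (H := asymptotic_linear _ _ _ _ _ _ _ _ x y
                   (J_asymptotic_phase nu) (J_asymptotic_phase (- nu))).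
    assert (Esh : phase_shift (- nu) = phase_shift nu - nu * PI) by (unfold phase_shift; field).
    rewrite Esh, cos_minus, sin_minus in H.
    pose proof (sin_sq (nu * PI)) as Hcc.
    match type of H with asymptotic _ _ ?al ?be =>
      replace al with (- (amplitude * sin (phase_shift nu))) in H;
      [replace be with (amplitude * cos (phase_shift nu)) in H|] end.
    + destruct H as [Ha Hb]. split.
      * eapply is_lim_ext; [|exact Ha]. intros t. cbv beta. now rewrite Eu, Ep.
      * eapply is_lim_ext; [|exact Hb]. intros t. cbv beta. now rewrite Eu, Ep.
    + unfold x, y. field_simplify_eq; [ring [Hcc]|exact Hs].
    + unfold x, y. field_simplify_eq; [ring [Hcc]|exact Hs].
Qed.

Lemma sin_near_integer (nu h : R) :
  sin (nu * PI) = 0 -> 0 < h < 1 -> sin ((nu + h) * PI) <> 0.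
Proof.
  intros Hs Hh. rewrite Rmult_plus_distr_r, sin_plus, Hs, Rmult_0_l, Rplus_0_l.
  pose proof (sin2_cos2 (nu * PI)) as Hsc. rewrite Hs in Hsc. unfold Rsqr in Hsc.
  pose proof PI_RGT_0.
  assert (0 < sin (h * PI)) by (apply sin_gt_0; nra).
  intros Hz. apply Rmult_integral in Hz. destruct Hz as [Hz|Hz]; [rewrite Hz in Hsc|]; lra.
Qed.

(** For integer order the defining limit is controlled from infinity: the
    quotients have explicitly known, continuous data there. *)
Lemma Y_solution (nu : R) :
  exists u p, solution (lam nu) u p /\
    asymptotic u p (- (amplitude * sin (phase_shift nu))) (amplitude * cos (phase_shift nu)) /\
    forall t, bessel_Y nu (exp t) = exp (- (t / 2)) * u t.
Proof.
  unfold bessel_Y. destruct (Req_EM_T (sin (nu * PI)) 0) as [Hs|Hs].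
  - set (mu := fun n : nat => nu + / (INR (S n) + 1)).
    assert (Hh : forall n, 0 < / (INR (S n) + 1) < 1).
    { intros n. assert (0 < INR (S n)) by (apply lt_0_INR; lia).
      split; [apply Rinv_0_lt_compat; lra|]. rewrite <- Rinv_1 at 2. apply Rinv_lt_contravar; lra. }
    assert (Hmu : is_lim_seq mu nu).
    { unfold mu. replace (Finite nu) with (Finite (nu + 0)) by (f_equal; ring).
      apply is_lim_seq_plus'; [apply is_lim_seq_const|].
      apply is_lim_seq_ext with (fun n => / INR (S (S n))).
      - intros n. now rewrite (S_INR (S n)).
      - apply (is_lim_seq_incr_1 (fun n => / INR (S n))).
        apply (is_lim_seq_incr_1 (fun n => / INR n)), is_lim_seq_inv_INR. }
    assert (Hsin : forall n, sin (mu n * PI) <> 0) by (intros n; apply sin_near_integer; auto).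
    destruct (limit_of_solutions (fun n => lam (mu n)) (fun n => uY (mu n)) (fun n => pY (mu n))
      (fun n => - (amplitude * sin (phase_shift (mu n))))
      (fun n => amplitude * cos (phase_shift (mu n)))
      (lam nu) (- (amplitude * sin (phase_shift nu))) (amplitude * cos (phase_shift nu)))
      as [U [P [HS [HA HU]]]].
    + intros n. now apply Y_quotient_solution.
    + intros n. now apply Y_quotient_solution.
    + apply (is_lim_seq_continuous lam mu nu); [|exact Hmu].
      apply derivable_continuous_pt. unfold lam. reg.
    + apply (is_lim_seq_continuous (fun x => - (amplitude * sin (phase_shift x))) mu nu); [|exact Hmu].
      unfold phase_shift. reg.
    + apply (is_lim_seq_continuous (fun x => amplitude * cos (phase_shift x)) mu nu); [|exact Hmu].
      unfold phase_shift. reg.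
    + exists U, P. split; [exact HS|]. split; [exact HA|]. intros t.
      unfold Lim. simpl Rbar_loc_seq.
      assert (H : is_lim_seq (fun n => bessel_Y_quotient (exp t) (nu + / (INR n + 1)))
                    (exp (- (t / 2)) * U t)).
      { apply is_lim_seq_incr_1.
        apply is_lim_seq_ext with (fun n => exp (- (t / 2)) * uY (mu n) t).
        - intros n. symmetry. apply Y_quotient_eq.
        - apply is_lim_seq_mult'; [apply is_lim_seq_const|apply HU]. }
      rewrite (is_lim_seq_unique _ _ H). reflexivity.
  - destruct (Y_quotient_solution nu Hs) as [H1 H2].
    exists (uY nu), (pY nu). split; [exact H1|]. split; [exact H2|]. intros t. apply Y_quotient_eq.
Qed.

(** * Comparison of phase functions *)

(** [f] is a phase function on [(t0, oo)] of the equation [y'' + Q y = 0]: its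
    solutions are the functions [rho sin (f - al)] with a common modulus. *)
Definition phase_of (t0 : R) (Q f : R -> R) : Prop :=
  (forall t, t0 < t -> continuity_pt f t) /\
  (forall s t, t0 < s -> s < t -> f s < f t) /\
  (forall al, exists rho y y', forall t, t0 < t ->
     0 < rho t /\ y t = rho t * sin (f t - al) /\
     is_derive y t (y' t) /\ is_derive y' t (- (Q t * y t))).

Lemma derive_at_right_zero (y : R -> R) (a c l : R) :
  a < c -> is_derive y c l -> y c = 0 -> (forall s, a < s < c -> 0 < y s) -> l <= 0.
Proof.
  intros Hac Hd Hc Hpos. apply Rnot_lt_le. intros Hl.
  apply is_derive_Reals in Hd. destruct (Hd l Hl) as [d Hd'].
  set (h := - (Rmin d (c - a) / 2)).
  assert (Hm : 0 < Rmin d (c - a)).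
  { apply Rmin_glb_lt; [apply cond_pos|lra]. }
  assert (Hm1 := Rmin_l d (c - a)). assert (Hm2 := Rmin_r d (c - a)).
  assert (Hh : h < 0) by (unfold h; lra).
  assert (Hy : 0 < y (c + h)) by (apply Hpos; unfold h; lra).
  specialize (Hd' h ltac:(lra) ltac:(unfold h; rewrite Rabs_Ropp, Rabs_right; lra)).
  rewrite Hc, Rminus_0_r in Hd'. apply Rabs_def2 in Hd'.
  assert (y (c + h) / h < 0).
  { unfold Rdiv. assert (/ h < 0) by now apply Rinv_lt_0_compat. nra. }
  lra.
Qed.

Lemma ivt_increasing (f : R -> R) (a b v : R) :
  a < b -> (forall t, a <= t <= b -> continuity_pt f t) -> f a < v <= f b ->
  exists c, a < c <= b /\ f c = v.
Proof.
  intros Hab Hf Hv.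
  destruct (Req_dec (f b) v) as [E|Hne]; [exists b; split; [lra|exact E]|].
  destruct (Ranalysis5.IVT_interv (fun t => f t - v) a b) as [c [Hc Hc']].
  - intros t Ht. apply continuity_pt_minus; [now apply Hf|].
    apply continuity_pt_const. intros x y. reflexivity.
  - exact Hab.
  - lra.
  - lra.
  - exists c. split; [|lra]. split; [|lra].
    destruct (Req_dec a c) as [->|]; lra.
Qed.

(** Sturm's comparison theorem in terms of phases: while the phase of the
    equation with the larger potential advances by a half-turn, the other one
    advances by less. *)
Lemma sturm_phase (t0 : R) (Q1 Q2 f1 f2 : R -> R) (a b : R) :
  phase_of t0 Q1 f1 -> phase_of t0 Q2 f2 -> (forall t, t0 < t -> Q2 t < Q1 t) ->
  t0 < a < b -> f1 b - f1 a = PI -> f2 b - f2 a < PI.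
Proof.
  intros [C1 [I1 P1]] [C2 [I2 P2]] HQ Hab Hpi. apply Rnot_le_lt. intros Hge.
  pose proof PI_RGT_0 as HPI.
  destruct (ivt_increasing f2 a b (f2 a + PI)) as [c [Hc Hfc]]; [lra| |lra|].
  { intros t Ht. apply C2. lra. }
  destruct (P1 (f1 a)) as [rho1 [y1 [y1' H1]]].
  destruct (P2 (f2 a)) as [rho2 [y2 [y2' H2]]].
  assert (Hp1 : forall t, a < t < c -> 0 < y1 t).
  { intros t Ht. destruct (H1 t ltac:(lra)) as [Hr [-> _]].
    apply Rmult_lt_0_compat; [exact Hr|]. apply sin_gt_0.
    - specialize (I1 a t). lra.
    - specialize (I1 t b). lra. }
  assert (Hp2 : forall t, a < t < c -> 0 < y2 t).
  { intros t Ht. destruct (H2 t ltac:(lra)) as [Hr [-> _]].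
    apply Rmult_lt_0_compat; [exact Hr|]. apply sin_gt_0.
    - specialize (I2 a t). lra.
    - specialize (I2 t c). lra. }
  assert (Ha1 : y1 a = 0).
  { destruct (H1 a ltac:(lra)) as [_ [-> _]]. rewrite Rminus_diag, sin_0. ring. }
  assert (Ha2 : y2 a = 0).
  { destruct (H2 a ltac:(lra)) as [_ [-> _]]. rewrite Rminus_diag, sin_0. ring. }
  assert (Hc2 : y2 c = 0).
  { destruct (H2 c ltac:(lra)) as [_ [-> _]].
    replace (f2 c - f2 a) with PI by lra. rewrite sin_PI. ring. }
  assert (Hc1 : 0 <= y1 c).
  { destruct (H1 c ltac:(lra)) as [Hr [-> _]]. apply Rmult_le_pos; [lra|].
    apply sin_ge_0.
    - specialize (I1 a c). lra.
    - destruct (Req_dec c b) as [->|]; [lra|]. specialize (I1 c b). lra. }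
  assert (Hd2 : y2' c <= 0).
  { apply (derive_at_right_zero y2 a c); [lra| |exact Hc2|exact Hp2]. apply H2. lra. }
  assert (HK := increasing_of_derive (fun t => y1 t * y2' t - y1' t * y2 t)
                  (fun t => (Q1 t - Q2 t) * y1 t * y2 t) a c ltac:(lra)).
  cbv beta in HK. rewrite Ha1, Ha2, Hc2 in HK.
  assert (0 * y2' a - y1' a * 0 < y1 c * y2' c - y1' c * 0); [|nra].
  apply HK.
  - intros t Ht. destruct (H1 t ltac:(lra)) as [_ [_ [D1 D1']]].
    destruct (H2 t ltac:(lra)) as [_ [_ [D2 D2']]].
    auto_derive.
    + repeat split; eexists; eassumption.
    + derive_values.
      ring.
  - intros t Ht. specialize (Hp1 t Ht). specialize (Hp2 t Ht). specialize (HQ t ltac:(lra)).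
    apply Rmult_lt_0_compat; [apply Rmult_lt_0_compat|]; lra.
Qed.

(** Phases that agree at infinity are ordered oppositely to their potentials:
    by Sturm, [f2 - f1] decreases along the points where [f1] has advanced by
    half-turns, and it tends to 0. *)
Lemma phase_comparison (t0 : R) (Q1 Q2 f1 f2 : R -> R) (t : R) :
  phase_of t0 Q1 f1 -> phase_of t0 Q2 f2 -> (forall s, t0 < s -> Q2 s < Q1 s) ->
  is_lim f1 p_infty p_infty -> is_lim (fun s => f2 s - f1 s) p_infty 0 ->
  t0 < t -> f1 t < f2 t.
Proof.
  intros H1 H2 HQ Hinf Hlim Ht. pose proof PI_RGT_0 as HPI.
  assert (Hstep : forall s, t0 < s ->
            exists s', s < s' /\ f1 s' = f1 s + PI /\ f2 s' - f1 s' < f2 s - f1 s).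
  { intros s Hs. apply is_lim_spec in Hinf. destruct (Hinf (f1 s + PI)) as [T HT].
    assert (HT1 := HT (Rmax (T + 1) (s + 1)) ltac:(pose proof (Rmax_l (T + 1) (s + 1)); lra)).
    pose proof (Rmax_r (T + 1) (s + 1)).
    destruct (ivt_increasing f1 s (Rmax (T + 1) (s + 1)) (f1 s + PI)) as [s' [Hs' E]].
    - lra.
    - intros x Hx. apply H1. lra.
    - lra.
    - exists s'. split; [lra|]. split; [exact E|].
      assert (f2 s' - f2 s < PI); [|lra].
      apply (sturm_phase t0 Q1 Q2 f1 f2 s s' H1 H2 HQ); lra. }
  apply Rnot_le_lt. intros Hle.
  destruct (Hstep t Ht) as [t1 [Ht1 [E1 D1]]].
  assert (Hn : forall n : nat, exists s, t1 <= s /\ f1 s = f1 t1 + INR n * PI /\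
                 f2 s - f1 s <= f2 t1 - f1 t1).
  { induction n as [|n [s [Hs [Es Ds]]]].
    - exists t1. simpl. lra.
    - destruct (Hstep s ltac:(lra)) as [s' [Hs' [E' D']]].
      exists s'. rewrite S_INR. lra. }
  assert (Heta : 0 < - (f2 t1 - f1 t1)) by lra.
  apply is_lim_spec in Hlim. destruct (Hlim (mkposreal _ Heta)) as [T HT]. simpl in HT.
  destruct H1 as [C1 [I1 _]].
  set (T' := Rmax T t1).
  destruct (nfloor_ex (Rmax 0 ((f1 (T' + 1) - f1 t1) / PI))) as [n Hn']; [apply Rmax_l|].
  destruct (Hn (S n)) as [s [Hs [Es Ds]]].
  assert (HTs : T < s).
  { apply Rlt_le_trans with (T' + 1).
    - pose proof (Rmax_l T t1). unfold T'. lra.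
    - apply Rnot_lt_le. intros Hlt. assert (f1 s < f1 (T' + 1)) by (apply I1; lra).
      assert (Hq : (f1 (T' + 1) - f1 t1) / PI < INR n + 1).
      { apply Rle_lt_trans with (2 := proj2 Hn'). apply Rmax_r. }
      apply (Rmult_lt_compat_r PI) in Hq; [|lra].
      unfold Rdiv in Hq. rewrite Rmult_assoc, Rinv_l, Rmult_1_r in Hq by lra.
      rewrite S_INR in Es. lra. }
  specialize (HT s HTs). rewrite Rminus_0_r in HT. apply Rabs_def2 in HT. lra.
Qed.

(** An increasing function with derivative [w] is a phase of
    [y'' + (w^2 + m/2 - l^2/4) y = 0], where [l = w'/w] and [m = l']; the
    modulus is [w^(-1/2)]. *)
Lemma phase_of_derivative (t0 : R) (f w l m : R -> R) :
  (forall t, t0 < t -> 0 < w t /\ is_derive f t (w t) /\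
     is_derive w t (w t * l t) /\ is_derive l t (m t)) ->
  phase_of t0 (fun t => w t ^ 2 + m t / 2 - l t ^ 2 / 4) f.
Proof.
  intros H. split; [|split].
  - intros t Ht. destruct (H t Ht) as [_ [Hf _]]. apply derivable_continuous_pt.
    exists (w t). now apply is_derive_Reals.
  - intros s t Hs Hst. apply (increasing_of_derive f w s t Hst).
    + intros x Hx. apply H. lra.
    + intros x Hx. apply H. lra.
  - intros al.
    exists (fun t => exp (- (ln (w t) / 2))),
      (fun t => exp (- (ln (w t) / 2)) * sin (f t - al)),
      (fun t => exp (- (ln (w t) / 2)) * (w t * cos (f t - al) - l t / 2 * sin (f t - al))).
    intros t Ht. destruct (H t Ht) as [Hw [Df [Dw Dl]]].
    split; [apply exp_pos|]. split; [reflexivity|]. split.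
    + auto_derive; [repeat split; try (eexists; eassumption); exact Hw|].
      derive_values. replace (f t + - al) with (f t - al) by ring.
      change (ln (w t) * / 2) with (ln (w t) / 2). field. lra.
    + auto_derive; [repeat split; try (eexists; eassumption); exact Hw|].
      derive_values. replace (f t + - al) with (f t - al) by ring.
      change (ln (w t) * / 2) with (ln (w t) / 2). field. lra.
Qed.

Lemma phase_of_shift (t0 d : R) (Q f : R -> R) :
  phase_of t0 Q f -> phase_of t0 Q (fun t => f t + d).
Proof.
  intros [C [I P]]. split; [|split].
  - intros t Ht. apply continuity_pt_plus; [now apply C|].
    apply continuity_pt_const. intros x y. reflexivity.
  - intros s t Hs Hst. specialize (I s t Hs Hst). lra.
  - intros al. destruct (P (al - d)) as [rho [y [y' H]]]. exists rho, y, y'. intros t Ht.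
    destruct (H t Ht) as [H1 [H2 H3]]. split; [exact H1|]. split; [|exact H3].
    rewrite H2. f_equal. f_equal. ring.
Qed.

Lemma increasing_of_local (f : R -> R) :
  (forall t, continuity_pt f t) ->
  (forall t, exists d, 0 < d /\ forall s, t < s < t + d -> f t < f s) ->
  forall s t, s < t -> f s < f t.
Proof.
  intros Hc Hl s t Hst.
  destruct (continuity_ab_maj f s t ltac:(lra) ltac:(intros; apply Hc)) as [m [Hm Hmr]].
  assert (Hmt : m = t).
  { destruct (Req_dec m t) as [|Hne]; [assumption|exfalso].
    destruct (Hl m) as [d [Hd Hd']].
    set (x := m + Rmin (d / 2) (t - m)).
    assert (H1 := Rmin_l (d / 2) (t - m)). assert (H2 := Rmin_r (d / 2) (t - m)).
    assert (H3 : 0 < Rmin (d / 2) (t - m)) by (apply Rmin_glb_lt; lra).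
    specialize (Hd' x ltac:(unfold x; lra)). specialize (Hm x ltac:(unfold x; lra)). lra. }
  subst m. destruct (Hl s) as [d [Hd Hd']].
  set (x := s + Rmin (d / 2) (t - s)).
  assert (H1 := Rmin_l (d / 2) (t - s)). assert (H2 := Rmin_r (d / 2) (t - s)).
  assert (H3 : 0 < Rmin (d / 2) (t - s)) by (apply Rmin_glb_lt; lra).
  specialize (Hd' x ltac:(unfold x; lra)). specialize (Hm x ltac:(unfold x; lra)). lra.
Qed.

(** * The Bessel phase *)

Lemma wronskian_const (l : R) u p v q :
  solution l u p -> solution l v q ->
  forall s t, u s * q s - p s * v s = u t * q t - p t * v t.
Proof.
  intros H1 H2.
  assert (H : forall s t, s < t -> u s * q s - p s * v s = u t * q t - p t * v t).
  { intros s t Hst.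
    destruct (mvt (fun x => u x * q x - p x * v x) (fun _ => 0) s t Hst) as [c [_ Hc]].
    - intros x _. destruct (H1 x) as [D1 D2]. destruct (H2 x) as [D3 D4].
      auto_derive.
      + repeat split; eexists; eassumption.
      + derive_values.
        ring.
    - lra. }
  intros s t. destruct (Rtotal_order s t) as [Hst|[->|Hst]]; [now apply H|reflexivity|].
  symmetry. now apply H.
Qed.

Lemma wronskian_value (l : R) u p v q (A om : R) :
  solution l u p -> solution l v q ->
  asymptotic u p (A * cos om) (A * sin om) ->
  asymptotic v q (- (A * sin om)) (A * cos om) ->
  forall t, u t * q t - p t * v t = A ^ 2.
Proof.
  intros S1 S2 [A1 A2] [A3 A4] t.
  assert (H := is_lim_minus' _ _ _ _ _ (is_lim_mult _ _ _ _ _ A1 A4 I) (is_lim_mult _ _ _ _ _ A2 A3 I)).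
  simpl in H.
  pose proof (sin2_cos2 om) as Hom. unfold Rsqr in Hom.
  replace (A * cos om * (A * cos om) - A * sin om * - (A * sin om)) with (A ^ 2) in H.
  2:{ assert (Hs : sin om * sin om = 1 - cos om * cos om) by lra. ring [Hs]. }
  assert (H' : is_lim (fun _ => u t * q t - p t * v t) p_infty (A ^ 2)).
  { eapply is_lim_ext; [|exact H]. intros s. cbv beta.
    rewrite (wronskian_const l u p v q S1 S2 t s).
    pose proof (sin_sq (exp s)) as Hs.
    ring [Hs]. }
  apply is_lim_unique in H'. rewrite Lim_const in H'. now injection H'.
Qed.

(** The second-order equation satisfied by [y = u / sqrt x] in the variable [t]. *)
Lemma solution_second_order (nu : R) u p :
  solution (lam nu) u p -> forall t,
  is_derive (fun t => exp (- (t / 2)) * u t) t (exp (- (t / 2)) * (exp t * p t - u t / 2)) /\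
  is_derive (fun t => exp (- (t / 2)) * (exp t * p t - u t / 2)) t
    (- ((exp (2 * t) - nu ^ 2) * (exp (- (t / 2)) * u t))).
Proof.
  intros HS t. destruct (HS t) as [D1 D2].
  split.
  - auto_derive; [repeat split; eexists; eassumption|]. derive_values.
    change (t * / 2) with (t / 2). field.
  - auto_derive; [repeat split; eexists; eassumption|]. derive_values.
    change (t * / 2) with (t / 2).
    rewrite (exp_double t).
    assert (He : exp t * exp (- t) = 1) by apply exp_mul_opp.
    unfold lam. field_simplify_eq. ring [He].
Qed.

Lemma sqrt_sum_sq_pos (a b : R) : a ^ 2 + b ^ 2 <> 0 -> 0 < sqrt (a ^ 2 + b ^ 2).
Proof.
  intros H. apply sqrt_lt_R0. pose proof (pow2_ge_0 a). pose proof (pow2_ge_0 b). lra.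
Qed.

(** The modulus [N] does not vanish because the Wronskian excludes common zeros. *)
Lemma bessel_phase_polar (nu : R) (theta : R -> R) :
  is_bessel_phase nu theta ->
  exists v q N, solution (lam nu) v q /\
    asymptotic v q (- (amplitude * sin (phase_shift nu))) (amplitude * cos (phase_shift nu)) /\
    forall t, 0 < N t /\ uJ nu t = N t * cos (theta (exp t)) /\ v t = N t * sin (theta (exp t)).
Proof.
  intros [_ [Hpol _]]. destruct (Y_solution nu) as [v [q [HS [HA HY]]]].
  exists v, q, (fun t => exp (t / 2) * bessel_modulus nu (exp t)).
  split; [exact HS|]. split; [exact HA|]. intros t.
  destruct (Hpol (exp t) (exp_pos t)) as [HJ HYs].
  rewrite bessel_J_eq in HJ. rewrite HY in HYs.
  assert (He : exp (t / 2) * exp (- (t / 2)) = 1) by apply exp_mul_opp.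
  pose proof (exp_pos (t / 2)) as He1. pose proof (exp_pos (- (t / 2))) as He2.
  split; [|split].
  - apply Rmult_lt_0_compat; [exact He1|]. apply sqrt_sum_sq_pos.
    rewrite bessel_J_eq, HY. intros H0.
    assert (Hz : uJ nu t = 0 /\ v t = 0).
    { set (a := exp (- (t / 2)) * uJ nu t) in *. set (b := exp (- (t / 2)) * v t) in *.
      pose proof (pow2_ge_0 a). pose proof (pow2_ge_0 b).
      assert (Ha : a = 0) by (apply Rsqr_0_uniq; unfold Rsqr; nra).
      assert (Hb : b = 0) by (apply Rsqr_0_uniq; unfold Rsqr; nra).
      split.
      - apply (Rmult_eq_reg_l (exp (- (t / 2)))); [|lra]. fold a. lra.
      - apply (Rmult_eq_reg_l (exp (- (t / 2)))); [|lra]. fold b. lra. }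
    destruct Hz as [Hz1 Hz2].
    assert (HW := wronskian_value _ _ _ _ _ _ _ (J_solution nu) HS (J_asymptotic_phase nu) HA t).
    rewrite Hz1, Hz2 in HW. pose proof amplitude_pos. nra.
  - transitivity (exp (t / 2) * exp (- (t / 2)) * uJ nu t); [rewrite He; ring|].
    rewrite Rmult_assoc, HJ. ring.
  - transitivity (exp (t / 2) * exp (- (t / 2)) * v t); [rewrite He; ring|].
    rewrite Rmult_assoc, HYs. ring.
Qed.

Lemma bessel_phase_continuity (nu : R) (theta : R -> R) :
  is_bessel_phase nu theta -> forall t, continuity_pt (fun t => theta (exp t)) t.
Proof.
  intros [Hc _] t. apply (continuity_pt_comp exp theta).
  - apply derivable_continuous_pt, derivable_pt_exp.
  - apply continuity_pt_filterlim. apply (Hc (exp t)), exp_pos.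
Qed.

(** The phase increases because the Wronskian of [J_nu] and [Y_nu] is positive. *)
Lemma bessel_phase_increasing (nu : R) (theta : R -> R) :
  is_bessel_phase nu theta -> forall s t, s < t -> theta (exp s) < theta (exp t).
Proof.
  intros Hth.
  assert (Hc := bessel_phase_continuity nu theta Hth).
  destruct (bessel_phase_polar nu theta Hth) as [v [q [N [HS [HA HN]]]]].
  apply (increasing_of_local (fun t => theta (exp t)) Hc).
  intros t.
  set (g := fun s => v s * uJ nu t - uJ nu s * v t).
  assert (HW := wronskian_value _ _ _ _ _ _ _ (J_solution nu) HS (J_asymptotic_phase nu) HA t).
  set (W := exp t * amplitude ^ 2).
  assert (HW0 : 0 < W).
  { apply Rmult_lt_0_compat; [apply exp_pos|]. apply pow_lt, amplitude_pos. }
  assert (Hg : is_derive g t W).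
  { destruct (HS t) as [D1 _]. destruct (J_solution nu t) as [D2 _]. unfold g.
    auto_derive; [repeat split; eexists; eassumption|].
    derive_values.
    unfold W. rewrite <- HW. ring. }
  apply is_derive_Reals in Hg. destruct (Hg W HW0) as [d1 Hd1].
  destruct (Hc t PI PI_RGT_0) as [d2 [Hd2 Hd2']].
  exists (Rmin d1 d2). split; [apply Rmin_glb_lt; [apply cond_pos|exact Hd2]|].
  intros s Hs. assert (Hm1 := Rmin_l d1 d2). assert (Hm2 := Rmin_r d1 d2).
  assert (Hgs : 0 < g s).
  { specialize (Hd1 (s - t) ltac:(lra) ltac:(rewrite Rabs_right; lra)).
    replace (t + (s - t)) with s in Hd1 by ring.
    replace (g t) with 0 in Hd1 by (unfold g; ring).
    rewrite Rminus_0_r in Hd1. apply Rabs_def2 in Hd1.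
    assert (Hq : 0 < g s / (s - t)) by lra.
    replace (g s) with (g s / (s - t) * (s - t)) by (field; lra).
    apply Rmult_lt_0_compat; lra. }
  assert (Hdist : Rabs (theta (exp s) - theta (exp t)) < PI).
  { apply (Hd2' s). split.
    - split; [exact I|lra].
    - simpl. unfold Rdist. rewrite Rabs_right; lra. }
  destruct (HN s) as [Ns [Es1 Es2]]. destruct (HN t) as [Nt [Et1 Et2]].
  assert (Hsin : 0 < sin (theta (exp s) - theta (exp t))).
  { apply (Rmult_lt_reg_l (N s * N t)); [now apply Rmult_lt_0_compat|].
    rewrite Rmult_0_r, sin_minus.
    replace (N s * N t * (sin (theta (exp s)) * cos (theta (exp t)) -
                          cos (theta (exp s)) * sin (theta (exp t)))) with (g s); [exact Hgs|].
    unfold g. rewrite Es1, Es2, Et1, Et2. ring. }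
  apply Rnot_le_lt. intros Hle. apply Rabs_def2 in Hdist.
  assert (0 <= sin (theta (exp t) - theta (exp s))) by (apply sin_ge_0; lra).
  replace (theta (exp s) - theta (exp t)) with (- (theta (exp t) - theta (exp s))) in Hsin by ring.
  rewrite sin_neg in Hsin. lra.
Qed.

Lemma bessel_phase_of (nu t0 : R) (theta : R -> R) :
  is_bessel_phase nu theta ->
  phase_of t0 (fun t => exp (2 * t) - nu ^ 2) (fun t => theta (exp t)).
Proof.
  intros Hth. split; [|split].
  - intros t _. now apply (bessel_phase_continuity nu).
  - intros s t _. now apply (bessel_phase_increasing nu).
  - intros al. destruct (bessel_phase_polar nu theta Hth) as [v [q [N [HS [HA HN]]]]].
    assert (HL := solution_linear _ _ _ _ _ (cos al) (- sin al) HS (J_solution nu)).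
    assert (HD := solution_second_order nu _ _ HL).
    eexists (fun t => exp (- (t / 2)) * N t), _, _. intros t _.
    destruct (HN t) as [Nt [E1 E2]].
    split; [apply Rmult_lt_0_compat; [apply exp_pos|exact Nt]|].
    split; [|exact (HD t)]. cbv beta.
    rewrite E1, E2, sin_minus. ring.
Qed.

Lemma bessel_phase_near_zero (nu : R) (theta : R -> R) (eta T : R) :
  is_bessel_phase nu theta -> 0 < eta ->
  exists s, s < T /\ Rabs (theta (exp s) - - (PI / 2)) < eta.
Proof.
  intros [_ [_ Hlim]] Heta.
  destruct (Hlim _ (locally_ball _ (mkposreal eta Heta))) as [d Hd].
  pose proof (cond_pos d) as Hd0.
  set (s := Rmin (ln (d / 2)) (T - 1)).
  assert (Hs : exp s <= d / 2).
  { rewrite <- (exp_ln (d / 2)) by lra. apply exp_nondecreasing, Rmin_l. }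
  assert (Hs2 : s <= T - 1) by apply Rmin_r.
  pose proof (exp_pos s) as Hes.
  exists s. split; [lra|].
  apply (Hd (exp s)); [|exact Hes].
  change (Rabs (exp s - 0) < d). rewrite Rminus_0_r, Rabs_right; lra.
Qed.

Lemma bessel_phase_gt (nu : R) (theta : R -> R) :
  is_bessel_phase nu theta -> forall t, - (PI / 2) < theta (exp t).
Proof.
  intros Hth t. assert (HI := bessel_phase_increasing nu theta Hth).
  apply Rnot_le_lt. intros Hle.
  assert (H1 := HI (t - 1) t ltac:(lra)).
  destruct (bessel_phase_near_zero nu theta (- (PI / 2) - theta (exp (t - 1))) (t - 1) Hth)
    as [s [Hs Hb]]; [lra|].
  apply Rabs_def2 in Hb. assert (H2 := HI s (t - 1) Hs). lra.
Qed.

Lemma cos_period_Z (x : R) (k : Z) : cos (x - 2 * PI * IZR k) = cos x /\ sin (x - 2 * PI * IZR k) = sin x.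
Proof.
  destruct (Z.lt_ge_cases k 0) as [Hk|Hk].
  - assert (E : IZR k = - INR (Z.to_nat (- k))).
    { rewrite INR_IZR_INZ, Z2Nat.id by lia. rewrite opp_IZR. ring. }
    rewrite E. replace (x - 2 * PI * - INR (Z.to_nat (- k)))
      with (x + 2 * INR (Z.to_nat (- k)) * PI) by ring.
    split; [apply cos_period|apply sin_period].
  - assert (E : IZR k = INR (Z.to_nat k)).
    { rewrite INR_IZR_INZ, Z2Nat.id by lia. reflexivity. }
    rewrite E. set (y := x - 2 * PI * INR (Z.to_nat k)).
    replace x with (y + 2 * INR (Z.to_nat k) * PI) by (unfold y; ring).
    split; symmetry; [apply cos_period|apply sin_period].
Qed.

Lemma near_multiple_2pi (x : R) : exists k : Z, Rabs (x - 2 * PI * IZR k) <= PI.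
Proof.
  pose proof PI_RGT_0 as HPI.
  destruct (archimed (x / (2 * PI) - / 2)) as [H1 H2].
  set (k := up (x / (2 * PI) - / 2)) in *. exists k.
  assert (E : x = 2 * PI * (x / (2 * PI))) by (field; lra).
  set (y := x / (2 * PI)) in *. rewrite E. apply Rabs_le. split; nra.
Qed.

(** If the polar coordinates of a curve settle on the positive axis, its
    continuous argument tends to a multiple of a full turn. *)
Lemma argument_limit (g N : R -> R) (A : R) :
  0 < A -> (forall t, continuity_pt g t) -> (forall t, 0 < N t) ->
  is_lim (fun t => N t * cos (g t)) p_infty A ->
  is_lim (fun t => N t * sin (g t)) p_infty 0 ->
  exists k : Z, is_lim g p_infty (2 * PI * IZR k).
Proof.
  intros HA Hg HN Hc Hs. pose proof PI_RGT_0 as HPI.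
  assert (Hc' := Hc). apply is_lim_spec in Hc'.
  destruct (Hc' (mkposreal A HA)) as [T HT]. simpl in HT.
  assert (Hpos : forall t, T < t -> 0 < cos (g t)).
  { intros t Ht. specialize (HT t Ht). specialize (HN t). apply Rabs_def2 in HT.
    apply Rnot_le_lt. intros Hle. nra. }
  destruct (near_multiple_2pi (g (T + 1))) as [k Hk]. exists k.
  set (h := fun t => g t - 2 * PI * IZR k).
  assert (Hch : forall t, T < t -> 0 < cos (h t)).
  { intros t Ht. unfold h. rewrite (proj1 (cos_period_Z (g t) k)). now apply Hpos. }
  assert (Hcont : forall t, continuity_pt h t).
  { intros t. unfold h. apply continuity_pt_minus; [apply Hg|].
    apply continuity_pt_const. intros x y. reflexivity. }
  assert (Hnz : forall x, - PI <= x <= PI -> 0 < cos x -> - (PI / 2) < x < PI / 2).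
  { intros x Hx Hcx. split; apply Rnot_le_lt; intros Hle.
    - assert (cos x <= 0); [|lra]. rewrite <- cos_neg. apply cos_le_0; lra.
    - assert (cos x <= 0); [|lra]. apply cos_le_0; lra. }
  assert (H1 : - (PI / 2) < h (T + 1) < PI / 2).
  { apply Hnz; [|apply Hch; lra]. apply Rabs_le_between in Hk. exact Hk. }
  assert (Hstay : forall t, T + 1 < t -> - (PI / 2) < h t < PI / 2).
  { intros t Ht. split; apply Rnot_le_lt; intros Hle.
    - destruct (ivt_increasing (fun x => - h x) (T + 1) t (PI / 2)) as [c [Hcc Ec]].
      + exact Ht.
      + intros x _. apply (continuity_pt_opp h), Hcont.
      + lra.
      + assert (Hx := Hch c ltac:(lra)). rewrite <- cos_neg, Ec, cos_PI2 in Hx. lra.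
    - destruct (ivt_increasing h (T + 1) t (PI / 2)) as [c [Hcc Ec]].
      + exact Ht.
      + intros x _. apply Hcont.
      + lra.
      + assert (Hx := Hch c ltac:(lra)). rewrite Ec, cos_PI2 in Hx. lra. }
  assert (Hq := is_lim_div _ _ _ _ _ Hs Hc ltac:(intros E; injection E; lra) I).
  simpl in Hq. rewrite Rmult_0_l in Hq.
  assert (Hat : is_lim (fun t => atan (N t * sin (g t) / (N t * cos (g t)))) p_infty (atan 0)).
  { apply (is_lim_comp_continuous (fun t => N t * sin (g t) / (N t * cos (g t))) atan p_infty 0).
    - exact Hq.
    - apply continuity_pt_filterlim, derivable_continuous_pt, derivable_pt_atan. }
  rewrite atan_0 in Hat.
  assert (Hfin := is_lim_plus' _ _ _ _ _ Hat (is_lim_const (2 * PI * IZR k) p_infty)).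
  rewrite Rplus_0_l in Hfin.
  eapply is_lim_ext_loc; [|exact Hfin].
  exists (T + 1). intros t Ht.
  specialize (Hstay t Ht). assert (Hct := Hch t ltac:(lra)). specialize (HN t).
  replace (N t * sin (g t) / (N t * cos (g t))) with (tan (h t)).
  - rewrite atan_tan by exact Hstay. unfold h. ring.
  - unfold tan, h in *. destruct (cos_period_Z (g t) k) as [E1 E2]. rewrite E1, E2 in *.
    field. split; lra.
Qed.

Lemma is_lim_mult_bounded (c f : R -> R) :
  (forall t, Rabs (c t) <= 1) -> is_lim f p_infty 0 -> is_lim (fun t => c t * f t) p_infty 0.
Proof.
  intros Hc Hf. apply is_lim_spec. intros eps. apply is_lim_spec in Hf.
  destruct (Hf eps) as [T HT]. exists T. intros t Ht. specialize (HT t Ht).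
  rewrite Rminus_0_r in *. rewrite Rabs_mult. specialize (Hc t).
  pose proof (Rabs_pos (f t)). pose proof (Rabs_pos (c t)). nra.
Qed.

Lemma asymptotic_value (u p : R -> R) (a b : R) :
  asymptotic u p a b ->
  is_lim (fun t => u t - (a * cos (exp t) + b * sin (exp t))) p_infty 0.
Proof.
  intros [H1 H2].
  assert (Hz : forall (f : R -> R) (x : R), is_lim f p_infty x -> is_lim (fun t => f t - x) p_infty 0).
  { intros f x Hf. assert (H := is_lim_minus' _ _ _ _ _ Hf (is_lim_const x p_infty)).
    now rewrite Rminus_diag in H. }
  assert (H := is_lim_plus' _ _ _ _ _
    (is_lim_mult_bounded (fun t => cos (exp t)) _ (fun t => cos_abs_le _) (Hz _ _ H1))
    (is_lim_mult_bounded (fun t => sin (exp t)) _ (fun t => sin_abs_le _) (Hz _ _ H2))).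
  rewrite Rplus_0_r in H. eapply is_lim_ext; [|exact H]. intros t. cbv beta.
  pose proof (sin_sq (exp t)) as Hs. ring [Hs].
Qed.

Lemma bessel_phase_limit (nu : R) (theta : R -> R) :
  is_bessel_phase nu theta ->
  exists k : Z, is_lim (fun t => theta (exp t) - (exp t - phase_shift nu)) p_infty (2 * PI * IZR k).
Proof.
  intros Hth. destruct (bessel_phase_polar nu theta Hth) as [v [q [N [HS [HA HN]]]]].
  assert (Hu := asymptotic_value _ _ _ _ (J_asymptotic_phase nu)).
  assert (Hv := asymptotic_value _ _ _ _ HA).
  set (A := amplitude) in *. set (om := phase_shift nu) in *.
  set (c := fun t => cos (exp t - om)). set (s := fun t => sin (exp t - om)).
  assert (Hc : forall t, Rabs (c t) <= 1) by (intros t; apply cos_abs_le).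
  assert (Hs : forall t, Rabs (s t) <= 1) by (intros t; apply sin_abs_le).
  (* [N cos g] and [N sin g] are the components of [(u, v)] along the rotating
     frame [(c, s)], in which [(u, v)] tends to [(A, 0)]. *)
  apply (argument_limit (fun t => theta (exp t) - (exp t - om)) N A amplitude_pos).
  - intros t. apply continuity_pt_minus; [now apply (bessel_phase_continuity nu)|].
    apply derivable_continuous_pt. reg.
  - intros t. apply HN.
  - assert (H := is_lim_plus' _ _ _ _ _
      (is_lim_plus' _ _ _ _ _ (is_lim_mult_bounded c _ Hc Hu) (is_lim_mult_bounded s _ Hs Hv))
      (is_lim_const A p_infty)).
    replace (0 + 0 + A) with A in H by ring.
    eapply is_lim_ext; [|exact H]. intros t. cbv beta.
    destruct (HN t) as [_ [E1 E2]]. rewrite E1, E2, (cos_minus (theta (exp t))).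
    unfold c, s. rewrite (cos_minus (exp t)), (sin_minus (exp t)).
    pose proof (sin_sq (exp t)) as Hs1. pose proof (sin_sq om) as Hs2. ring [Hs1 Hs2].
  - assert (H := is_lim_minus' _ _ _ _ _
        (is_lim_mult_bounded c _ Hc Hv) (is_lim_mult_bounded s _ Hs Hu)).
    rewrite Rminus_diag in H.
    eapply is_lim_ext; [|exact H]. intros t. cbv beta.
    destruct (HN t) as [_ [E1 E2]]. rewrite E1, E2, (sin_minus (theta (exp t))).
    unfold c, s. rewrite (cos_minus (exp t)), (sin_minus (exp t)).
    pose proof (sin_sq (exp t)) as Hs1. pose proof (sin_sq om) as Hs2. ring [Hs1 Hs2].
Qed.

(** * The two approximate phases *)

Lemma is_derive_acos (y : R) : -1 < y < 1 -> is_derive acos y (- / sqrt (1 - y ^ 2)).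
Proof.
  intros Hy. apply is_derive_Reals.
  assert (H := derive_pt_acos y Hy).
  apply derive_pt_eq_1 in H.
  replace (- / sqrt (1 - y ^ 2)) with (-1 / sqrt (1 - y²)); [exact H|].
  unfold Rsqr. replace (y ^ 2) with (y * y) by ring. unfold Rdiv. ring.
Qed.

Lemma turning_point_range (nu t : R) :
  0 <= nu -> nu < exp t ->
  0 < exp (2 * t) - nu ^ 2 /\ (exp t) ^ 2 = exp (2 * t) /\ 0 <= nu / exp t < 1.
Proof.
  intros Hnu Ht. pose proof (exp_pos t) as He.
  assert (E : exp (2 * t) = exp t * exp t) by apply exp_double.
  split; [|split].
  - rewrite E. nra.
  - rewrite E. ring.
  - split; [apply Rdiv_le_0_compat; lra|]. apply (Rmult_lt_reg_r (exp t)); [exact He|].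
    unfold Rdiv. rewrite Rmult_assoc, Rinv_l by lra. lra.
Qed.

Lemma is_derive_theta_tilde (nu t : R) :
  0 <= nu -> nu < exp t ->
  is_derive (fun t => theta_tilde nu (exp t)) t (sqrt (exp (2 * t) - nu ^ 2)).
Proof.
  intros Hnu Ht. destruct (turning_point_range nu t Hnu Ht) as [HU [E Hq]].
  pose proof (exp_pos t) as He.
  set (s := sqrt (exp (2 * t) - nu ^ 2)).
  assert (Hs : 0 < s) by now apply sqrt_lt_R0.
  assert (Hss : exp t * exp t = s * s + nu ^ 2).
  { unfold s. rewrite sqrt_sqrt by lra. rewrite <- E. ring. }
  assert (Ha : is_derive (fun t => acos (nu / exp t)) t (nu / s)).
  { assert (Hi : is_derive (fun t => nu / exp t) t (- (nu / exp t))).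
    { auto_derive; [lra|]. field. lra. }
    assert (H := is_derive_comp acos (fun t => nu / exp t) t _ _
                   (is_derive_acos (nu / exp t) ltac:(lra)) Hi).
    replace (nu / s) with (scal (- (nu / exp t)) (- / sqrt (1 - (nu / exp t) ^ 2))); [exact H|].
    change (- (nu / exp t) * - / sqrt (1 - (nu / exp t) ^ 2) = nu / s).
    replace (1 - (nu / exp t) ^ 2) with ((s / exp t) * (s / exp t)).
    2:{ field_simplify_eq; [|lra]. ring [Hss]. }
    rewrite sqrt_square by (apply Rdiv_le_0_compat; lra).
    field. lra. }
  apply (is_derive_ext (fun t => (sqrt (exp t ^ 2 - nu ^ 2) - PI / 4) - nu * acos (nu / exp t))).
  { intros x. unfold theta_tilde. match goal with |- ?a = ?b => change (@eq R a b) end. ring. }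
  assert (Es : (exp t * exp t) / s - nu * (nu / s) = s) by (rewrite Hss; field; lra).
  rewrite <- Es.
  apply (is_derive_minus (fun t => sqrt (exp t ^ 2 - nu ^ 2) - PI / 4) (fun t => nu * acos (nu / exp t))).
  - auto_derive.
    + replace (exp t * (exp t * 1) + - (nu * (nu * 1))) with (exp (2 * t) - nu ^ 2)
        by (rewrite <- E; ring). exact HU.
    + replace (exp t * (exp t * 1) + - (nu * (nu * 1))) with (exp (2 * t) - nu ^ 2)
        by (rewrite <- E; ring). fold s. field. lra.
  - exact (is_derive_scal _ _ nu _ Ha).
Qed.

(** With [U = x^2 - nu^2] and [w = sqrt U] one has [l = w'/w = 1 + nu^2 / U], a
    nonincreasing function of [t]; so [m/2 - l^2/4] is negative and lowers the
    potential below [w^2 = U]. *)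
Lemma tilde_phase_of (nu t0 : R) :
  0 <= nu -> nu <= exp t0 ->
  exists Q, phase_of t0 Q (fun t => theta_tilde nu (exp t)) /\
    forall t, t0 < t -> Q t < exp (2 * t) - nu ^ 2.
Proof.
  intros Hnu Ht0.
  set (U := fun t => exp (2 * t) - nu ^ 2).
  eexists. split.
  - apply (phase_of_derivative t0 _ (fun t => sqrt (U t)) (fun t => (U t + nu ^ 2) / U t)
             (fun t => - (2 * nu ^ 2 * (U t + nu ^ 2) / U t ^ 2))).
    intros t Ht. assert (Hlt : nu < exp t) by (apply exp_increasing in Ht; lra).
    destruct (turning_point_range nu t Hnu Hlt) as [HU [E Hq]].
    fold (U t) in HU.
    assert (Hs : 0 < sqrt (U t)) by now apply sqrt_lt_R0.
    assert (Hss : sqrt (U t) * sqrt (U t) = U t) by (apply sqrt_sqrt; lra).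
    split; [exact Hs|]. split; [now apply is_derive_theta_tilde|]. split.
    + unfold U. auto_derive; [exact HU|].
      change (exp (2 * t) + - (nu * (nu * 1))) with (U t).
      change (exp (2 * t) - nu ^ 2) with (U t).
      replace (exp (2 * t)) with (U t + nu ^ 2) by (unfold U; ring).
      field_simplify_eq; [|split; lra]. ring [Hss].
    + unfold U. auto_derive; [unfold U in HU; simpl in HU; lra|].
      change (exp (2 * t) + - (nu * (nu * 1))) with (U t).
      change (exp (2 * t) - nu ^ 2) with (U t).
      replace (exp (2 * t)) with (U t + nu ^ 2) by (unfold U; ring).
      field. lra.
  - intros t Ht. cbv beta. assert (Hlt : nu < exp t) by (apply exp_increasing in Ht; lra).
    destruct (turning_point_range nu t Hnu Hlt) as [HU _].
    fold (U t) in HU |- *.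
    replace (sqrt (U t) ^ 2) with (U t) by (rewrite pow2_sqrt by lra; reflexivity).
    assert (Hn : 0 <= nu ^ 2) by apply pow2_ge_0.
    assert (0 <= 2 * nu ^ 2 * (U t + nu ^ 2) / U t ^ 2).
    { apply Rdiv_le_0_compat; [nra|now apply pow_lt]. }
    assert (0 < (U t + nu ^ 2) / U t) by (apply Rdiv_lt_0_compat; lra).
    nra.
Qed.

Definition tilde_correction (nu t : R) : R :=
  (3 * exp (2 * t) + 2 * nu ^ 2) / (24 * ((exp (2 * t) - nu ^ 2) * sqrt (exp (2 * t) - nu ^ 2))).

Lemma theta_under_eq (nu t : R) :
  0 <= nu -> nu < exp t ->
  theta_under nu (exp t) = theta_tilde nu (exp t) - tilde_correction nu t.
Proof.
  intros Hnu Ht. destruct (turning_point_range nu t Hnu Ht) as [HU [E _]].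
  unfold theta_under, tilde_correction. rewrite E.
  replace (3 / 2) with (1 + / 2) by field.
  rewrite Rpower_plus, Rpower_1, Rpower_sqrt by exact HU. reflexivity.
Qed.

(** Up to the positive factor [64 U^5 g^2], this is the excess of the potential of
    the corrected phase over the Bessel potential [U], where [n = nu^2].  After
    expansion all its coefficients are positive. *)
Lemma under_polynomial_pos (U n : R) :
  0 < U -> 0 <= n ->
  let g := 8 * U ^ 3 + (U + n) * (U + 5 * n) in
  let g1 := 24 * U ^ 2 + 2 * U + 6 * n in
  let g2 := 48 * U + 2 in
  0 < g ^ 4 - 64 * U ^ 6 * g ^ 2
    + 64 * U ^ 3 * ((U + n) * (2 * g1 * g * U ^ 2 + 2 * (U + n) * (g2 * g - g1 ^ 2) * U ^ 2
                               + 5 * n * g ^ 2))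
    - 16 * U ^ 3 * (U + n) ^ 2 * (2 * g1 * U - 5 * g) ^ 2.
Proof.
  intros HU Hn g g1 g2. unfold g, g1, g2. ring_simplify.
  assert (Hm : forall c i j, 0 <= c -> 0 <= c * U ^ i * n ^ j).
  { intros c i j Hc. apply Rmult_le_pos; [apply Rmult_le_pos; [exact Hc|]|]; apply pow_le; lra. }
  assert (Hm1 : forall c i, 0 <= c -> 0 <= c * U ^ i * n).
  { intros c i Hc. apply Rmult_le_pos; [apply Rmult_le_pos; [exact Hc|]|]; [apply pow_le|]; lra. }
  assert (Hm2 : forall c j, 0 <= c -> 0 <= c * U * n ^ j).
  { intros c j Hc. apply Rmult_le_pos; [apply Rmult_le_pos; [exact Hc|]|]; [|apply pow_le]; lra. }
  assert (0 < U ^ 8) by now apply pow_lt.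
  assert (0 < 1600 * U ^ 10) by (apply Rmult_lt_0_compat; [lra|now apply pow_lt]).
  assert (0 < 16 * U ^ 9) by (apply Rmult_lt_0_compat; [lra|now apply pow_lt]).
  assert (0 <= 625 * n ^ 8) by (apply Rmult_le_pos; [lra|now apply pow_le]).
  repeat match goal with
  | |- 0 < _ + _ => apply Rplus_lt_le_0_compat
  end; first [lra | apply Hm; lra | apply Hm1; lra | apply Hm2; lra].
Qed.

(** Here [w = g / (8 U^(5/2))] with [U = x^2 - nu^2] and [g] polynomial in [U];
    [g1] and [48 U + 2] are the first two derivatives of [g] in [U], and
    [dU/dt = 2 (U + nu^2)]. *)
Lemma under_phase_of (nu t0 : R) :
  0 <= nu -> nu <= exp t0 ->
  exists Q, phase_of t0 Q (fun t => theta_tilde nu (exp t) - tilde_correction nu t) /\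
    forall t, t0 < t -> exp (2 * t) - nu ^ 2 < Q t.
Proof.
  intros Hnu Ht0.
  set (n := nu ^ 2). assert (Hn : 0 <= n) by apply pow2_ge_0.
  set (U := fun t => exp (2 * t) - n).
  set (g := fun t => 8 * U t ^ 3 + (U t + n) * (U t + 5 * n)).
  set (g1 := fun t => 24 * U t ^ 2 + 2 * U t + 6 * n).
  set (w := fun t => g t / (8 * (U t ^ 2 * sqrt (U t)))).
  set (l := fun t => 2 * (U t + n) * g1 t / g t - 5 * (U t + n) / U t).
  set (m := fun t => 2 * (U t + n) * (2 * g1 t / g t +
              2 * (U t + n) * ((48 * U t + 2) / g t - g1 t ^ 2 / g t ^ 2) + 5 * n / U t ^ 2)).
  assert (Hpos : forall t, t0 < t -> nu < exp t /\ 0 < U t /\ 0 < g t /\ 0 < sqrt (U t) /\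
             sqrt (U t) * sqrt (U t) = U t).
  { intros t Ht. assert (Hlt : nu < exp t) by (apply exp_increasing in Ht; lra).
    destruct (turning_point_range nu t Hnu Hlt) as [HU _]. fold n in HU. fold (U t) in HU.
    split; [exact Hlt|]. split; [exact HU|]. split; [|split].
    - unfold g. assert (0 < U t ^ 3) by now apply pow_lt. nra.
    - now apply sqrt_lt_R0.
    - apply sqrt_sqrt. lra. }
  exists (fun t => w t ^ 2 + m t / 2 - l t ^ 2 / 4). split.
  - apply phase_of_derivative. intros t Ht.
    destruct (Hpos t Ht) as [Hlt [HU [Hg [Hs Hss]]]].
    assert (EU : forall x, exp (2 * x) + - n = U x) by (intros x; reflexivity).
    assert (Ee : exp (2 * t) = U t + n) by (unfold U; ring).
    split; [|split; [|split]].
    + unfold w. apply Rdiv_lt_0_compat; [exact Hg|].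
      assert (0 < U t ^ 2) by now apply pow_lt. nra.
    + assert (Hc : is_derive (tilde_correction nu) t (sqrt (U t) - w t)).
      { unfold tilde_correction. fold n.
        auto_derive.
        - rewrite EU. repeat split; try exact HU. nra.
        - rewrite !EU, Ee. unfold w, g.
          set (s := sqrt (U t)) in *. rewrite <- Hss. field. nra. }
      replace (w t) with (sqrt (U t) - (sqrt (U t) - w t)) by ring.
      apply (is_derive_minus (fun t => theta_tilde nu (exp t)) (tilde_correction nu));
        [now apply is_derive_theta_tilde|exact Hc].
    + unfold w, l, g1, g, U. auto_derive.
      * rewrite EU. repeat split; try exact HU. apply Rgt_not_eq. repeat apply Rmult_lt_0_compat; lra.
      * rewrite !EU. change (exp (2 * t) - n) with (U t). rewrite Ee.
        unfold g in Hg. set (s := sqrt (U t)) in *. rewrite <- Hss in *. field.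
        split; [lra|nra].
    + unfold l, m, g1, g, U. unfold g, U in Hg. auto_derive.
      * split; [|split; [|exact I]]; simpl in *; [|unfold U in HU; simpl in HU]; lra.
      * change (exp (2 * t) - n) with (U t) in *. rewrite !EU, Ee. field. split; lra.
  - intros t Ht. destruct (Hpos t Ht) as [Hlt [HU [Hg [Hs Hss]]]].
    change (exp (2 * t) - n) with (U t).
    assert (HP := under_polynomial_pos (U t) n HU Hn). cbv zeta in HP.
    fold (g t) (g1 t) in HP.
    assert (E : w t ^ 2 + m t / 2 - l t ^ 2 / 4 - U t =
      (g t ^ 4 - 64 * U t ^ 6 * g t ^ 2
       + 64 * U t ^ 3 * ((U t + n) * (2 * g1 t * g t * U t ^ 2 +
            2 * (U t + n) * ((48 * U t + 2) * g t - g1 t ^ 2) * U t ^ 2 + 5 * n * g t ^ 2))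
       - 16 * U t ^ 3 * (U t + n) ^ 2 * (2 * g1 t * U t - 5 * g t) ^ 2) /
      (64 * U t ^ 5 * g t ^ 2)).
    { replace (w t ^ 2) with (g t ^ 2 / (64 * U t ^ 5)).
      2:{ unfold w. set (s := sqrt (U t)) in *. rewrite <- Hss. field. lra. }
      unfold m, l. field. split; lra. }
    assert (0 < w t ^ 2 + m t / 2 - l t ^ 2 / 4 - U t).
    { rewrite E. apply Rdiv_lt_0_compat; [exact HP|].
      assert (0 < U t ^ 5) by now apply pow_lt. assert (0 < g t ^ 2) by now apply pow_lt. nra. }
    lra.
Qed.

Lemma is_lim_squeeze_zero (f g : R -> R) :
  (exists T, forall t, T < t -> Rabs (f t) <= g t) -> is_lim g p_infty 0 -> is_lim f p_infty 0.
Proof.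
  intros [T HT] Hg.
  apply (is_lim_le_le_loc (fun t => - g t) g).
  - exists T. intros t Ht. specialize (HT t Ht). now apply Rabs_le_between in HT.
  - replace (Finite 0) with (Rbar_opp 0) by (simpl; f_equal; ring). now apply is_lim_opp.
  - exact Hg.
Qed.

Lemma theta_tilde_limit (nu : R) :
  0 <= nu -> is_lim (fun t => theta_tilde nu (exp t) - (exp t - phase_shift nu)) p_infty 0.
Proof.
  intros Hnu.
  assert (H1 : is_lim (fun t => sqrt (exp (2 * t) - nu ^ 2) - exp t) p_infty 0).
  { apply (is_lim_squeeze_zero _ (fun t => nu ^ 2 * exp (- t))).
    - exists (ln (nu + 1)). intros t Ht.
      assert (Hlt : nu < exp t).
      { apply exp_increasing in Ht. rewrite exp_ln in Ht by lra. lra. }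
      destruct (turning_point_range nu t Hnu Hlt) as [HU [E _]].
      pose proof (exp_pos t) as He.
      set (s := sqrt (exp (2 * t) - nu ^ 2)).
      assert (Hs : 0 < s) by now apply sqrt_lt_R0.
      assert (Hss : s * s = exp (2 * t) - nu ^ 2) by (apply sqrt_sqrt; lra).
      assert (Hq : (exp t - s) * (exp t + s) = nu ^ 2) by (rewrite <- E in Hss; nra).
      assert (Hn : 0 <= nu ^ 2) by apply pow2_ge_0.
      assert (He1 : exp t * exp (- t) = 1) by apply exp_mul_opp.
      assert (H0 : 0 <= exp t - s).
      { apply Rnot_lt_le. intros Hx. nra. }
      rewrite Rabs_left1 by lra.
      pose proof (exp_pos (- t)).
      replace (- (s - exp t)) with ((exp t - s) * (exp t * exp (- t))) by (rewrite He1; ring).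
      assert ((exp t - s) * exp t <= nu ^ 2) by nra. nra.
    - replace (Finite 0) with (Rbar_mult (nu ^ 2) 0) by (simpl; f_equal; ring).
      apply is_lim_scal_l, is_lim_exp_opp. }
  assert (H2 : is_lim (fun t => acos (nu / exp t)) p_infty (PI / 2)).
  { rewrite <- acos_0.
    apply (is_lim_comp_continuous (fun t => nu / exp t) acos p_infty 0).
    - replace (Finite 0) with (Rbar_mult nu 0) by (simpl; f_equal; ring).
      eapply is_lim_ext; [|apply (is_lim_scal_l _ nu _ _ is_lim_exp_opp)].
      intros t. cbv beta. rewrite exp_Ropp. reflexivity.
    - apply (ex_derive_continuous acos 0). eexists. apply is_derive_acos. lra. }
  assert (H := is_lim_plus' _ _ _ _ _ H1
    (is_lim_minus' _ _ _ _ _ (is_lim_const (nu * (PI / 2)) p_infty)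
       (is_lim_scal_l _ nu _ _ H2))).
  replace (0 + (nu * (PI / 2) - nu * (PI / 2))) with 0 in H by ring.
  eapply is_lim_ext; [|exact H]. intros t. cbv beta. unfold theta_tilde, phase_shift.
  replace (exp t ^ 2) with (exp (2 * t)).
  - field.
  - replace (2 * t) with (t + t) by ring. rewrite exp_plus. ring.
Qed.

Lemma tilde_correction_limit (nu : R) : is_lim (tilde_correction nu) p_infty 0.
Proof.
  apply (is_lim_squeeze_zero _ (fun t => exp (- t))).
  - exists (2 * Rabs nu). intros t Ht.
    pose proof (exp_ineq1_le t) as He. pose proof (Rabs_pos nu) as Hn0.
    assert (Hn : nu ^ 2 = Rabs nu ^ 2) by (symmetry; apply pow2_abs).
    assert (E : exp (2 * t) = exp t * exp t) by apply exp_double.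
    unfold tilde_correction. rewrite Hn, E.
    set (x := exp t) in *. set (a := Rabs nu) in *.
    assert (Hx : 1 <= x /\ 2 * a <= x) by lra.
    set (U := x * x - a ^ 2).
    assert (HU : x * x <= 2 * U) by (unfold U; nra).
    assert (HU0 : 0 < U) by nra.
    set (s := sqrt U).
    assert (Hs : 0 < s) by now apply sqrt_lt_R0.
    assert (Hss : s * s = U) by (apply sqrt_sqrt; lra).
    assert (Hsx : x <= 2 * s).
    { apply Rnot_lt_le. intros Hlt. nra. }
    assert (Hden : x * x * x <= 4 * (U * s)) by nra.
    replace (exp (- t)) with (/ x) by (unfold x; now rewrite exp_Ropp).
    rewrite Rabs_right.
    + apply (Rmult_le_reg_r (24 * (U * s))); [nra|].
      unfold Rdiv. rewrite Rmult_assoc, Rinv_l, Rmult_1_r by nra.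
      apply (Rmult_le_reg_l x); [lra|].
      replace (x * (/ x * (24 * (U * s)))) with (24 * (U * s)) by (field; lra).
      assert (3 * (x * x) + 2 * a ^ 2 <= 6 * (x * x)) by nra. nra.
    + apply Rle_ge, Rdiv_le_0_compat; [|nra]. pose proof (pow2_ge_0 a). nra.
  - apply is_lim_exp_opp.
Qed.

(** * Positivity of J_nu beyond the turning point *)

(** The first two terms bound the sum from below. *)
Lemma alternating_series_pos (b : nat -> R) :
  (forall k, b (S k) <= b k) -> b 1%nat < b O -> ex_series b ->
  0 < Series (fun k => (-1) ^ k * b k).
Proof.
  intros Hdec H01 Hb.
  assert (Hb0 : Un_cv b 0) by (apply is_lim_seq_Reals, ex_series_lim_0; exact Hb).
  assert (Hpos : forall k, 0 <= b k).
  { intros k. apply (is_lim_seq_decr_compare b 0); [now apply is_lim_seq_Reals|exact Hdec]. }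
  assert (Hex : ex_series (fun k => (-1) ^ k * b k)).
  { apply ex_series_Rabs. eapply ex_series_ext; [|exact Hb]. intros k.
    rewrite Rabs_mult, pow_m1_abs, Rabs_right by (apply Rle_ge, Hpos).
    match goal with |- ?x = ?y => change (@eq R x y) end. ring. }
  assert (Hs := Series_correct _ Hex). apply is_series_Reals in Hs.
  destruct (alternated_series_ineq b _ O Hdec Hb0 Hs) as [H _].
  unfold tg_alt in H. simpl in H. lra.
Qed.

Lemma J_terms (nu t : R) :
  uJ nu t = Series (fun k => (-1) ^ k * (besselI_coef nu k * exp (freq (nu + / 2) k * t))) /\
  exp t * pJ nu t - uJ nu t / 2 =
    Series (fun k => (-1) ^ k * (freq nu k * (besselI_coef nu k * exp (freq (nu + / 2) k * t)))).
Proof.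
  pose proof (exp_type_besselJ nu) as H0.
  assert (E1 : uJ nu t = Series (fun k => (-1) ^ k * (besselI_coef nu k * exp (freq (nu + / 2) k * t)))).
  { unfold uJ, zJ, V. apply Series_ext. intros k. unfold Vterm, besselJ_coef.
    replace (freq (nu + / 2) k * 0 + 0) with 0 by ring. rewrite cos_0. ring. }
  split; [exact E1|].
  unfold pJ. rewrite <- Rmult_assoc, <- exp_plus, Rplus_opp_r, exp_0, Rmult_1_l.
  transitivity (1 * zJ1 nu t 0 0 + (- / 2) * uJ nu t); [field|].
  unfold uJ, zJ, zJ1. rewrite <- V_lin by (try apply exp_type_freq; exact H0).
  unfold V. apply Series_ext. intros k. unfold Vterm, besselJ_coef.
  replace (freq (nu + / 2) k * 0 + 0) with 0 by ring. rewrite cos_0. unfold freq. field.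
Qed.

Lemma besselI_coef_pos (nu : R) (k : nat) : 0 <= nu -> 0 < besselI_coef nu k.
Proof.
  intros Hnu. unfold besselI_coef. apply Rmult_lt_0_compat; [apply Rpower_pos|].
  apply Rdiv_lt_0_compat.
  - apply rgamma_pos. pose proof (pos_INR k). lra.
  - apply Rmult_lt_0_compat; [apply INR_fact_lt_0|apply pow4_pos].
Qed.

Lemma J_term_ratio (nu t : R) (k : nat) :
  4 * INR (S k) * (INR (S k) + nu) * (besselI_coef nu (S k) * exp (freq (nu + / 2) (S k) * t)) =
  exp (2 * t) * (besselI_coef nu k * exp (freq (nu + / 2) k * t)).
Proof.
  assert (H1 := besselI_coef_up nu k). assert (H2 := besselI_coef_down (nu + 1) k).
  replace (nu + 1 - 1) with nu in H2 by ring. rewrite <- H2, <- H1.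
  replace (freq (nu + / 2) (S k) * t) with (2 * t + freq (nu + / 2) k * t).
  2:{ unfold freq. rewrite S_INR. ring. }
  rewrite exp_plus, S_INR. ring.
Qed.

Lemma ex_series_J_terms (nu t : R) :
  ex_series (fun k => besselI_coef nu k * exp (freq (nu + / 2) k * t)).
Proof.
  eapply ex_series_ext; [|exact (exp_type_ex_series _ (exp_type_exp _ (nu + / 2) t (exp_type_besselI nu)))].
  intros k. match goal with |- ?x = ?y => change (@eq R x y) end. cbv beta. ring.
Qed.

Lemma J_pos_small (nu t : R) : 0 <= nu -> exp (2 * t) < 4 * (nu + 1) -> 0 < uJ nu t.
Proof.
  intros Hnu Ht. rewrite (proj1 (J_terms nu t)).
  set (b := fun k => besselI_coef nu k * exp (freq (nu + / 2) k * t)).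
  assert (Hb : forall k, 0 < b k).
  { intros k. apply Rmult_lt_0_compat; [now apply besselI_coef_pos|apply exp_pos]. }
  assert (Hdec : forall k, b (S k) < b k).
  { intros k. assert (H := J_term_ratio nu t k). fold (b k) (b (S k)) in H.
    assert (H1 : 1 <= INR (S k)) by (apply (le_INR 1); lia).
    pose proof (Hb k) as Hk. pose proof (Hb (S k)) as HSk.
    assert (4 * (nu + 1) <= 4 * INR (S k) * (INR (S k) + nu)) by nra.
    apply Rnot_le_lt. intros Hle.
    assert (4 * (nu + 1) * b (S k) <= 4 * INR (S k) * (INR (S k) + nu) * b (S k))
      by (apply Rmult_le_compat_r; lra).
    assert (exp (2 * t) * b k < 4 * (nu + 1) * b k) by (apply Rmult_lt_compat_r; lra).
    assert (4 * (nu + 1) * b k <= 4 * (nu + 1) * b (S k)) by (apply Rmult_le_compat_l; lra).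
    lra. }
    apply (alternating_series_pos b); [intros k; apply Rlt_le, Hdec|apply Hdec|].
  apply ex_series_J_terms.
Qed.

Lemma J_derivative_pos_at_1 (nu : R) : 1 <= nu -> 0 < exp 0 * pJ nu 0 - uJ nu 0 / 2.
Proof.
  intros Hnu. rewrite (proj2 (J_terms nu 0)).
  set (b := fun k => besselI_coef nu k * exp (freq (nu + / 2) k * 0)).
  set (c := fun k => freq nu k * b k).
  change (0 < Series (fun k => (-1) ^ k * c k)).
  assert (Hb : forall k, 0 < b k).
  { intros k. apply Rmult_lt_0_compat; [apply besselI_coef_pos; lra|apply exp_pos]. }
  assert (Hdec : forall k, c (S k) < c k).
  { intros k. assert (H := J_term_ratio nu 0 k). fold (b k) (b (S k)) in H.
    rewrite Rmult_0_r, exp_0, Rmult_1_l in H. rewrite S_INR in H.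
    unfold c, freq. rewrite <- H, S_INR. pose proof (pos_INR k). pose proof (Hb (S k)) as HSk.
    rewrite <- Rmult_assoc. apply Rmult_lt_compat_r; [exact HSk|].
    assert (1 <= 2 * INR k + nu) by lra.
    set (X := 4 * (INR k + 1) * (INR k + 1 + nu)).
    assert (HX : 2 * (INR k + 1) + nu < X) by (unfold X; nra).
    apply Rlt_le_trans with (1 := HX). rewrite <- (Rmult_1_l X) at 1.
    apply Rmult_le_compat_r; lra. }
  apply (alternating_series_pos c); [intros k; apply Rlt_le, Hdec|apply Hdec|].
  assert (He := exp_type_exp _ (nu + / 2) 0 (exp_type_freq _ nu (exp_type_besselI nu))).
  eapply ex_series_ext; [|exact (exp_type_ex_series _ He)].
  intros k. match goal with |- ?x = ?y => change (@eq R x y) end. unfold c, b. ring.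
Qed.

Lemma first_zero (y : R -> R) (a b : R) :
  a <= b -> (forall t, a <= t <= b -> continuity_pt y t) -> 0 < y a -> y b <= 0 ->
  exists z, a < z <= b /\ y z = 0 /\ forall s, a <= s < z -> 0 < y s.
Proof.
  intros Hab Hc Ha Hb.
  set (E := fun t => a <= t <= b /\ forall s, a <= s <= t -> 0 < y s).
  assert (HEa : E a).
  { split; [lra|]. intros s Hs. replace s with a by lra. exact Ha. }
  destruct (completeness E) as [z [Hub Hlub]].
  - exists b. intros t [Ht _]. lra.
  - now exists a.
  - assert (Haz : a <= z) by now apply Hub.
    assert (Hzb : z <= b) by (apply Hlub; intros t [Ht _]; lra).
    assert (Hbelow : forall s, a <= s < z -> 0 < y s).
    { intros s Hs. apply Rnot_le_lt. intros Hle.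
      assert (z <= s); [|lra]. apply Hlub. intros t [Ht Ht'].
      apply Rnot_lt_le. intros Hst. specialize (Ht' s). lra. }
    assert (Hyz : y z = 0).
    { destruct (Rtotal_order (y z) 0) as [Hlt|[|Hgt]]; [exfalso|assumption|exfalso].
      - assert (Haz' : a < z) by (destruct (Req_dec a z) as [<-|]; lra).
        destruct (Hc z ltac:(lra) (- y z) ltac:(lra)) as [d [Hd Hd']].
        set (s := z - Rmin (d / 2) (z - a)).
        assert (H1 := Rmin_l (d / 2) (z - a)). assert (H2 := Rmin_r (d / 2) (z - a)).
        assert (H3 : 0 < Rmin (d / 2) (z - a)) by (apply Rmin_glb_lt; lra).
        assert (Hs := Hbelow s ltac:(unfold s; lra)).
        assert (Hx : Rabs (y s - y z) < - y z).
        { apply (Hd' s). split.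
          - split; [exact I|unfold s; lra].
          - simpl. unfold Rdist, s. rewrite Rabs_left1; lra. }
        apply Rabs_def2 in Hx. lra.
      - assert (Hzb' : z < b) by (destruct (Req_dec z b) as [->|]; lra).
        destruct (Hc z ltac:(lra) (y z) Hgt) as [d [Hd Hd']].
        set (s := z + Rmin (d / 2) (b - z)).
        assert (H1 := Rmin_l (d / 2) (b - z)). assert (H2 := Rmin_r (d / 2) (b - z)).
        assert (H3 : 0 < Rmin (d / 2) (b - z)) by (apply Rmin_glb_lt; lra).
        assert (HEs : E s).
        { split; [unfold s; lra|]. intros x Hx.
          destruct (Rtotal_order x z) as [Hlt|[->|Hxz]]; [apply Hbelow; lra|exact Hgt|].
          assert (Hy : Rabs (y x - y z) < y z).
          { apply (Hd' x). split.
            - split; [exact I|lra].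
            - simpl. unfold Rdist, s in *. rewrite Rabs_right; lra. }
          apply Rabs_def2 in Hy. lra. }
        assert (s <= z) by now apply Hub. unfold s in *. lra. }
    exists z. split; [|split; [exact Hyz|exact Hbelow]].
    split; [|exact Hzb]. destruct (Req_dec a z) as [<-|]; lra.
Qed.

(** A solution that starts above a positive supersolution [c], in the sense of
    the Wronskian, stays positive: as long as it is positive, [y / c] does not
    decrease. *)
Lemma positivity_persists (y y' y'' c c' c'' : R -> R) (a b : R) :
  a <= b ->
  (forall t, a <= t <= b -> is_derive y t (y' t) /\ is_derive y' t (y'' t) /\
                            is_derive c t (c' t) /\ is_derive c' t (c'' t) /\ 0 < c t) ->
  (forall t, a <= t <= b -> 0 < y t -> 0 <= y'' t * c t - y t * c'' t) ->
  0 < y a -> 0 <= y' a * c a - y a * c' a ->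
  (forall t, a <= t <= b -> 0 < y t) /\ 0 <= y' b * c b - y b * c' b.
Proof.
  intros Hab HD HK Ha HKa.
  assert (HDK : forall t, a <= t <= b ->
            is_derive (fun t => y' t * c t - y t * c' t) t (y'' t * c t - y t * c'' t)).
  { intros t Ht. destruct (HD t Ht) as [D1 [D2 [D3 [D4 _]]]].
    auto_derive; [repeat split; eexists; eassumption|].
    derive_values.
    ring. }
  assert (HKmono : forall z, a <= z <= b -> (forall s, a < s < z -> 0 < y s) ->
            0 <= y' z * c z - y z * c' z).
  { intros z Hz Hp.
    apply Rle_trans with (1 := HKa).
    apply (nondecreasing_of_derive (fun t => y' t * c t - y t * c' t) _ a z ltac:(lra)
             (fun t Ht => HDK t ltac:(lra))).
    intros t Ht. apply HK; [lra|now apply Hp]. }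
  assert (Hpos : forall t, a <= t <= b -> 0 < y t).
  { intros t Ht. apply Rnot_le_lt. intros Hle.
    destruct (first_zero y a t ltac:(lra)) as [z [Hz [Hyz Hbelow]]]; [|exact Ha|exact Hle|].
    { intros s Hs. apply derivable_continuous_pt. exists (y' s). apply is_derive_Reals, HD. lra. }
    assert (Hq : y a / c a <= y z / c z).
    { apply (nondecreasing_of_derive (fun t => y t / c t)
               (fun t => (y' t * c t - y t * c' t) / c t ^ 2) a z ltac:(lra)).
      - intros s Hs. destruct (HD s ltac:(lra)) as [D1 [D2 [D3 [D4 Hc]]]].
        auto_derive; [repeat split; try (eexists; eassumption); lra|].
        derive_values.
        field. lra.
      - intros s Hs. apply Rdiv_le_0_compat.
        + apply HKmono; [lra|]. intros x Hx. apply Hbelow. lra.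
        + apply pow_lt, HD. lra. }
    rewrite Hyz in Hq. destruct (HD a ltac:(lra)) as [_ [_ [_ [_ Hca]]]].
    assert (0 < y a / c a) by now apply Rdiv_lt_0_compat.
    unfold Rdiv in Hq at 2. lra. }
  split; [exact Hpos|]. apply HKmono; [lra|]. intros s Hs. apply Hpos. lra.
Qed.

(** [J_nu] has no zero up to a point whose distance to the turning point is of
    order [nu^(1/3)] for large [nu], where the correction term is already small. *)
Lemma J_positive_past_turning_point (nu : R) :
  0 <= nu ->
  exists t1, nu < exp t1 /\ tilde_correction nu t1 <= 7 / 12 /\ forall t, t <= t1 -> 0 < uJ nu t.
Proof.
  intros Hnu. destruct (Rle_dec nu 1) as [Hle|Hgt].
  - (* Small order: the alternating series suffices up to [x = nu + 1]. *)
    exists (ln (nu + 1)).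
    assert (E : exp (2 * ln (nu + 1)) = (nu + 1) * (nu + 1)).
    { replace (2 * ln (nu + 1)) with (ln (nu + 1) + ln (nu + 1)) by ring.
      rewrite exp_plus, exp_ln by lra. ring. }
    split; [rewrite exp_ln; lra|]. split.
    + unfold tilde_correction. rewrite E.
      replace ((nu + 1) * (nu + 1) - nu ^ 2) with (2 * nu + 1) by ring.
      assert (Hs : 1 <= sqrt (2 * nu + 1)) by (rewrite <- sqrt_1 at 1; apply sqrt_le_1_alt; lra).
      assert (Hden : 1 <= (2 * nu + 1) * sqrt (2 * nu + 1)) by nra.
      apply (Rmult_le_reg_r (24 * ((2 * nu + 1) * sqrt (2 * nu + 1)))); [lra|].
      unfold Rdiv at 1. rewrite Rmult_assoc, Rinv_l, Rmult_1_r by lra. nra.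
    + intros t Ht. apply J_pos_small; [exact Hnu|].
      apply Rle_lt_trans with (exp (2 * ln (nu + 1))); [apply exp_nondecreasing; lra|].
      rewrite E. nra.
  - (* The endpoint is given by [x^2 - nu^2 = k^2 = nu^(4/3)].  Below the turning
       point [y] is compared with the constant 1; beyond it the potential is at
       most [k^2], and [y] is compared with [cos (k (t - tn))] over a length of at
       most [1 / (2 k)]. *)
    set (k := Rpower nu (2 / 3)).
    assert (Hk3 : k * (k * k) = nu * nu).
    { unfold k. rewrite <- !Rpower_plus. replace (2 / 3 + (2 / 3 + 2 / 3)) with (1 + 1) by field.
      rewrite Rpower_plus, Rpower_1 by lra. reflexivity. }
    assert (Hk1 : 1 <= k).
    { unfold k. rewrite <- (Rpower_O nu) by lra. apply Rle_Rpower; lra. }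
    set (tn := ln nu). set (t1 := ln (nu * nu + k * k) / 2).
    assert (Etn : exp tn = nu) by (apply exp_ln; lra).
    assert (Etn2 : exp (2 * tn) = nu * nu).
    { replace (2 * tn) with (tn + tn) by ring. now rewrite exp_plus, Etn. }
    assert (Et1 : exp (2 * t1) = nu * nu + k * k).
    { unfold t1. replace (2 * (ln (nu * nu + k * k) / 2)) with (ln (nu * nu + k * k)) by field.
      apply exp_ln. nra. }
    assert (Htn0 : 0 <= tn).
    { unfold tn. rewrite <- ln_1. apply Rlt_le, ln_increasing; lra. }
    assert (Htn1 : tn < t1).
    { apply Rnot_le_lt. intros Hx. assert (exp (2 * t1) <= exp (2 * tn)).
      { apply exp_nondecreasing. lra. }
      rewrite Etn2, Et1 in H. nra. }
    assert (Hwidth : k * (t1 - tn) <= / 2).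
    { assert (Hx : t1 <= tn + / (2 * k)).
      { apply Rnot_lt_le. intros Hx.
        assert (Hexp : exp (2 * (tn + / (2 * k))) < exp (2 * t1)) by (apply exp_increasing; lra).
        replace (2 * (tn + / (2 * k))) with (2 * tn + / k) in Hexp by (field; lra).
        rewrite exp_plus, Etn2, Et1, <- Hk3 in Hexp.
        assert (Hi := exp_ineq1_le (/ k)).
        assert (Hki : k * / k = 1) by (apply Rinv_r; lra).
        assert (k * (k * k) * (1 + / k) <= k * (k * k) * exp (/ k)) by (apply Rmult_le_compat_l; nra).
        replace (k * (k * k) * (1 + / k)) with (k * (k * k) + k * k * (k * / k)) in H by ring.
        rewrite Hki in H. lra. }
      apply Rle_trans with (k * / (2 * k)); [apply Rmult_le_compat_l; lra|].
      right. field. lra. }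
    set (y := fun t => exp (- (t / 2)) * uJ nu t).
    set (y' := fun t => exp (- (t / 2)) * (exp t * pJ nu t - uJ nu t / 2)).
    set (y'' := fun t => - ((exp (2 * t) - nu ^ 2) * y t)).
    assert (HD : forall t, is_derive y t (y' t) /\ is_derive y' t (y'' t)).
    { intros t. exact (solution_second_order nu _ _ (J_solution nu) t). }
    destruct (positivity_persists y y' y'' (fun _ => 1) (fun _ => 0) (fun _ => 0) 0 tn Htn0)
      as [HposA HA].
    { intros t _. destruct (HD t) as [D1 D2]. split; [exact D1|]. split; [exact D2|].
      split; [apply @is_derive_const|]. split; [apply @is_derive_const|lra]. }
    { intros t Ht Hy. unfold y''.
      assert (exp (2 * t) <= nu * nu) by (rewrite <- Etn2; apply exp_nondecreasing; lra). nra. }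
    { unfold y. apply Rmult_lt_0_compat; [apply exp_pos|]. apply J_pos_small; [lra|].
      rewrite Rmult_0_r, exp_0. lra. }
    { unfold y'. pose proof (J_derivative_pos_at_1 nu ltac:(lra)).
      pose proof (exp_pos (- (0 / 2))). nra. }
    destruct (positivity_persists y y' y'' (fun t => cos (k * (t - tn)))
                (fun t => - (k * sin (k * (t - tn)))) (fun t => - (k * (k * cos (k * (t - tn)))))
                tn t1 ltac:(lra)) as [HposB _].
    { intros t Ht. destruct (HD t) as [D1 D2]. split; [exact D1|]. split; [exact D2|].
      assert (Es : t + - tn = t - tn) by ring.
      split; [auto_derive; [exact I|rewrite Es; ring]|].
      split; [auto_derive; [exact I|rewrite Es; ring]|].
      pose proof PI2_1. apply cos_gt_0; nra. }
    { intros t Ht Hy. unfold y''.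
      assert (Hc : 0 < cos (k * (t - tn))) by (pose proof PI2_1; apply cos_gt_0; nra).
      assert (He : exp (2 * t) <= nu * nu + k * k) by (rewrite <- Et1; apply exp_nondecreasing; lra).
      replace (- ((exp (2 * t) - nu ^ 2) * y t) * cos (k * (t - tn)) -
               y t * - (k * (k * cos (k * (t - tn)))))
        with ((nu * nu + k * k - exp (2 * t)) * (y t * cos (k * (t - tn)))) by ring.
      apply Rmult_le_pos; [lra|]. apply Rlt_le, Rmult_lt_0_compat; lra. }
    { apply HposA. lra. }
    { rewrite Rminus_diag, Rmult_0_r, sin_0, cos_0. lra. }
    exists t1.
    assert (Hexp1 : nu < exp t1) by (rewrite <- Etn; now apply exp_increasing).
    split; [exact Hexp1|]. split.
    + unfold tilde_correction. rewrite Et1.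
      replace (nu * nu + k * k - nu ^ 2) with (k * k) by ring.
      rewrite sqrt_square by lra. replace (k * k * k) with (nu * nu) by (rewrite <- Hk3; ring).
      apply (Rmult_le_reg_r (24 * (nu * nu))); [nra|].
      unfold Rdiv at 1. rewrite Rmult_assoc, Rinv_l, Rmult_1_r by nra.
      assert (k * k <= nu * nu) by (rewrite <- Hk3; nra). nra.
    + intros t Ht.
      assert (Hy : 0 < y t \/ t < 0).
      { destruct (Rle_dec 0 t) as [H0|H0]; [left|right; lra].
        destruct (Rle_dec t tn); [apply HposA|apply HposB]; lra. }
      destruct Hy as [Hy|Hy].
      * unfold y in Hy. pose proof (exp_pos (- (t / 2))).
        apply Rnot_le_lt. intros Hx. nra.
      * apply J_pos_small; [lra|].
        assert (exp (2 * t) <= exp 0) by (apply exp_nondecreasing; lra). rewrite exp_0 in H. lra.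
Qed.

(** * The enclosure of the Bessel phase *)

(** With [nu = x cos b] this is [sin b >= b cos b]. *)
Lemma theta_tilde_ge (nu t : R) :
  0 <= nu -> nu < exp t -> - (PI / 4) <= theta_tilde nu (exp t).
Proof.
  intros Hnu Ht. destruct (turning_point_range nu t Hnu Ht) as [HU [E Hq]].
  pose proof (exp_pos t) as He.
  unfold theta_tilde. set (y := nu / exp t) in *. set (b := acos y).
  assert (Hcos : cos b = y) by (apply cos_acos; lra).
  assert (Hb : 0 <= b <= PI) by apply acos_bound.
  assert (Hsin : 0 <= sin b) by (apply sin_ge_0; lra).
  assert (Enu : nu = exp t * cos b) by (rewrite Hcos; unfold y; field; lra).
  assert (Es : sqrt (exp t ^ 2 - nu ^ 2) = exp t * sin b).
  { replace (exp t ^ 2 - nu ^ 2) with ((exp t * sin b) * (exp t * sin b)).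
    - apply sqrt_square. nra.
    - rewrite Enu. pose proof (sin_sq b) as Hs. ring [Hs]. }
  assert (Hmain : sin 0 - 0 * cos 0 <= sin b - b * cos b).
  { apply (nondecreasing_of_derive (fun z => sin z - z * cos z) (fun z => z * sin z) 0 b (proj1 Hb)).
    - intros z _. auto_derive; [exact I|ring].
    - intros z Hz. apply Rmult_le_pos; [lra|]. apply sin_ge_0; lra. }
  rewrite sin_0, Rmult_0_l, Rminus_0_r in Hmain.
  rewrite Es. rewrite Enu at 1.
  assert (0 <= exp t * (sin b - b * cos b)) by (apply Rmult_le_pos; lra).
  lra.
Qed.

Lemma is_lim_infinity_of_asymptote (f : R -> R) (c d : R) :
  is_lim (fun t => f t - (exp t - c)) p_infty d -> is_lim f p_infty p_infty.
Proof.
  intros H. apply is_lim_spec. intros M. apply is_lim_spec in H.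
  destruct (H (mkposreal 1 Rlt_0_1)) as [T HT]. simpl in HT.
  exists (Rmax T (M + c + Rabs d)). intros t Ht.
  assert (Ht1 : T < t) by (apply Rle_lt_trans with (2 := Ht); apply Rmax_l).
  assert (Ht2 : M + c + Rabs d < t) by (apply Rle_lt_trans with (2 := Ht); apply Rmax_r).
  specialize (HT t Ht1). apply Rabs_def2 in HT.
  pose proof (exp_ineq1_le t). pose proof (Rle_abs (- d)). rewrite Rabs_Ropp in H1. lra.
Qed.

Lemma between_turning_point (nu t : R) :
  0 <= nu -> nu < exp t -> exists t0, nu <= exp t0 /\ t0 < t.
Proof.
  intros Hnu Ht. exists (ln ((nu + exp t) / 2)). split.
  - rewrite exp_ln by lra. lra.
  - rewrite <- (ln_exp t) at 2. apply ln_increasing; lra.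
Qed.

(** Both bounds relative to the limit [d] of the deviation from the expected
    asymptotics, which is later shown to be 0. *)
Lemma bessel_phase_enclosure_mod (nu : R) (theta : R -> R) (d : R) :
  0 <= nu -> is_bessel_phase nu theta ->
  is_lim (fun t => theta (exp t) - (exp t - phase_shift nu)) p_infty d ->
  forall t, nu < exp t ->
    theta_tilde nu (exp t) - tilde_correction nu t + d < theta (exp t) <
    theta_tilde nu (exp t) + d.
Proof.
  intros Hnu Hth Hd t Ht.
  destruct (between_turning_point nu t Hnu Ht) as [t0 [Ht0 Htt0]].
  assert (HB := bessel_phase_of nu t0 theta Hth).
  assert (Htl := theta_tilde_limit nu Hnu). assert (Hcl := tilde_correction_limit nu).
  destruct (tilde_phase_of nu t0 Hnu Ht0) as [Q1 [HP1 HQ1]].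
  destruct (under_phase_of nu t0 Hnu Ht0) as [Q2 [HP2 HQ2]].
  assert (Hbelow : is_lim (fun t => theta_tilde nu (exp t) - tilde_correction nu t + d -
                                    (exp t - phase_shift nu)) p_infty d).
  { assert (H := is_lim_plus' _ _ _ _ _ (is_lim_minus' _ _ _ _ _ Htl Hcl) (is_lim_const d p_infty)).
    replace (0 - 0 + d) with d in H by ring.
    eapply is_lim_ext; [|exact H]. intros s. cbv beta. ring. }
  split.
  - apply (phase_comparison t0 Q2 (fun t => exp (2 * t) - nu ^ 2)
             (fun t => theta_tilde nu (exp t) - tilde_correction nu t + d)
             (fun t => theta (exp t)) t).
    + exact (phase_of_shift _ d _ _ HP2).
    + exact HB.
    + exact HQ2.
    + exact (is_lim_infinity_of_asymptote _ _ _ Hbelow).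
    + assert (H := is_lim_minus' _ _ _ _ _ Hd Hbelow). rewrite Rminus_diag in H.
      eapply is_lim_ext; [|exact H]. intros s. cbv beta. ring.
    + exact Htt0.
  - apply (phase_comparison t0 (fun t => exp (2 * t) - nu ^ 2) Q1
             (fun t => theta (exp t)) (fun t => theta_tilde nu (exp t) + d) t).
    + exact HB.
    + exact (phase_of_shift _ d _ _ HP1).
    + exact HQ1.
    + exact (is_lim_infinity_of_asymptote _ _ _ Hd).
    + assert (H := is_lim_minus' _ _ _ _ _ (is_lim_plus' _ _ _ _ _ Htl (is_lim_const d p_infty)) Hd).
      replace (0 + d - d) with 0 in H by ring.
      eapply is_lim_ext; [|exact H]. intros s. cbv beta. ring.
    + exact Htt0.
Qed.

Lemma bessel_phase_lt_before_zero (nu : R) (theta : R -> R) (t1 : R) :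
  is_bessel_phase nu theta -> (forall t, t <= t1 -> 0 < uJ nu t) -> theta (exp t1) < PI / 2.
Proof.
  intros Hth HJ. pose proof PI_RGT_0. apply Rnot_le_lt. intros Hle.
  destruct (bessel_phase_near_zero nu theta (PI / 2) t1 Hth) as [s [Hs Hb]]; [lra|].
  apply Rabs_def2 in Hb.
  destruct (ivt_increasing (fun t => theta (exp t)) s t1 (PI / 2) Hs) as [c [Hc Ec]].
  - intros t _. now apply (bessel_phase_continuity nu).
  - lra.
  - destruct (bessel_phase_polar nu theta Hth) as [v [q [N [_ [_ HN]]]]].
    destruct (HN c) as [_ [Eu _]]. specialize (HJ c ltac:(lra)).
    rewrite Ec, cos_PI2 in Eu. lra.
Qed.

(** The asymptotic phase carries no extra full turn.  A negative one contradicts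
    [theta > -pi/2] near the turning point; a positive one would force a zero of
    [J_nu] in the range where [J_nu] is still positive. *)
Lemma bessel_phase_asymptotic (nu : R) (theta : R -> R) :
  0 <= nu -> is_bessel_phase nu theta ->
  is_lim (fun t => theta (exp t) - (exp t - phase_shift nu)) p_infty 0.
Proof.
  intros Hnu Hth. destruct (bessel_phase_limit nu theta Hth) as [k Hk].
  assert (Henc := bessel_phase_enclosure_mod nu theta _ Hnu Hth Hk).
  assert (HPI : 2 < PI) by (pose proof PI2_1; lra).
  assert (Hlow : -1 < IZR k).
  { (* At this point [x^2 - nu^2 = 1], so [theta_tilde <= 1 - pi/4]. *)
    set (t := ln (sqrt (nu ^ 2 + 1))).
    assert (Hs : nu < sqrt (nu ^ 2 + 1)).
    { rewrite <- (sqrt_pow2 nu Hnu) at 1. apply sqrt_lt_1_alt. pose proof (pow2_ge_0 nu). lra. }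
    assert (Et : exp t = sqrt (nu ^ 2 + 1)) by (apply exp_ln; lra).
    assert (Ht : nu < exp t) by (rewrite Et; exact Hs).
    destruct (Henc t Ht) as [_ H1]. pose proof (bessel_phase_gt nu theta Hth t) as H2.
    assert (H3 : theta_tilde nu (exp t) <= 1 - PI / 4).
    { unfold theta_tilde. replace (exp t ^ 2 - nu ^ 2) with 1.
      2:{ rewrite Et, pow2_sqrt by (pose proof (pow2_ge_0 nu); lra). ring. }
      rewrite sqrt_1.
      destruct (turning_point_range nu t Hnu Ht) as [_ [_ Hq]].
      pose proof (acos_bound (nu / exp t)). nra. }
    nra. }
  assert (Hup : IZR k < 1).
  { destruct (J_positive_past_turning_point nu Hnu) as [t1 [Ht1 [Hcor HJ]]].
    destruct (Henc t1 Ht1) as [H1 _].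
    pose proof (bessel_phase_lt_before_zero nu theta t1 Hth HJ).
    pose proof (theta_tilde_ge nu t1 Hnu Ht1). nra. }
  assert (k = 0%Z).
  { assert ((-1 < k)%Z) by now apply lt_IZR. assert ((k < 1)%Z) by now apply lt_IZR. lia. }
  subst k. now rewrite Rmult_0_r in Hk.
Qed.

Theorem theorem1p4 :
  forall (nu : R) (theta : R -> R),
    0 <= nu -> is_bessel_phase nu theta ->
    forall x : R, nu < x ->
      Rmax (theta_under nu x) (- (PI / 2)) < theta x < theta_tilde nu x.
Proof.
  intros nu theta Hnu Hth x Hx.
  assert (Ex : exp (ln x) = x) by (apply exp_ln; lra).
  rewrite <- Ex in Hx |- *.
  assert (Henc := bessel_phase_enclosure_mod nu theta 0 Hnu Hth
                    (bessel_phase_asymptotic nu theta Hnu Hth) (ln x) Hx).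
  rewrite theta_under_eq by assumption.
  split; [|lra].
  apply Rmax_lub_lt; [lra|]. now apply (bessel_phase_gt nu).
Qed.
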